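(* Let $K$ be a number field, let $W\subset K^\times/K^{\times2}$ be an $\mathbb{F}_2$-subspace of dimension $r$, and let $u_0\in K^\times/K^{\times2}$. Let $\lambda_1,\dots,\lambda_r$ be local Hilbert-symbol functionals, $\lambda_i=\lambda_{w_i,b_i}$ with $w_i$ a finite place of $K$ and $b_i\in K_{w_i}^\times/K_{w_i}^{\times2}$, chosen so that $$\Lambda_W=(\lambda_1,\dots,\lambda_r):W\longrightarrow\mathbb{F}_2^r$$ is an isomorphism (such a choice always exists). Then the restriction of the same local functionals to the affine coset $u_0+W$ defines an affine isomorphism $$\Lambda_{u_0+W}:u_0+W\longrightarrow\Lambda_{u_0+W}(u_0)+\mathbb{F}_2^r,\qquad u\longmapsto(\lambda_i(u))_{i=1}^r.$$ Equivalently, the $2^r$ candidates in $u_0+W$ are uniquely determined by the $r$ local Hilbert-symbol bits $\lambda_1(u),\dots,\lambda_r(u)$.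
   Context: $K^\times/K^{\times2}$ is viewed additively as an $\mathbb{F}_2$-vector space. For a finite place $w$ of $K$ and $b\in K_w^\times/K_w^{\times2}$, the local Hilbert-symbol functional $\lambda_{w,b}:K^\times/K^{\times2}\to\mathbb{F}_2$ is defined by $\lambda_{w,b}(u)=0$ if $(u,b)_w=1$ and $\lambda_{w,b}(u)=1$ if $(u,b)_w=-1$, where $(\cdot,\cdot)_w$ is the quadratic Hilbert symbol of the completion $K_w$ ($(a,b)_w=1$ iff $a$ is a norm from $K_w(\sqrt b)$), evaluated on the image of $u$ in $K_w^\times/K_w^{\times2}$. An affine isomorphism between cosets of $\mathbb{F}_2$-vector spaces is a bijection that is a translate of a linear isomorphism. *)

(* Defs.v *)
From HB Require Import structures.
From mathcomp Require Import all_boot all_order all_algebra all_field ring.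
From mathcomp Require Import boolp classical_sets functions.

Set Implicit Arguments.
Unset Strict Implicit.
Unset Printing Implicit Defensive.

Import Order.TTheory GRing.Theory Num.Theory.

Local Open Scope ring_scope.
Local Open Scope quotient_scope.

(* F^* / F^*2 is written additively below: the sum of two square classes is the
   class of the product. *)
Definition nonzero (F : fieldType) := {x : F | x != 0}.
Definition Nonzero (F : fieldType) (x : F) (x0 : x != 0) : nonzero F := exist _ x x0.

Section SquareClass.
Variable F : fieldType.
Implicit Types x y z : nonzero F.

Definition same_sqclass x y : bool := `[< exists z : F, val x = val y * z ^+ 2 >].

Lemma same_sqclass_is_equiv : equiv_class_of same_sqclass.
Proof.
split=> [x|x y|y x z].
- by apply/asboolP; exists 1; rewrite expr1n mulr1.
- have sym (a b : nonzero F) : same_sqclass a b -> same_sqclass b a.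
    move=> /asboolP[z e]; apply/asboolP; exists z^-1.
    have z0 : z ^+ 2 != 0.
      by apply: contraNneq (valP a) => z0; rewrite e z0 mulr0.
    by rewrite e exprVn mulfK.
  by apply/idP/idP; apply: sym.
- move=> /asboolP[a e] /asboolP[b e']; apply/asboolP; exists (b * a).
  by rewrite e e' exprMn -mulrA.
Qed.

Canonical same_sqclass_equiv := EquivRelPack same_sqclass_is_equiv.

Definition sqclass := {eq_quot same_sqclass}.
HB.instance Definition _ := Choice.on sqclass.
HB.instance Definition _ : EqQuotient _ same_sqclass sqclass :=
  EqQuotient.on sqclass.

Lemma eq_sqclassP x y :
  reflect (exists z : F, val x = val y * z ^+ 2) (x == y %[mod sqclass]).
Proof. by rewrite eqmodE; apply: asboolP. Qed.

Definition nonzero1 : nonzero F := Nonzero (oner_neq0 F).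
Definition nonzeroM x y : nonzero F := Nonzero (mulf_neq0 (valP x) (valP y)).

Definition sqclass0 : sqclass := \pi_sqclass nonzero1.
Definition sqclass_add (u v : sqclass) : sqclass :=
  \pi_sqclass (nonzeroM (repr u) (repr v)).

Lemma pi_nonzeroM x y :
  sqclass_add (\pi_sqclass x) (\pi_sqclass y) = \pi_sqclass (nonzeroM x y).
Proof.
apply/eqP/eq_sqclassP => /=.
have /eq_sqclassP[a ->] : repr (\pi_sqclass x) == x %[mod sqclass].
  by rewrite reprK.
have /eq_sqclassP[b ->] : repr (\pi_sqclass y) == y %[mod sqclass].
  by rewrite reprK.
by exists (a * b); rewrite exprMn mulrACA.
Qed.

Lemma sqclass_addA : associative sqclass_add.
Proof.
elim/quotW=> x; elim/quotW=> y; elim/quotW=> z.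
rewrite (pi_nonzeroM y z) (pi_nonzeroM x y) !pi_nonzeroM.
by congr (\pi_sqclass _); apply: val_inj; rewrite /= mulrA.
Qed.

Lemma sqclass_addC : commutative sqclass_add.
Proof.
elim/quotW=> x; elim/quotW=> y; rewrite (pi_nonzeroM x y) (pi_nonzeroM y x).
by congr (\pi_sqclass _); apply: val_inj; rewrite /= mulrC.
Qed.

Lemma sqclass_add0 : left_id sqclass0 sqclass_add.
Proof.
elim/quotW=> x; rewrite pi_nonzeroM.
by congr (\pi_sqclass _); apply: val_inj; rewrite /= mul1r.
Qed.

Lemma sqclass_addxx u : sqclass_add u u = sqclass0.
Proof.
elim/quotW: u => x; rewrite pi_nonzeroM; apply/eqP/eq_sqclassP.
by exists (val x); rewrite /= mul1r.
Qed.

HB.instance Definition _ := GRing.isZmodule.Build sqclass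
  sqclass_addA sqclass_addC sqclass_add0 sqclass_addxx.

Lemma sqclass_mulrn_mod2 (u : sqclass) n : u *+ (n %% 2) = u *+ n.
Proof.
have u2 : u *+ 2 = 0 by rewrite mulr2n; exact: sqclass_addxx.
by rewrite {2}(divn_eq n 2) mulrnDr mulnC mulrnA u2 mul0rn add0r.
Qed.

Definition sqclass_scale (a : 'F_2) (u : sqclass) : sqclass := u *+ val a.

Lemma sqclass_scaleA a b u :
  sqclass_scale a (sqclass_scale b u) = sqclass_scale (a * b) u.
Proof.
by rewrite /sqclass_scale -mulrnA mulnC -[RHS]sqclass_mulrn_mod2 modn_mod
           sqclass_mulrn_mod2.
Qed.

Lemma sqclass_scale1 : left_id 1 sqclass_scale.
Proof. by move=> u; exact: mulr1n. Qed.

Lemma sqclass_scaleDr : right_distributive sqclass_scale +%R.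
Proof. by move=> a u v; exact: mulrnDl. Qed.

Lemma sqclass_scaleDl u : {morph sqclass_scale^~ u : a b / a + b}.
Proof.
by move=> a b; rewrite /sqclass_scale -mulrnDr -[LHS]sqclass_mulrn_mod2 modn_mod
                   sqclass_mulrn_mod2.
Qed.

HB.instance Definition _ := GRing.Zmodule_isLmodule.Build 'F_2 sqclass
  sqclass_scaleA sqclass_scale1 sqclass_scaleDr sqclass_scaleDl.

End SquareClass.

Section SquareClassMap.
Variables (F E : fieldType) (f : {rmorphism F -> E}).

Definition nonzero_map (x : nonzero F) : nonzero E :=
  Nonzero (etrans (congr1 negb (fmorph_eq0 f (val x))) (valP x)).

Definition sqclass_map (u : sqclass F) : sqclass E :=
  \pi_(sqclass E) (nonzero_map (repr u)).

Lemma sqclass_map_pi x : sqclass_map (\pi_(sqclass F) x) = \pi_(sqclass E) (nonzero_map x).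
Proof.
apply/eqP/eq_sqclassP.
have /eq_sqclassP[z] : repr (\pi_(sqclass F) x) == x %[mod sqclass F] by rewrite reprK.
by move=> /= ->; exists (f z); rewrite rmorphM rmorphXn.
Qed.

End SquareClassMap.

(* A finite place of a number field is given by the unique normalized discrete
   valuation in its class; the value at 0 is never used. *)
Record finite_place (K : fieldType) := FinitePlace {
  place_val :> K -> int;
  place_valM : forall x y : K,
    x != 0 -> y != 0 -> place_val (x * y) = place_val x + place_val y;
  place_valD : forall x y : K, x != 0 -> y != 0 -> x + y != 0 ->
    Num.min (place_val x) (place_val y) <= place_val (x + y);
  place_val_surj : forall n : int, exists2 x : K, x != 0 & place_val x = n
}.

Section Completion.
Variables (K : fieldType) (w : finite_place K).
Implicit Types (x y : K) (s t : nat -> K) (N : int).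

Definition val_ge N x : bool := (x == 0) || (N <= w x).

Lemma val_ge0 N : val_ge N 0. Proof. by rewrite /val_ge eqxx. Qed.

Lemma place_val1 : w 1 = 0.
Proof.
have := place_valM w (oner_neq0 K) (oner_neq0 K).
by rewrite mulr1 -{1}[w 1]addr0 => /addrI.
Qed.

Lemma place_valN x : x != 0 -> w (- x) = w x.
Proof.
move=> x0; have n1 : -1 != 0 :> K by rewrite oppr_eq0 oner_eq0.
have := place_valM w n1 n1; rewrite mulrNN mulr1 place_val1 => /eqP.
rewrite -mulr2n eq_sym mulrn_eq0 /= => /eqP wN1.
by rewrite -mulN1r place_valM // wN1 add0r.
Qed.

Lemma val_geN N x : val_ge N (- x) = val_ge N x.
Proof. by rewrite /val_ge oppr_eq0; case: eqVneq => //= /place_valN ->. Qed.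

Lemma val_geD N x y : val_ge N x -> val_ge N y -> val_ge N (x + y).
Proof.
rewrite /val_ge; case: eqVneq => [->|x0] /=; first by rewrite add0r.
case: (eqVneq y 0) => [->|y0] /=; first by rewrite addr0 => -> _; rewrite orbT.
move=> Nx Ny; case: eqVneq => //= xy0.
by apply: le_trans (place_valD w x0 y0 xy0); rewrite le_min Nx.
Qed.

Lemma val_geB N x y : val_ge N x -> val_ge N y -> val_ge N (x - y).
Proof. by move=> Nx Ny; rewrite val_geD ?val_geN. Qed.

Lemma val_geM N M x y : val_ge N x -> val_ge M y -> val_ge (N + M) (x * y).
Proof.
rewrite /val_ge mulf_eq0; case: eqVneq => //= x0; case: eqVneq => //= y0.
by rewrite place_valM //; exact: lerD.
Qed.

Definition is_cauchy s : Prop :=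
  forall N, exists M : nat, forall m n, (M <= m)%N -> (M <= n)%N ->
    val_ge N (s m - s n).

Definition is_null s : Prop :=
  forall N, exists M : nat, forall n, (M <= n)%N -> val_ge N (s n).

Definition cauchy_pred : {pred nat -> K} := fun s => `[< is_cauchy s >].

Lemma is_cauchy_bounded s : is_cauchy s ->
  exists B M, forall n, (M <= n)%N -> val_ge B (s n).
Proof.
move=> /(_ 0)[M sM]; exists (Num.min 0 (w (s M))), M => n Mn.
rewrite -(subrK (s M) (s n)); apply: val_geD.
  have := sM n M Mn (leqnn M); rewrite /val_ge => /orP[->//|p].
  by rewrite ge_min p orbT.
by rewrite /val_ge ge_min lexx !orbT.
Qed.

Lemma cauchy_subring : subring_closed cauchy_pred.
Proof.
split=> [|s t /asboolP cs /asboolP ct|s t /asboolP cs /asboolP ct]; apply/asboolP.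
- by move=> N; exists 0%N => m n _ _; rewrite subrr val_ge0.
- move=> N; have [[M1 H1] [M2 H2]] := (cs N, ct N).
  exists (maxn M1 M2) => m n; rewrite !geq_max => /andP[m1 m2] /andP[n1 n2].
  have -> : (s - t) m - (s - t) n = (s m - s n) - (t m - t n).
    by rewrite !fctE; ring.
  by apply: val_geB; [apply: H1 | apply: H2].
- move=> N; have [Bs [Ms Hs]] := is_cauchy_bounded cs.
  have [Bt [Mt Ht]] := is_cauchy_bounded ct.
  have [[M1 H1] [M2 H2]] := (cs (N - Bt), ct (N - Bs)).
  exists (maxn (maxn Ms Mt) (maxn M1 M2)) => m n.
  rewrite !geq_max => /andP[/andP[ms mt] /andP[m1 m2]].
  move=> /andP[/andP[ns nt] /andP[n1 n2]].
  have -> : (s * t) m - (s * t) n = s m * (t m - t n) + (s m - s n) * t n.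
    by rewrite !fctE; ring.
  apply: val_geD.
    by rewrite -[N](subrKC Bs); apply: val_geM; [apply: Hs | apply: H2].
  by rewrite -[N](subrK Bt); apply: val_geM; [apply: H1 | apply: Ht].
Qed.

HB.instance Definition _ :=
  GRing.isSubringClosed.Build (nat -> K) cauchy_pred cauchy_subring.

Definition cauchy_seq := {s : nat -> K | s \in cauchy_pred}.
HB.instance Definition _ := SubChoice.on cauchy_seq.
HB.instance Definition _ := [SubChoice_isSubComNzRing of cauchy_seq by <:].

Definition null_pred : {pred cauchy_seq} :=
  fun s : cauchy_seq => `[< is_null (val s) >].

Lemma null_idealr : idealr_closed null_pred.
Proof.
split.
- by apply/asboolP => N; exists 0%N => n _; rewrite val_ge0.
- apply/asboolP => /(_ 1)[M /(_ M (leqnn M))].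
  by rewrite /val_ge /= oner_eq0 place_val1.
- move=> a x y /asboolP nx /asboolP ny; apply/asboolP => N.
  have /asboolP/is_cauchy_bounded[B [M0 H0]] := valP a.
  have [[M1 H1] [M2 H2]] := (nx (N - B), ny N).
  exists (maxn M0 (maxn M1 M2)) => n; rewrite !geq_max => /and3P[n0 n1 n2].
  apply: val_geD; last exact: H2.
  by rewrite -[N](subrKC B); apply: val_geM; [apply: H0 | apply: H1].
Qed.

HB.instance Definition _ := isIdealr.Build cauchy_seq null_pred null_idealr.

Definition completion := {ideal_quot null_pred}.
HB.instance Definition _ := GRing.ComNzRing.on completion.

Definition completion_inv (q : completion) : completion :=
  if q == 0 then 0
  else \pi_completion (insubd (0 : cauchy_seq) (fun n => (val (repr q) n)^-1)).

Lemma pi_completion_eq0 (s : cauchy_seq) :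
  (\pi_completion s == 0) = (s \in null_pred).
Proof.
have -> : (0 : completion) = \pi_completion 0 by rewrite rmorph0.
by rewrite -Quotient.idealrBE subr0.
Qed.

Lemma not_null_bounded s : is_cauchy s -> ~ is_null s ->
  exists N M, forall n, (M <= n)%N -> s n != 0 /\ w (s n) < N.
Proof.
move=> cs /existsNP[N /forallNP nN]; have [M HM] := cs N; exists N, M => n Mn.
have /existsNP[k /not_implyP[Mk /negP sk]] := nN M.
have : ~~ val_ge N (s n).
  by apply: contra sk => sn; rewrite -(subrK (s n) (s k)) val_geD ?HM.
by rewrite negb_or -ltNge => /andP.
Qed.

Lemma cauchy_inv s : is_cauchy s -> ~ is_null s -> is_cauchy (fun n => (s n)^-1).
Proof.
move=> cs ns; have [B [M0 H0]] := not_null_bounded cs ns => N.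
have invB x : x != 0 -> w x < B -> val_ge (- B) x^-1.
  move=> x0 xB; rewrite /val_ge invr_eq0 (negPf x0) /=.
  have x'0 : x^-1 != 0 by rewrite invr_eq0.
  have := place_valM w x0 x'0; rewrite mulfV // place_val1 => /esym/eqP.
  by rewrite addrC addr_eq0 => /eqP ->; rewrite lerN2 ltW.
have [M1 H1] := cs (N + B + B); exists (maxn M0 M1) => m n.
rewrite !geq_max => /andP[m0 m1] /andP[n0 n1].
have [[sm0 smB] [sn0 snB]] := (H0 m m0, H0 n n0).
have -> : (s m)^-1 - (s n)^-1 = (s n - s m) * (s m)^-1 * (s n)^-1.
  by rewrite mulrBl mulfV // !mulrBl mul1r mulrAC mulfV // mul1r.
rewrite -[N](addrK B) -[N + B](addrK B).
by do 2?apply: val_geM; rewrite ?H1 ?invB.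
Qed.

Lemma completion_mulVq (q : completion) : q != 0 -> completion_inv q * q = 1.
Proof.
move=> q0; rewrite /completion_inv (negPf q0).
set r := repr q; have cr : is_cauchy (val r) by exact/asboolP/(valP r).
have nr : ~ is_null (val r).
  move=> /asboolP nr; move: q0; rewrite -[q]reprK pi_completion_eq0 -/r.
  by move/negP; apply.
have -> : q = \pi_completion r by rewrite reprK.
apply/eqP; rewrite -subr_eq0 -rmorphM -(rmorph1 (\pi_completion)) -rmorphB.
rewrite pi_completion_eq0; apply/asboolP => N.
have [B [M0 H0]] := not_null_bounded cr nr.
exists M0 => n /H0[rn0 _]; rewrite /= insubdK; last exact/asboolP/cauchy_inv.
by rewrite !fctE mulVf // subrr val_ge0.
Qed.

Lemma completion_inv0 : completion_inv 0 = 0.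
Proof. by rewrite /completion_inv eqxx. Qed.

HB.instance Definition _ :=
  GRing.ComNzRing_isField.Build completion completion_mulVq completion_inv0.

Lemma cst_cauchy x : (fun=> x) \in cauchy_pred.
Proof. by apply/asboolP => N; exists 0%N => m n _ _; rewrite subrr val_ge0. Qed.

Definition completion_emb x : completion :=
  \pi_completion (exist _ (fun=> x) (cst_cauchy x) : cauchy_seq).

Lemma completion_emb_is_zmod_morphism : zmod_morphism completion_emb.
Proof. by move=> x y; rewrite -rmorphB; congr (\pi_completion _); apply: val_inj. Qed.

Lemma completion_emb_is_monoid_morphism : monoid_morphism completion_emb.
Proof.
split=> [|x y].
  by rewrite -(rmorph1 \pi_completion); congr (\pi_completion _); apply: val_inj.
by rewrite -rmorphM; congr (\pi_completion _); apply: val_inj.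
Qed.

HB.instance Definition _ := GRing.isZmodMorphism.Build K completion
  completion_emb completion_emb_is_zmod_morphism.
HB.instance Definition _ := GRing.isMonoidMorphism.Build K completion
  completion_emb completion_emb_is_monoid_morphism.

End Completion.

(* [a] is a norm from L = F(sqrt b), which is F itself when b is a square.  L is
   unique up to F-isomorphism, and [galNorm] is the field norm in characteristic
   different from 2. *)
Definition is_sqrt_norm (F : fieldType) (a b : F) : Prop :=
  exists (L : splittingFieldType F) (s y : L),
    [/\ s ^+ 2 = b%:A, <<1; s>>%VS = {:L}%VS & galNorm 1 {:L} y = a%:A].

Lemma is_sqrt_norm_sqr (F : fieldType) (a b z t : F) : t != 0 ->
  is_sqrt_norm a b -> is_sqrt_norm (a * z ^+ 2) (b * t ^+ 2).
Proof.
move=> t0 [L [s [y [s2 Ls Ny]]]].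
have tL0 : t%:A != 0 :> L by rewrite scaler_eq0 oner_eq0 orbF.
have galA (c : F) : galNorm 1 {:L} c%:A = (c ^+ #|'Gal({:L} / 1)%g|)%:A :> L.
  rewrite /galNorm (eq_bigr (fun=> c%:A)) ?prodr_const => [|g _].
    by rewrite -[_%:A]/(in_alg L _) -rmorphXn.
  by rewrite linearZ /= rmorph1.
have dimL : (\dim {:L} <= 2)%N.
  have pX : root ('X^2 - (b%:A)%:P : {poly L}) s.
    by rewrite rootE !hornerE s2 subrr.
  have oX (E : {subfield L}) : 'X^2 - (b%:A)%:P \is a polyOver E.
    apply/polyOverP => i; rewrite coefB coefXn coefC.
    by rewrite rpredB ?rpred_nat //; case: (i == 0%N); rewrite ?rpred0 ?rpredZ ?mem1v.
  have := dvdp_leq _ (minPoly_dvdp (oX 1%AS) pX); rewrite size_minPoly size_XnsubC //.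
  rewrite -size_poly_eq0 size_XnsubC // adjoin_degreeE dimv1 divn1 Ls.
  exact.
have cardG : (0 < #|'Gal({:L} / 1)%g| <= 2)%N.
  by rewrite fingroup.fingroup.cardG_gt0 /= dim_fixedField; apply: leq_trans (leq_div _ _) dimL.
have norm_z2 : exists x : L, galNorm 1 {:L} x = (z ^+ 2)%:A.
  case: #|_| cardG galA => [|[|[|//]]] // _ galA.
    by exists (z ^+ 2)%:A; rewrite galA expr1.
  by exists z%:A; rewrite galA.
have [x Nx] := norm_z2; exists L, (t%:A * s), (y * x); split.
- by rewrite exprMn s2 -[_%:A in X in X * _]/(in_alg L t) -[b%:A]/(in_alg L b)
             -rmorphXn -rmorphM mulrC.
- apply/eqP; rewrite eqEsubv subvf /= -Ls; apply/FadjoinP; split.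
    exact: sub1v.
  have := memv_adjoin 1%AS (t%:A * s) => /(memvZ t^-1).
  by rewrite -scalerAl mul1r scalerA mulVf // scale1r.
- by rewrite galNormM Ny Nx -[a%:A]/(in_alg L a) -[(z ^+ 2)%:A]/(in_alg L _) -rmorphM.
Qed.

Definition hilbert_symbol (F : fieldType) (a b : sqclass F) : int :=
  if `[< is_sqrt_norm (val (repr a)) (val (repr b)) >] then 1 else -1.

Lemma hilbert_symbol_pi (F : fieldType) (x y : nonzero F) :
  hilbert_symbol (\pi_(sqclass F) x) (\pi_(sqclass F) y) =
  if `[< is_sqrt_norm (val x) (val y) >] then 1 else -1.
Proof.
have sym (u v : nonzero F) z : val u = val v * z ^+ 2 ->
    z != 0 /\ val v = val u * z^-1 ^+ 2.
  move=> e; have z0 : z ^+ 2 != 0.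
    by apply: contraNneq (valP u) => z0; rewrite e z0 mulr0.
  by split; [rewrite expf_eq0 in z0 | rewrite e exprVn mulfK].
rewrite /hilbert_symbol; congr (if _ then _ else _).
have /eq_sqclassP[z ex] : repr (\pi_(sqclass F) x) == x %[mod sqclass F].
  by rewrite reprK.
have /eq_sqclassP[t ey] : repr (\pi_(sqclass F) y) == y %[mod sqclass F].
  by rewrite reprK.
have [_ ex'] := sym _ _ _ ex; have [t0 ey'] := sym _ _ _ ey.
apply/asbool_equiv_eq; split => h.
  by rewrite ex' ey'; apply: is_sqrt_norm_sqr; rewrite ?invr_eq0.
by rewrite ex ey; apply: is_sqrt_norm_sqr.
Qed.

Definition local_functional (K : fieldType) (w : finite_place K)
    (b : sqclass (completion w)) (u : sqclass K) : 'F_2 :=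
  if hilbert_symbol (sqclass_map (completion_emb w) u) b == 1 then 0 else 1.

Definition functional_map (K : fieldType) (r : nat) (w : 'I_r -> finite_place K)
    (b : forall i, sqclass (completion (w i))) (u : sqclass K) : 'rV['F_2]_r :=
  \row_i local_functional (b i) u.

Section Spaces.
Variable F : fieldType.

Definition subspace_of_dim (V : lmodType F) (W : {pred V}) (r : nat) : Prop :=
  submod_closed W /\
  exists e : 'I_r -> V,
    [/\ forall i, e i \in W,
        forall c : 'I_r -> F, \sum_i c i *: e i = 0 -> forall i, c i = 0
      & {in W, forall u, exists c : 'I_r -> F, u = \sum_i c i *: e i}].

Variables V U : lmodType F.

Definition bijective_between (A : {pred V}) (B : {pred U}) (f : V -> U) : Prop :=
  [/\ {in A, forall u, f u \in B}, {in A &, injective f}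
    & {in B, forall y, exists2 u, u \in A & f u = y}].

Definition linear_iso (A : {pred V}) (B : {pred U}) (f : V -> U) : Prop :=
  bijective_between A B f /\
  forall a, {in A &, forall u v, f (a *: u + v) = a *: f u + f v}.

Definition affine_coset (T : zmodType) (x0 : T) (A : {pred T}) : {pred T} :=
  [pred x | x - x0 \in A].

Definition affine_iso (x0 : V) (A : {pred V}) (y0 : U) (B : {pred U})
    (f : V -> U) : Prop :=
  bijective_between (affine_coset x0 A) (affine_coset y0 B) f /\
  exists g c, linear_iso A B g /\ {in A, forall x, f (x0 + x) = c + g x}.

End Spaces.

(* Main.v *)
Require Import Defs.
From HB Require Import structures.
From mathcomp Require Import all_boot all_order all_algebra all_fingroup all_field.
From mathcomp Require Import ring zify lra.
From mathcomp Require Import boolp classical_sets functions.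

(* The symbol (., b)_w takes only two values, so it is additive as soon as the
   product of two non-norms from F(sqrt b) is a norm, F = K_w.  Multiplying b by
   squares and a non-norm a by norms, bring both as close to 1 as possible.  With
   e = v 2, improving the approximation step by step forces
   v (a - 1) = 2 e - v (b - 1), where one square or Artin-Schreier class of the
   finite residue field remains, so the product of two such non-norms can be
   brought closer to 1 and is a norm by Hensel's lemma.

   It remains to find, for u not a square in K, a place with (u, p)_w = -1.  Let
   K = Q(theta), R = Z[theta], d = [K : Q].  It suffices that u be a nonsquare
   unit modulo an unramified prime w above p.  Otherwise u is a square modulo
   every M = 1 mod D0 in R, for some D0 > 0.  Take pairs (alpha, beta) of such
   elements of sizes t^i and t^(J - i): there are (J + 1) P^d of them, P = t^J.
   Let s be a square root of u modulo the product of all of them.  The ideal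
   (alpha, sqrt u - s) (beta, sqrt u + s) of R[sqrt u] determines the pair, because
   alpha and beta are too close to large integers to be changed by a unit.  By the
   pigeonhole principle it contains z of size O(sqrt P), of relative norm
   j alpha beta with j bounded, and it is recovered from z and a set of residues
   modulo j.  So there are only O(P^d) of them, a contradiction for large J.

   Linear algebra then gives r independent functionals, and additivity carries the
   isomorphism on W over to its cosets. *)

Set Implicit Arguments.
Unset Strict Implicit.
Unset Printing Implicit Defensive.

Import Order.TTheory GRing.Theory Num.Theory.

Local Open Scope ring_scope.
Local Open Scope quotient_scope.

(** * Norms from quadratic extensions *)

(** The counting takes the place of a density theorem for primes. If u were a square modulo every M
    = 1 mod D0, then R[sqrt u] would have about P^d log P ideals of relative norm of size P, as if
    its zeta function had a double pole, while its rank 2 d leaves room for only O(P^d); the J + 1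
    scales are the logarithm.

    Since Z[theta] need not be integrally closed, no factorization of ideals is used: an ideal is a
    pair of congruences. D0 collects 2, a multiple of u and a discriminant-like integer, so that 2
    and s are invertible modulo the product of the moduli and p is a uniformizer at the places that
    are needed.

    On the local side a finite place is a bare discrete valuation, so the finiteness of its residue
    field has to be derived from [K : Q]. The two distances to 1, those of a and of b, compete: a is
    a norm once they add up to more than 2 e, and optimal representatives of a non-norm reach the
    sum 2 e exactly. This covers residue characteristic 2, where most of the work lies, together
    with the odd ones. *)

Section QuadraticNorm.
Variables (F : fieldType) (b : F).
Hypotheses (two_neq0 : 2 != 0 :> F) (nsq_b : forall c : F, c ^+ 2 != b).

Lemma sqrt_notin1 (L : fieldExtType F) (s : L) : s ^+ 2 = b%:A -> s \notin 1%VS.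
Proof.
move=> s2; apply/negP => /vlineP[c sc]; case/eqP: (nsq_b c).
apply: (fmorph_inj (in_alg L)); rewrite rmorphXn /=.
by rewrite -[in LHS]/(c *: 1) -sc s2.
Qed.

Section Norm.
Variables (L : splittingFieldType F) (s : L).
Hypotheses (s2 : s ^+ 2 = b%:A) (genL : <<1; s>>%VS = {:L}%VS).

Let s_neq0 : s != 0.
Proof. by apply: contraNneq (sqrt_notin1 s2) => ->; exact: mem0v. Qed.

Let two_neq0L : 2 != 0 :> L.
Proof. by rewrite -(rmorph_nat (in_alg L)) fmorph_eq0. Qed.

Lemma quadratic_galois : galois 1 {:L}.
Proof.
apply/splitting_galoisField; exists ('X^2 - (b%:A)%:P).
have Xs : 'X^2 - (b%:A)%:P = \prod_(z <- [:: s; - s]) ('X - z%:P) :> {poly L}.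
  by rewrite !big_cons big_nil mulr1 -s2 polyCN rmorphXn /=; ring.
split.
- apply/polyOverP => i; rewrite coefB coefXn coefC.
  by rewrite rpredB ?rpred_nat //; case: (i == 0%N); rewrite ?rpred0 ?rpredZ ?mem1v.
- rewrite Xs separable_prod_XsubC /= inE andbT -addr_eq0 -mulr2n -mulr_natl.
  by rewrite mulf_neq0.
- exists [:: s; - s]; first by rewrite Xs eqpxx.
  apply/eqP; rewrite eqEsubv subvf /= -genL; apply/FadjoinP; split.
    exact: subv_adjoin_seq.
  by apply: seqv_sub_adjoin; rewrite inE eqxx.
Qed.

Lemma quadratic_dim : \dim {:L} = 2.
Proof.
have deg : \dim {:L} = adjoin_degree 1 s by rewrite adjoin_degreeE genL dimv1 divn1.
have := adjoin_deg_eq1 1%AS s; rewrite (negPf (sqrt_notin1 s2)).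
have pX : root ('X^2 - (b%:A)%:P : {poly L}) s.
  by rewrite rootE !hornerE s2 subrr.
have oX : 'X^2 - (b%:A)%:P \is a @polyOver L 1%VS.
  apply/polyOverP => i; rewrite coefB coefXn coefC.
  by rewrite rpredB ?rpred_nat //; case: (i == 0%N); rewrite ?rpred0 ?rpredZ ?mem1v.
have := dvdp_leq _ (minPoly_dvdp oX pX); rewrite size_minPoly size_XnsubC //.
rewrite -size_poly_eq0 size_XnsubC // -deg ltnS => /(_ isT).
by have := adim_gt0 {:L}; case: (\dim _) => [|[|[|]]].
Qed.

Lemma quadratic_galNorm (x y : F) :
  galNorm 1 {:L} (x%:A + y *: s) = (x ^+ 2 - b * y ^+ 2)%:A.
Proof.
have galL := quadratic_galois.
have cardG : #|'Gal({:L} / 1)%g| = 2 by rewrite -galois_dim // quadratic_dim dimv1.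
have /trivgPn[g Gg g1] : 'Gal({:L} / 1)%g != 1%g.
  by apply/eqP => G1; move: cardG; rewrite G1 cards1.
have gF (c : F) : g c%:A = c%:A.
  by apply: (fixed_gal (sub1v _) Gg); rewrite rpredZ ?mem1v.
have gs : g s = - s.
  have : (g s) ^+ 2 == s ^+ 2.
    have gss : g (s * s) = g s * g s by rewrite rmorphM.
    by rewrite expr2 -gss -expr2 s2 gF.
  (* If g fixed s, it would fix every polynomial in s, that is all of L. *)
  rewrite eqf_sqr => /orP[|/eqP //] /eqP gs; case/eqP: g1.
  apply/eqP; apply/gal_eqP => z _; rewrite gal_id.
  have : z \in <<1; s>>%VS by rewrite genL memvf.
  case/Fadjoin_polyP => p p1 ->.
  have /polyOver1P[q ->] := p1.
  elim/poly_ind: q => [|q c IH]; first by rewrite map_poly0 horner0 rmorph0.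
  rewrite rmorphD rmorphM /= map_polyX map_polyC hornerMXaddC rmorphD rmorphM /=.
  by rewrite IH gs gF.
have G2 : 'Gal({:L} / 1)%g = [set 1%g; g].
  by apply/esym/eqP; rewrite eqEcard finset.subUset !finset.sub1set group1 Gg cardG cards2 eq_sym g1.
rewrite /galNorm G2 big_setU1 ?inE 1?eq_sym // big_set1 gal_id.
rewrite -(mulr_algl y) rmorphD rmorphM /= !gF gs.
have -> : (x ^+ 2 - b * y ^+ 2)%:A = x%:A ^+ 2 - s ^+ 2 * y%:A ^+ 2 :> L.
  rewrite s2 -[x%:A]/(in_alg L x) -[b%:A]/(in_alg L b) -[y%:A]/(in_alg L y).
  by rewrite -!rmorphXn -rmorphM -rmorphB.
ring.
Qed.

Lemma quadratic_span (z : L) : exists x y : F, z = x%:A + y *: s.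
Proof.
have : z \in <<1; s>>%VS by rewrite genL memvf.
case/Fadjoin_polyP => p /polyOver1P[q ->] ->.
elim/poly_ind: q => [|q c [x [y IH]]].
  by exists 0, 0; rewrite map_poly0 horner0 !scale0r addr0.
rewrite rmorphD rmorphM /= map_polyX map_polyC hornerMXaddC /=.
exists (y * b + c), x; rewrite IH mulrDl -!scalerAl mul1r -expr2 s2 scalerA.
by rewrite scalerDl -addrA addrC.
Qed.

End Norm.

Lemma quadratic_splittingField :
  exists (L : splittingFieldType F) (s : L), s ^+ 2 = b%:A /\ <<1; s>>%VS = {:L}%VS.
Proof.
have sz : size ('X^2 - b%:P) = 3 by rewrite size_XnsubC.
have irr : irreducible_poly ('X^2 - b%:P).
  apply: cubic_irreducible; first by rewrite sz.
  move=> x; rewrite rootE !hornerE subr_eq0; exact: nsq_b.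
have [L dimL [s rs genL]] := irredp_FAdjoin irr.
have s2 : s ^+ 2 = b%:A.
  by move: rs; rewrite rmorphB /= map_polyXn map_polyC rootE !hornerE subr_eq0 => /eqP.
have splitL : SplittingField.axiom L.
  exists ('X^2 - (b%:A)%:P).
    apply/polyOverP => i; rewrite coefB coefXn coefC.
    by rewrite rpredB ?rpred_nat //; case: (i == 0%N); rewrite ?rpred0 ?rpredZ ?mem1v.
  exists [:: s; - s].
    suff -> : 'X^2 - (b%:A)%:P = \prod_(z <- [:: s; - s]) ('X - z%:P) by exact: eqpxx.
    by rewrite !big_cons big_nil mulr1 -s2 polyCN rmorphXn /=; ring.
  apply/eqP; rewrite eqEsubv subvf /= -genL; apply/FadjoinP; split.
    exact: subv_adjoin_seq.
  by apply: seqv_sub_adjoin; rewrite inE eqxx.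
pose mx := FieldExt_isSplittingField.Build F L splitL.
pose L' : splittingFieldType F := HB.pack L mx.
by exists L', s.
Qed.

End QuadraticNorm.

Lemma is_sqrt_normP (F : fieldType) (a b : F) : 2 != 0 :> F -> b != 0 ->
  is_sqrt_norm a b <-> exists x y : F, a = x ^+ 2 - b * y ^+ 2.
Proof.
move=> two b0; have [[c c2]|nsq] := pselect (exists c : F, c ^+ 2 = b).
  have c0 : c != 0 by apply: contraNneq b0 => c0; rewrite -c2 c0 expr0n.
  split=> _.
    (* For b = c ^ 2 the form is (x - c y) (x + c y); the two factors are given the values 1 and
       a. *)
    exists ((a + 1) / 2), ((a - 1) / (2 * c)); rewrite -c2; field.
    by rewrite two c0.
  have gen : <<1; (c : F^o)>>%VS = {:F^o}%VS.
    by apply/eqP; rewrite eqEsubv subvf /=; apply: subv_trans (subv_adjoin _ _); rewrite regular_fullv.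
  exists (F^o : splittingFieldType F), (c : F^o), (a : F^o); split=> //.
    by rewrite c2 -[LHS](mulr1 (b : F)).
  rewrite /galNorm (_ : 'Gal({:F^o} / 1)%g = 1%g) ?big_set1 ?gal_id.
    by rewrite -[LHS](mulr1 (a : F)).
  apply/trivgP/fintype.subsetP => g Gg; rewrite inE; apply/gal_eqP => z _; rewrite gal_id.
  apply: (fixed_gal (sub1v _) Gg); apply/vlineP; exists (z : F).
  by rewrite -[LHS](mulr1 (z : F)).
have nsq_b (c : F) : c ^+ 2 != b by apply/eqP => c2; apply: nsq; exists c.
split=> [[L [s [z [s2 gen Nz]]]]|[x [y ->]]].
  have [x [y zE]] := quadratic_span s2 gen z; exists x, y.
  apply: (fmorph_inj (in_alg L)); rewrite /= -Nz zE.
  by rewrite -(quadratic_galNorm two nsq_b s2 gen).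
have [L [s [s2 gen]]] := quadratic_splittingField nsq_b.
exists L, s, (x%:A + y *: s); split=> //.
exact: quadratic_galNorm.
Qed.

(** * Places and residue fields *)

(* [lia] on the integer (in)equalities of the context only. *)
Ltac int_lia :=
  repeat match goal with
  | H : ?T |- _ =>
      lazymatch T with
      | is_true (@Order.le _ _ ?x _) => fail
      | is_true (@Order.lt _ _ ?x _) => fail
      | is_true (~~ @Order.le _ _ ?x _) => fail
      | @eq ?A _ _ => tryif unify A int then fail else clear H
      | _ => clear H
      end
  end; lia.

Section PlaceTheory.
Variables (F : fieldType) (v : finite_place F).
Implicit Types (x y z : F) (N M : int).

Lemma place_valV x : x != 0 -> v x^-1 = - v x.
Proof.
move=> x0; have x'0 : x^-1 != 0 by rewrite invr_eq0.
apply/eqP; rewrite -addr_eq0 addrC.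
by rewrite -place_valM // mulfV // place_val1.
Qed.

Lemma place_valX x n : x != 0 -> v (x ^+ n) = v x *+ n.
Proof.
move=> x0; elim: n => [|n IH]; first by rewrite expr0 place_val1.
by rewrite exprS mulrS place_valM ?expf_neq0 // IH.
Qed.

Lemma place_valMz x y : x != 0 -> y != 0 -> v (x / y) = v x - v y.
Proof. by move=> x0 y0; rewrite place_valM ?invr_eq0 // place_valV. Qed.

Lemma val_geE N x : x != 0 -> val_ge v N x = (N <= v x).
Proof. by rewrite /val_ge; case: eqVneq. Qed.

Lemma val_ge_refl x : val_ge v (v x) x.
Proof. by rewrite /val_ge lexx orbT. Qed.

Lemma val_geW N M x : M <= N -> val_ge v N x -> val_ge v M x.
Proof.
by move=> MN; rewrite /val_ge; case: eqVneq => //= _; apply: le_trans.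
Qed.

Lemma val_ge_natr n : val_ge v 0 n%:R.
Proof.
elim: n => [|n IH]; first exact: val_ge0.
by rewrite -natr1 val_geD // /val_ge place_val1 lexx orbT.
Qed.

Lemma val_ge_sub N x y : val_ge v N (x - y) = val_ge v N (y - x).
Proof. by rewrite -val_geN opprB. Qed.

Lemma val_ge_trans N y x z : val_ge v N (x - y) -> val_ge v N (y - z) -> val_ge v N (x - z).
Proof. by move=> xy yz; rewrite -(subrKA y) val_geD. Qed.

Lemma place_val_addl x y : x != 0 -> val_ge v (v x + 1) y -> x + y != 0 /\ v (x + y) = v x.
Proof.
move=> x0 /orP[/eqP->|xy]; first by rewrite addr0.
have [->|y0] := eqVneq y 0; first by rewrite addr0.
have xy0 : x + y != 0.
  apply/eqP => /eqP; rewrite addr_eq0 => /eqP xE; move: xy.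
  by rewrite xE place_valN //; lia.
split=> //; apply/eqP; rewrite eq_le; apply/andP; split; last first.
  apply: le_trans (place_valD v x0 y0 xy0); rewrite le_min lexx /=; lia.
rewrite leNgt; apply/negP => lt.
have yN0 : - y != 0 by rewrite oppr_eq0.
have xE : x + y - y = x by rewrite addrK.
have := place_valD v xy0 yN0; rewrite xE => /(_ x0).
by rewrite place_valN // ge_min => /orP[]; lia.
Qed.

Lemma place_val_close x y N : x != 0 -> v x < N -> val_ge v N (x - y) -> y != 0 /\ v y = v x.
Proof.
move=> x0 xN; rewrite val_ge_sub => yx; rewrite -(subrKC x y).
by apply: place_val_addl x0 (val_geW _ yx); lia.
Qed.

Lemma val_ge_div N x y : y != 0 -> val_ge v (N + v y) x -> val_ge v N (x / y).
Proof.
move=> y0 Nx; rewrite -(addrK (v y) N) val_geM //.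
by rewrite -place_valV // val_ge_refl.
Qed.

(* A finite set of representatives of the residue field: congruence modulo the
   maximal ideal is [val_ge v 1 (x - y)]. *)
Definition finite_residue : Prop :=
  exists s : seq F, forall x, val_ge v 0 x -> exists2 y, y \in s & val_ge v 1 (x - y).

Lemma finite_residueP : finite_residue ->
  exists (T : finType) (lift : T -> F) (res : F -> T),
    [/\ forall t, val_ge v 0 (lift t),
        forall x, val_ge v 0 x -> val_ge v 1 (lift (res x) - x)
      & forall t u, val_ge v 1 (lift t - lift u) -> t = u].
Proof.
(* [c x] is the first element of [s] congruent to [x], so congruent elements share it; the fixed
   points of [c] represent each residue class once. *)
move=> [s sP]; pose c x := nth 0 s (find (fun z => val_ge v 1 (x - z)) s).
have cP x : val_ge v 0 x -> c x \in s /\ val_ge v 1 (x - c x).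
  move=> /sP[y ys xy]; have hs : has (fun z => val_ge v 1 (x - z)) s.
    by apply/hasP; exists y.
  by rewrite /c mem_nth -?has_find //; split=> //; exact: (nth_find 0 hs).
have cE x y : val_ge v 1 (x - y) -> c x = c y.
  move=> xy; rewrite /c; congr nth; apply: eq_find => z.
  by apply/idP/idP; apply: val_ge_trans; rewrite // val_ge_sub.
have cO x : val_ge v 0 x -> val_ge v 0 (c x).
  move=> xO; have [_] := cP x xO; rewrite val_ge_sub => /(val_geW (ler01 : 0 <= 1 :> int)) h.
  by rewrite -(subrK x (c x)) val_geD.
pose p z := val_ge v 0 z && (c z == z); pose t := [seq z <- s | p z].
have ct x : val_ge v 0 x -> c x \in t.
  move=> xO; rewrite mem_filter /p cO //=; have [-> /cE <-] := cP x xO.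
  by rewrite eqxx.
have c0 := ct 0 (val_ge0 _ _).
exists (seq_sub t), val, (fun x => insubd (SeqSub c0) (c x)); split.
- by move=> [z]/=; rewrite mem_filter => /andP[/andP[]].
- move=> x xO; rewrite val_insubd ct // val_ge_sub; by have [] := cP x xO.
- move=> [y yt] [z zt] /= /cE yz; apply: val_inj => /=.
  move: yt zt; rewrite !mem_filter => /andP[/andP[_ /eqP yE] _] /andP[/andP[_ /eqP zE] _].
  by rewrite -yE -zE.
Qed.

End PlaceTheory.

(** * Fibres of maps between finite sets *)

Section Fibres.
Variable T : finType.
Implicit Types (D : {set T}) (f : T -> T).

Definition at_most_two_to_one D f :=
  {in D & &, forall x y z, f x = f y -> f y = f z -> [\/ x = y, y = z | x = z]}.

(** Choosing one preimage of each value, and a second one where it exists, covers D by two images of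
    [f @: D]. *)
Lemma card_at_most_two_to_one D f : at_most_two_to_one D f -> (#|D| <= 2 * #|f @: D|)%N.
Proof.
move=> two; have [->|[x0 _]] := set_0Vmem D; first by rewrite cards0.
pose g y := odflt x0 [pick x in D | f x == y].
pose h y := odflt x0 [pick x in D | (f x == y) && (x != g y)].
have gP x : x \in D -> g (f x) \in D /\ f (g (f x)) = f x.
  move=> Dx; rewrite /g; case: pickP => [z /andP[Dz /eqP] //|/(_ x)].
  by rewrite Dx eqxx.
have sub : D \subset (g @: (f @: D)) :|: (h @: (f @: D)).
  apply/fintype.subsetP => x Dx; rewrite inE.
  have [Dg fg] := gP x Dx.
  have [gx|gx] := eqVneq (g (f x)) x.
    by apply/orP; left; apply/imsetP; exists (f x); rewrite ?imset_f.
  apply/orP; right; apply/imsetP; exists (f x); rewrite ?imset_f // /h.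
  case: pickP => [z /and3P[Dz /eqP fz zg]|/(_ x)] /=; last first.
    by rewrite Dx eqxx eq_sym gx.
  have [//|/eqP|/esym/eqP] := two x z (g (f x)) Dx Dz Dg (esym fz) (etrans fz (esym fg)).
    by rewrite (negPf zg).
  by rewrite (negPf gx).
apply: leq_trans (subset_leq_card sub) _; apply: leq_trans (leq_card_setU _ _) _.
by rewrite mul2n -addnn leq_add ?leq_imset_card.
Qed.

(** A substitute for a subgroup of index 2: the image of f has at least half of the elements of D,
    and its translate by the injective g is disjoint from it, so the two fill D. *)
Lemma two_cosets D f g : at_most_two_to_one D f -> {in D, forall x, f x \in D} ->
  {in D, forall x, g x \in D} -> {in D &, injective g} ->
  {in D &, forall x y, g (f x) <> f y} ->
  {in D, forall t, (exists2 x, x \in D & t = f x) \/ exists2 x, x \in D & t = g (f x)}.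
Proof.
move=> two fD gD ginj disj t Dt.
pose A := f @: D; pose B := g @: A.
have AD : A \subset D by apply/fintype.subsetP => _ /imsetP[x Dx ->]; apply: fD.
have BD : B \subset D.
  by apply/fintype.subsetP => _ /imsetP[x /(fintype.subsetP AD) Dx ->]; apply: gD.
have cB : #|B| = #|A|.
  by apply: card_in_imset => x y /(fintype.subsetP AD) Dx /(fintype.subsetP AD) Dy; apply: ginj.
have AB0 : A :&: B = finset.set0.
  apply/eqP; rewrite -finset.subset0; apply/fintype.subsetP => z.
  rewrite inE => /andP[/imsetP[y Dy ->] /imsetP[_ /imsetP[x Dx ->] /esym e]].
  by case: (disj x y Dx Dy).
have /eqP ABD : A :|: B == D.
  rewrite eqEcard finset.subUset AD BD cardsU AB0 cards0 subn0 cB addnn -mul2n.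
  exact: card_at_most_two_to_one.
have : t \in A :|: B by rewrite ABD.
rewrite inE => /orP[/imsetP[x Dx ->]|/imsetP[_ /imsetP[x Dx ->] ->]].
  by left; exists x.
by right; exists x.
Qed.

End Fibres.

Section Residues.
Variables (F : fieldType) (v : finite_place F).
Hypotheses (two_neq0 : 2 != 0 :> F) (finres : finite_residue v).
Implicit Types (x y z a b : F).

Local Notation O := (val_ge v 0).
Local Notation "x ~~ y" := (val_ge v 1 (x - y)) (at level 70).

Lemma val_ge01 x : val_ge v 1 x -> O x.
Proof. exact: val_geW. Qed.

Lemma val_ge1M x y : O x -> val_ge v 1 y -> val_ge v 1 (x * y).
Proof. by move=> Ox y1; rewrite -[1]add0r val_geM. Qed.

Lemma val_geM0 x y : O x -> O y -> O (x * y).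
Proof. by move=> Ox Oy; rewrite -[0]addr0 val_geM. Qed.

Lemma val_ge1_mul x y : O x -> O y -> val_ge v 1 (x * y) ->
  val_ge v 1 x \/ val_ge v 1 y.
Proof.
rewrite /val_ge mulf_eq0; case: (eqVneq x 0) => [->|x0]; first by left.
case: (eqVneq y 0) => [->|y0] /=; first by right.
by rewrite place_valM //; int_lia.
Qed.

Lemma val_ge1_sqr x : val_ge v 1 (x ^+ 2) -> val_ge v 1 x.
Proof.
rewrite /val_ge expf_eq0; case: eqVneq => //= x0; rewrite place_valX //.
by rewrite mulr2n; int_lia.
Qed.

Lemma val_two_ge0 : 0 <= v 2.
Proof. by have := val_ge_natr v 2; rewrite val_geE. Qed.

Lemma unit_val0 x : O x -> ~ val_ge v 1 x -> x != 0 /\ v x = 0.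
Proof.
move=> Ox /negP; rewrite /val_ge negb_or => /andP[x0 x1]; split=> //.
by move: Ox; rewrite val_geE //; int_lia.
Qed.

Lemma residue_eq0_sqr_diff x y : O x -> O y -> x ^+ 2 ~~ y ^+ 2 -> x ~~ y \/ x ~~ - y.
Proof.
move=> Ox Oy; rewrite opprK subr_sqr.
by case/(val_ge1_mul (val_geB Ox Oy) (val_geD Ox Oy)); [left|right].
Qed.

(** * Residue characteristic two *)

Section Wild.
Hypothesis e_gt0 : 0 < v 2.

Let two1 : val_ge v 1 2.
Proof. by rewrite val_geE //; int_lia. Qed.

(** Squaring is additive, hence injective, on a residue field of characteristic 2; as the field is
    finite, every residue is a square. Dividing by [p ^+ 2] reduces to units. *)
Lemma sqrt_residue z j : z != 0 -> v z = j + j ->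
  exists x, [/\ x != 0, v x = j & val_ge v (j + j + 1) (z - x ^+ 2)].
Proof.
move=> z0 vz; have [T [l [r [Ol lr linj]]]] := finite_residueP finres.
pose f t := r (l t ^+ 2).
have Of t : O (l t ^+ 2) by rewrite expr2 val_geM0.
have finj : injective f.
  move=> t u tu; apply: linj; apply: val_ge1_sqr.
  have e1 := lr _ (Of t); have := lr _ (Of u); rewrite -/(f u) -tu val_ge_sub => e2.
  have -> : (l t - l u) ^+ 2 = - (l (f t) - l t ^+ 2) - (l u ^+ 2 - l (f t))
                               - l u * (l t - l u) * 2 by ring.
  by rewrite val_geB ?val_ge1M ?val_geM0 // val_geB // val_geN.
have [p p0 vp] := place_val_surj v j.
have p20 : p ^+ 2 != 0 by rewrite expf_neq0.
pose u := z / p ^+ 2.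
have vp2 : v (p ^+ 2) = j + j by rewrite expr2 place_valM // vp.
have u0 : u != 0 by rewrite mulf_neq0 ?invr_eq0.
have vu : v u = 0 by rewrite place_valMz // vz vp2; int_lia.
have Ou : O u by rewrite val_geE // vu.
have /codomP[t tE] := injF_onto finj (r u).
have ut : u ~~ l t ^+ 2.
  by have := lr _ (Of t); rewrite -/(f t) -tE; apply: val_ge_trans; rewrite val_ge_sub lr.
have [lt20 vlt2] : l t ^+ 2 != 0 /\ v (l t ^+ 2) = v u.
  by apply: place_val_close u0 _ ut; rewrite vu.
have lt0 : l t != 0 by move: lt20; rewrite expf_eq0.
have vlt : v (l t) = 0 by move: vlt2; rewrite vu place_valX // mulr2n; int_lia.
exists (p * l t); split; rewrite ?mulf_neq0 // ?place_valM // ?vp ?vlt ?addr0 //.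
have -> : z - (p * l t) ^+ 2 = p ^+ 2 * (u - l t ^+ 2).
  by rewrite /u mulrBr mulrCA mulfV // mulr1 exprMn.
by rewrite val_geM // -vp2 val_ge_refl.
Qed.

(** In characteristic 2 the map y - y ^ 2 is additive with kernel {0, 1}, so its image has index 2
    in the finite residue field. The lifts obey the corresponding identities up to multiples of
    2. *)
Lemma artin_schreier_index2 a b : O a -> O b ->
  (forall y, O y -> ~ a ~~ y - y ^+ 2) -> (forall y, O y -> ~ b ~~ y - y ^+ 2) ->
  exists2 y, O y & a + b ~~ y - y ^+ 2.
Proof.
move=> Oa Ob na nb; have [T [l [r [Ol lr linj]]]] := finite_residueP finres.
pose q x := x - x ^+ 2.
have Oq t : O (q (l t)) by rewrite /q expr2 val_geB // val_geM0.
pose f t := r (q (l t)); pose g t := r (a + l t).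
have Og t : O (a + l t) by rewrite val_geD.
have rE x y : O x -> O y -> r x = r y -> x ~~ y.
  move=> Ox Oy xy; apply: (@val_ge_trans _ v 1 (l (r x))); first by rewrite val_ge_sub lr.
  by rewrite xy lr.
have two : at_most_two_to_one [set: T] f.
  have h t u : f t = f u -> t = u \/ l t + l u ~~ 1.
    move=> /(rE _ _ (Oq _) (Oq _)).
    have -> : q (l t) - q (l u) = (l t - l u) * (1 - (l t + l u)) by rewrite /q; ring.
    have O1 : O 1 by exact: (val_ge_natr v 1).
    case/(val_ge1_mul (val_geB _ _) (val_geB O1 (val_geD _ _))) => // h.
      by left; apply: linj.
    by right; rewrite val_ge_sub.
  move=> x y z _ _ _ /h[->|xy]; first by constructor.
  move=> /h[->|yz]; first by constructor 2.
  constructor 3; apply: linj.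
  have -> : l x - l z = l x + l y - 1 - (l y + l z - 1) by ring.
  by rewrite val_geB.
have disj : {in [set: T] &, forall x y : T, g (f x) <> f y}.
  move=> x y _ _ /(rE _ _ (Og _) (Oq _)) e; apply: (na (l y - l x)).
    by rewrite val_geB.
  have e' := lr _ (Oq x); rewrite -/(f x) in e'.
  have -> : a - (l y - l x - (l y - l x) ^+ 2) =
     a + l (f x) - q (l y) - (l (f x) - q (l x)) + l x * (l x - l y) * 2.
    by rewrite /q; ring.
  apply: val_geD; first exact: val_geB.
  by apply: val_ge1M => //; apply: val_geM0 => //; exact: val_geB.
have ginj : {in [set: T] &, injective g}.
  move=> x y _ _ /(rE _ _ (Og _) (Og _)) e; apply: linj.
  by have -> : l x - l y = a + l x - (a + l y) by ring.
have fT (h : T -> T) : {in [set: T], forall x : T, h x \in [set: T]} by [].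
have [[x _ e]|[x _ e]] := two_cosets two (fT f) (fT g) ginj disj (finset.in_setT (r b)).
  by case: (nb (l x) (Ol x)); exact: (rE _ _ Ob (Oq x) e).
exists (l x) => //.
have e' := lr _ (Oq x); rewrite -/(f x) in e'.
have {}e := rE _ _ Ob (Og _) e.
have -> : a + b - (l x - l x ^+ 2) = b - (a + l (f x)) + (l (f x) - q (l x)) + a * 2.
  by rewrite /q; ring.
apply: val_geD; first exact: val_geD.
exact: val_ge1M.
Qed.

End Wild.

(** * Odd residue characteristic *)

Section Tame.
Hypothesis e_eq0 : v 2 = 0.

Let D (T : finType) (l : T -> F) := [set t | ~~ val_ge v 1 (l t)].

Let sqr_two_to_one (T : finType) (l : T -> F) (r : F -> T) :
  (forall t, O (l t)) -> (forall x, O x -> l (r x) ~~ x) ->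
  (forall t u, l t ~~ l u -> t = u) ->
  at_most_two_to_one (D l) (fun t => r (l t ^+ 2)).
Proof.
move=> Ol lr linj.
have Oq t : O (l t ^+ 2) by rewrite expr2 val_geM0.
have h t u : r (l t ^+ 2) = r (l u ^+ 2) -> t = u \/ l t ~~ - l u.
  move=> tu; have : l t ^+ 2 ~~ l u ^+ 2.
    apply: (@val_ge_trans _ v 1 (l (r (l t ^+ 2)))); first by rewrite val_ge_sub lr.
    by rewrite tu lr.
  by case/residue_eq0_sqr_diff => //; [left; apply: linj|right].
move=> x y z _ _ _ /h[->|xy]; first by constructor.
move=> /h[->|yz]; first by constructor 2.
constructor 3; apply: linj.
have -> : l x - l z = l x - - l y - (l y - - l z) by ring.
by rewrite val_geB.
Qed.

(** Squaring is two-to-one on the nonzero residue classes, so the squares and their translates by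
    the nonsquare a exhaust them. *)
Lemma square_residues_index2 a b : O a -> ~ val_ge v 1 a -> O b -> ~ val_ge v 1 b ->
  (forall y, O y -> ~ a ~~ y ^+ 2) -> (forall y, O y -> ~ b ~~ y ^+ 2) ->
  exists2 y, O y & a * b ~~ y ^+ 2.
Proof.
move=> Oa a1 Ob b1 na nb; have [T [l [r [Ol lr linj]]]] := finite_residueP finres.
have Oq t : O (l t ^+ 2) by rewrite expr2 val_geM0.
pose f t := r (l t ^+ 2); pose g t := r (a * l t).
have Og t : O (a * l t) by rewrite val_geM0.
have rE x y : O x -> O y -> r x = r y -> x ~~ y.
  move=> Ox Oy xy; apply: (@val_ge_trans _ v 1 (l (r x))); first by rewrite val_ge_sub lr.
  by rewrite xy lr.
have rD x : O x -> ~ val_ge v 1 x -> r x \in D l.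
  move=> Ox x1; rewrite inE; apply/negP => h; apply: x1.
  by rewrite -[x](subKr (l (r x))) val_geB // lr.
have DP t : t \in D l -> ~ val_ge v 1 (l t) by rewrite inE => /negP.
have fD : {in D l, forall x : T, f x \in D l}.
  by move=> x /DP xD; apply: rD => //; move/val_ge1_sqr.
have gD : {in D l, forall x : T, g x \in D l}.
  by move=> x /DP xD; apply: rD => //; case/val_ge1_mul.
have ginj : {in D l &, injective g}.
  move=> x y _ _ /(rE _ _ (Og _) (Og _)); rewrite -mulrBr.
  by case/(val_ge1_mul Oa (val_geB _ _)) => // h; apply: linj.
have disj : {in D l &, forall x y : T, g (f x) <> f y}.
  move=> x y /DP xD /DP yD /(rE _ _ (Og _) (Oq _)) e.
  have [x0 vx] := unit_val0 (Ol x) xD.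
  have Oxi : O (l x)^-1 by rewrite val_geE ?invr_eq0 // place_valV // vx.
  apply: (na (l y / l x)); first by rewrite val_geM0.
  have e' := lr _ (Oq x); rewrite -/(f x) in e'.
  have -> : a - (l y / l x) ^+ 2 = (l x)^-1 ^+ 2 *
      ((a * l (f x) - l y ^+ 2) - a * (l (f x) - l x ^+ 2)) by field.
  apply: val_ge1M; first by rewrite expr2 val_geM0.
  by apply: val_geB => //; apply: val_ge1M.
have [[x xD e]|[x xD e]] := two_cosets (sqr_two_to_one Ol lr linj) fD gD ginj disj (rD b Ob b1).
  by case: (nb (l x) (Ol x)); exact: (rE _ _ Ob (Oq x) e).
exists (a * l x); first by rewrite val_geM0.
have e' := lr _ (Oq x); rewrite -/(f x) in e'.
have {}e := rE _ _ Ob (Og _) e.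
have -> : a * b - (a * l x) ^+ 2 = a * (b - a * l (f x)) + a * (a * (l (f x) - l x ^+ 2)).
  ring.
by apply: val_geD; do ?apply: val_ge1M.
Qed.

(** Counting zero, the squares are more than half of the residue field, so the values x ^ 2 and a +
    b y ^ 2 have one in common. *)
Lemma residue_norm_surj a b : O a -> O b -> ~ val_ge v 1 b ->
  exists x y, [/\ O x, O y & a ~~ x ^+ 2 - b * y ^+ 2].
Proof.
move=> Oa Ob b1; have [T [l [r [Ol lr linj]]]] := finite_residueP finres.
have Oq t : O (l t ^+ 2) by rewrite expr2 val_geM0.
pose f t := r (l t ^+ 2); pose g t := r (a + b * l t).
have Og t : O (a + b * l t) by rewrite val_geD // val_geM0.
have rE x y : O x -> O y -> r x = r y -> x ~~ y.
  move=> Ox Oy xy; apply: (@val_ge_trans _ v 1 (l (r x))); first by rewrite val_ge_sub lr.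
  by rewrite xy lr.
have O0 : O 0 by exact: val_ge0.
have l0 : val_ge v 1 (l (r 0)) by rewrite -[l _]subr0 lr.
pose A := f @: [set: T].
have cA : (#|T| < 2 * #|A|)%N.
  have DE : D l = ([set~ r 0])%SET.
    apply/finset.setP => t; rewrite !inE; congr negb; apply/idP/eqP => [t1|-> //].
    by apply: linj; rewrite val_geB.
  have fr0 : f (r 0) \notin f @: D l.
    apply/imsetP => -[t]; rewrite inE => /negP t1 /(rE _ _ (Oq _) (Oq _)) e; apply: t1.
    apply: val_ge1_sqr; rewrite -[l t ^+ 2](subKr (l (r 0) ^+ 2)) val_geB //.
    by rewrite expr2 val_ge1M // val_ge01.
  have -> : A = f (r 0) |: f @: D l.
    rewrite /A (_ : [set: T] = r 0 |: D l) ?imsetU1 //.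
    by apply/finset.setP => t; rewrite DE !inE orbN.
  rewrite cardsU1 fr0 mulnDr muln1.
  have := card_at_most_two_to_one (sqr_two_to_one Ol lr linj).
  have := cardsC1 (r 0); rewrite -DE -/f; have : (0 < #|T|)%N by apply/card_gt0P; exists (r 0).
  lia.
have ginj : injective g.
  move=> x y /(rE _ _ (Og _) (Og _)).
  have -> : a + b * l x - (a + b * l y) = b * (l x - l y) by ring.
  by case/(val_ge1_mul Ob (val_geB _ _)) => // h; apply: linj.
have : ~~ [disjoint A & g @: A].
  apply/negP => dis; have := max_card (mem (A :|: g @: A)).
  move: dis; rewrite -setI_eq0 cardsU => /eqP ->.
  by rewrite cards0 subn0 card_imset // addnn -mul2n leqNgt cA.
case/pred0Pn => t /andP[/= /imsetP[x _ ->] /imsetP[_ /imsetP[y _ ->] e]].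
exists (l x), (l y); split=> //.
have {}e := rE _ _ (Oq _) (Og _) e.
have e' := lr _ (Oq y); rewrite -/(f y) in e'.
have -> : a - (l x ^+ 2 - b * l y ^+ 2) =
    - (l x ^+ 2 - (a + b * l (f y))) - b * (l (f y) - l y ^+ 2) by ring.
by apply: val_geB; [rewrite val_geN | apply: val_ge1M].
Qed.

End Tame.

End Residues.

(** * The norm index over a complete field *)

Section NormForm.
Variables (F : fieldType) (b : F).

Definition is_norm (a : F) : Prop := exists x y : F, a = x ^+ 2 - b * y ^+ 2.

Lemma is_norm_sqr x : is_norm (x ^+ 2).
Proof. by exists x, 0; rewrite expr0n mulr0 subr0. Qed.

Lemma is_norm1 : is_norm 1.
Proof. by rewrite -(expr1n _ 2); exact: is_norm_sqr. Qed.

Lemma is_normM a a' : is_norm a -> is_norm a' -> is_norm (a * a').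
Proof.
move=> [x [y ->]] [z [t ->]]; exists (x * z + b * y * t), (x * t + y * z); ring.
Qed.

Lemma is_normV a : is_norm a -> is_norm a^-1.
Proof.
have [->|a0] := eqVneq a 0; first by rewrite invr0.
move=> Na; rewrite (_ : a^-1 = a * a^-1 ^+ 2); last by field.
by apply: is_normM => //; exact: is_norm_sqr.
Qed.

Lemma is_norm_mulr a c : c != 0 -> is_norm c -> is_norm (a * c) -> is_norm a.
Proof.
by move=> c0 Nc Nac; rewrite -(mulfK c0 a); apply: is_normM => //; exact: is_normV.
Qed.

End NormForm.

Lemma is_norm_twist (F : fieldType) (a b t : F) : t != 0 -> is_norm (b * t ^+ 2) a <-> is_norm b a.
Proof.
move=> t0; split=> -[x [y ->]].
  by exists x, (t * y); ring.
by exists x, (y / t); field.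
Qed.

Section LocalIndex.
Variables (F : fieldType) (v : finite_place F).
Hypotheses (two_neq0 : 2 != 0 :> F) (finres : finite_residue v).
Hypothesis hensel : forall x, val_ge v (v 2 + v 2 + 1) (x - 1) -> exists y, x = y ^+ 2.
Implicit Types (x y z a b : F).

Local Notation O := (val_ge v 0).
Local Notation e := (v 2).

Let four_neq0 : 4 != 0 :> F.
Proof. by rewrite (natrM _ 2 2) mulf_neq0. Qed.

Let val4 : v 4 = e + e.
Proof. by rewrite (natrM _ 2 2) place_valM. Qed.

(** The level v (x - 1) measures closeness to 1. Its boundedness replaces repeated improvement of an
    approximation by the choice of an optimal one. *)
Lemma max_level (P : F -> Prop) : (exists x, P x) ->
  (forall x, P x -> [/\ x != 1, 0 <= v (x - 1) & v (x - 1) <= e + e]) ->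
  exists2 x, P x & forall y, P y -> v (y - 1) <= v (x - 1).
Proof.
move=> [x0 Px0] bd.
pose Q (n : nat) := `[< exists2 x, P x & v (x - 1) = n%:Z >].
have exQ : exists n, Q n.
  have [_ h _] := bd _ Px0; exists (absz (v (x0 - 1))); apply/asboolP; exists x0 => //.
  by rewrite gez0_abs.
have ubQ n : Q n -> (n <= absz (e + e)%R)%N.
  by move=> /asboolP[x /bd[_ _ h] xn]; int_lia.
case: (ex_maxnP exQ ubQ) => n /asboolP[x Px xn] nmax; exists x => // y Py.
have [_ h _] := bd _ Py; have : (absz (v (y - 1)%R) <= n)%N; last by int_lia.
by apply: nmax; apply/asboolP; exists y => //; rewrite gez0_abs.
Qed.

Lemma exists_half_twist x : x != 0 ->
  exists t, [/\ t != 0 & v (x * t ^+ 2) = 0 \/ v (x * t ^+ 2) = 1].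
Proof.
move=> x0; have [t t0 vt] := place_val_surj v (- (v x %/ 2)%Z); exists t; split=> //.
rewrite place_valM ?expf_neq0 // place_valX // vt mulr2n; int_lia.
Qed.

Lemma twist_by_sqr x k : x != 0 -> v x = k + k ->
  exists t, [/\ t != 0 & v (x * t ^+ 2) = 0].
Proof.
move=> x0 xk; have [t t0 vt] := place_val_surj v (- k); exists t; split=> //.
rewrite place_valM ?expf_neq0 // place_valX // vt mulr2n; int_lia.
Qed.

(* The unit 1 + eps is the norm of (1 + y) + y sqrt b, where y = (1 - r) / d,
   d = b - 1 and r ^ 2 = 1 - d eps. *)
Lemma close_to1_is_norm b x : b != 1 -> val_ge v (e + e - v (b - 1) + 1) (x - 1) ->
  is_norm b x.
Proof.
move=> b1 hx; have d0 : b - 1 != 0 by rewrite subr_eq0.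
have [r rE] : exists r, 1 - (b - 1) * (x - 1) = r ^+ 2.
  apply: hensel; have -> : 1 - (b - 1) * (x - 1) - 1 = - ((b - 1) * (x - 1)) by ring.
  rewrite val_geN.
  have -> : e + e + 1 = v (b - 1) + (e + e - v (b - 1) + 1) by int_lia.
  by rewrite val_geM // val_ge_refl.
exists (1 + (1 - r) / (b - 1)), ((1 - r) / (b - 1)).
have -> : x = 1 + (1 - r ^+ 2) / (b - 1) by rewrite -rE; field.
by field.
Qed.

(* Up to squares, a distance to 1 below 2e is odd (residue characteristic 2). *)
Lemma even_level_improve x c : 0 < e -> x != 0 -> v x = 0 -> x != 1 ->
  v (x - 1) = c + c -> 0 <= c -> c + c < e + e ->
  exists t, [/\ t != 0, v t = 0 & val_ge v (c + c + 1) (x * t ^+ 2 - 1)].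
Proof.
move=> e0 x0 vx x1 vc c0 ce.
suff [s [s0 vs xs]] : exists s, [/\ s != 0, v s = 0 & val_ge v (c + c + 1) (x - s ^+ 2)].
  exists s^-1; split; rewrite ?invr_eq0 ?place_valV ?vs //.
  have -> : x * s^-1 ^+ 2 - 1 = (x - s ^+ 2) / s ^+ 2 by field.
  by rewrite val_ge_div ?expf_neq0 // place_valX // vs mul0rn addr0.
have [c00|c_neq0] := eqVneq c 0.
  have [s [s0 vs xs]] : exists s, [/\ s != 0, v s = 0 & val_ge v (0 + 0 + 1) (x - s ^+ 2)].
    exact: sqrt_residue.
  by exists s; rewrite c00.
(* If x - 1 is close to p ^ 2, then x is close to (1 + p) ^ 2: the cross term 2 p has valuation e +
   c, which exceeds c + c. *)
have [|p [p0 vp xp]] := sqrt_residue two_neq0 finres e0 _ vc; first by rewrite subr_eq0.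
have one0 := oner_neq0 F; have c1 : 0 < c by rewrite lt_def c_neq0.
have [s0 vs] : 1 + p != 0 /\ v (1 + p) = v 1.
  by apply: place_val_addl => //; rewrite place_val1 val_geE // vp; int_lia.
exists (1 + p); rewrite vs place_val1; split=> //.
have -> : x - (1 + p) ^+ 2 = x - 1 - p ^+ 2 - 2 * p by ring.
by apply: val_geB => //; rewrite val_geE ?mulf_neq0 // place_valM // vp; int_lia.
Qed.

(** * Norms for a fixed b, taken as close to 1 as its square class permits *)

Section FixedB.
Variable b : F.
Hypotheses (b0 : b != 0) (vb : v b = 0 \/ v b = 1) (b1 : b != 1).
Hypothesis d_le : v (b - 1) <= e + e.
Hypothesis bmax : forall t, t != 0 -> v (b * t ^+ 2) = 0 \/ v (b * t ^+ 2) = 1 ->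
  v (b * t ^+ 2 - 1) <= v (b - 1).

Local Notation N := (is_norm b).
Local Notation d := (v (b - 1)).

Let d_neq0 : b - 1 != 0. Proof. by rewrite subr_eq0. Qed.

Let nonneg_level x : x != 0 -> x != 1 -> v x = 0 \/ v x = 1 -> 0 <= v (x - 1).
Proof.
move=> x0 x1 vx; have : O (x - 1).
  apply: val_geB; first by rewrite val_geE //; case: vx => ->.
  by rewrite val_geE ?oner_neq0 // place_val1.
by rewrite val_geE // subr_eq0.
Qed.

Let d_ge0 : 0 <= d. Proof. exact: nonneg_level. Qed.

Let positive_level x : x != 0 -> 0 < v (x - 1) -> v x = 0.
Proof.
move=> x0 x1; have h : val_ge v 1 (1 - x).
  by rewrite val_ge_sub; apply: (val_geW _ (val_ge_refl v (x - 1))); int_lia.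
have lt : v 1 < 1 by rewrite place_val1.
by have [_ ->] := place_val_close (oner_neq0 F) lt h; rewrite place_val1.
Qed.

(** For a unit, an even level below 2 e could be raised by a square; maximality leaves an odd level
    or a uniformizer, whose level is 0. *)
Lemma wild_max_level x : 0 < e -> x != 0 -> x != 1 -> v x = 0 \/ v x = 1 ->
  v (x - 1) < e + e ->
  (forall t, t != 0 -> v (x * t ^+ 2) = 0 \/ v (x * t ^+ 2) = 1 ->
     x * t ^+ 2 != 1 -> v (x * t ^+ 2 - 1) <= v (x - 1)) ->
  (forall t, t != 0 -> x * t ^+ 2 != 1) ->
  (v (x - 1) = 0 /\ v x = 1) \/ exists k, v (x - 1) = k + k + 1.
Proof.
move=> e0 x0 x1 vx xe xmax xsq.
have c0 := nonneg_level x0 x1 vx.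
have [k [kE|kE]] : exists k, v (x - 1) = k + k \/ v (x - 1) = k + k + 1.
- by exists (v (x - 1) %/ 2)%Z; int_lia.
- case: vx => vx; last first.
    left; split=> //; apply/eqP; rewrite eq_le c0 andbT leNgt; apply/negP.
    by move/(positive_level x0); rewrite vx.
  have [||t [t0 vt]] := even_level_improve e0 x0 vx x1 kE; try int_lia.
  have := xmax t t0; rewrite place_valM ?expf_neq0 // place_valX // vt vx mul0rn.
  move=> /(_ (or_introl erefl) (xsq t t0)).
  rewrite val_geE ?subr_eq0 ?xsq //; int_lia.
- by right; exists k.
Qed.

Hypothesis b_nsq : forall t, t != 0 -> b * t ^+ 2 != 1.

Let wild_b : 0 < e -> [\/ d = 0 /\ v b = 1, exists k, d = k + k + 1 | d = e + e].
Proof.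
move=> e0; have [/eqP dE|dne] := boolP (d == e + e); first by constructor 3.
case: (wild_max_level e0 b0 b1 vb); rewrite ?lt_neqAle ?dne //.
- by move=> t t0 vt _; apply: bmax.
- by constructor.
- by constructor 2.
Qed.

(** The norm of (1 + y) + y sqrt b; for small y this supplies the norms close to 1. *)
Let norm_form y : N (1 + 2 * y - (b - 1) * y ^+ 2).
Proof. by exists (1 + y), y; ring. Qed.

Let norm_sqrt : N (- b). Proof. by exists 0, 1; ring. Qed.

Let norm_delta : N (1 - b). Proof. by exists 1, 1; ring. Qed.

Definition best_in_norm_class a x : Prop :=
  [/\ x != 0, v x = 0 \/ v x = 1, exists2 n, n != 0 /\ N n & x = a * n
    & forall n, n != 0 -> N n -> v (a * n) = 0 \/ v (a * n) = 1 ->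
        v (a * n - 1) <= v (x - 1)].

Lemma exists_best a : a != 0 -> ~ N a -> exists x, best_in_norm_class a x.
Proof.
move=> a0 Na.
pose P x := (v x = 0 \/ v x = 1) /\ exists2 n, n != 0 /\ N n & x = a * n.
have [|x [vx [n [n0 Nn] xE]]|x [vx [n [n0 Nn] xE]] xmax] := @max_level P.
- have [t [t0 vt]] := exists_half_twist a0.
  exists (a * t ^+ 2); split=> //; exists (t ^+ 2) => //; split; last exact: is_norm_sqr.
  exact: expf_neq0.
- have nNx : ~ N x by rewrite xE; apply: contra_not Na; exact: is_norm_mulr.
  have x1 : x != 1.
    by apply: contra_notN nNx => /eqP ->; exact: is_norm1.
  have x0 : x != 0 by rewrite xE mulf_neq0.
  split=> //; first exact: nonneg_level.
  rewrite leNgt; apply/negP => lt; apply: nNx; apply: close_to1_is_norm b1 _.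
  apply: (val_geW _ (val_ge_refl v (x - 1))); int_lia.
- exists x; split=> //; first by rewrite xE mulf_neq0.
    by exists n.
  by move=> m m0 Nm vm; apply: xmax; split=> //; exists m.
Qed.

Section Best.
Variables (a x : F).
Hypotheses (a0 : a != 0) (nNa : ~ N a) (best : best_in_norm_class a x).

Let x0 : x != 0. Proof. by case: best. Qed.
Let vx : v x = 0 \/ v x = 1. Proof. by case: best. Qed.

Let best_mul n : n != 0 -> N n -> v (x * n) = 0 \/ v (x * n) = 1 ->
  v (x * n - 1) <= v (x - 1).
Proof.
case: best => _ _ [m [m0 Nm] ->] bx n0 Nn; rewrite -mulrA => h.
by apply: bx => //; rewrite ?mulf_neq0 //; exact: is_normM.
Qed.

Lemma best_not_norm : ~ N x.
Proof. by case: best => _ _ [n [n0 Nn] ->] _; apply: contra_not nNa; exact: is_norm_mulr. Qed.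

Let x_mul_neq1 n : n != 0 -> N n -> x * n != 1.
Proof.
move=> n0 Nn; apply/eqP => xn; apply: best_not_norm; apply: is_norm_mulr n0 Nn _.
by rewrite xn; exact: is_norm1.
Qed.

Let x1 : x != 1.
Proof.
have N1 : N 1 by exact: is_norm1.
by have := x_mul_neq1 (oner_neq0 F) N1; rewrite mulr1.
Qed.

Lemma best_level_le : v (x - 1) <= e + e - d.
Proof.
rewrite leNgt; apply/negP => lt; apply: best_not_norm; apply: close_to1_is_norm b1 _.
apply: (val_geW _ (val_ge_refl v (x - 1))); int_lia.
Qed.

Lemma best_level_ge0 : 0 <= v (x - 1). Proof. exact: nonneg_level. Qed.

(** Otherwise x / n would lie in the same norm class and be closer to 1 than the optimal x. *)
Let improve_close n : n != 0 -> N n -> v x = v n -> val_ge v (v (x - 1) + 1 + v n) (x - n) -> False.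
Proof.
move=> n0 Nn xn h.
have Vn : N n^-1 by exact: is_normV.
have n'0 : n^-1 != 0 by rewrite invr_eq0.
have := best_mul n'0 Vn; rewrite place_valMz // xn subrr => /(_ (or_introl erefl)).
have -> : x / n - 1 = (x - n) / n by field.
apply/negP; rewrite -ltNge.
have : val_ge v (v (x - 1) + 1) ((x - n) / n) by rewrite val_ge_div.
rewrite val_geE; first int_lia.
by rewrite mulf_neq0 // subr_eq0; apply: contraNneq (x_mul_neq1 n'0 Vn) => ->; rewrite mulfV.
Qed.

Lemma wild_best : 0 < e -> v (x - 1) < e + e ->
  (v (x - 1) = 0 /\ v x = 1) \/ exists k, v (x - 1) = k + k + 1.
Proof.
move=> e0 lt; apply: wild_max_level => //.
- by move=> t t0 vt _; apply: best_mul; rewrite ?expf_neq0 //; exact: is_norm_sqr.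
- by move=> t t0; apply: x_mul_neq1; rewrite ?expf_neq0 //; exact: is_norm_sqr.
Qed.

(** Up to a square, x n is a unit, and in residue characteristic 2 a further square brings it to
    level at least 1, better than the level 0 of x. *)
Let odd_norm_improve n k : 0 < e -> v (x - 1) = 0 -> v x = 1 ->
  n != 0 -> N n -> v n = k + k + 1 -> False.
Proof.
move=> e0 vx1 vxE n0 Nn nk.
have xn0 : x * n != 0 by rewrite mulf_neq0.
have [|t [t0 vt]] := @twist_by_sqr (x * n) (k + 1) xn0.
  by rewrite place_valM // vxE nk; int_lia.
have t20 : t ^+ 2 != 0 by rewrite expf_neq0.
have y0 : x * n * t ^+ 2 != 0 by rewrite mulf_neq0.
have nt0 : n * t ^+ 2 != 0 by rewrite mulf_neq0.
have Nnt : N (n * t ^+ 2) by apply: is_normM => //; exact: is_norm_sqr.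
have y1 : x * n * t ^+ 2 != 1 by rewrite -mulrA x_mul_neq1.
have := best_mul nt0 Nnt; rewrite mulrA vt vx1 => /(_ (or_introl erefl)) h.
have vy : v (x * n * t ^+ 2 - 1) = 0 + 0.
  by apply/eqP; rewrite addr0 eq_le h nonneg_level //; left.
have [||s [s0 vs hs]] := even_level_improve e0 y0 vt y1 vy; try int_lia.
have s20 : s ^+ 2 != 0 by rewrite expf_neq0.
have nts0 : n * t ^+ 2 * s ^+ 2 != 0 by rewrite mulf_neq0.
have Nnts : N (n * t ^+ 2 * s ^+ 2) by apply: is_normM => //; exact: is_norm_sqr.
have := best_mul nts0 Nnts; rewrite 2!mulrA place_valM // vt place_valX // vs mul0rn vx1.
move=> /(_ (or_introl erefl)); move: hs; rewrite val_geE.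
  int_lia.
rewrite subr_eq0 (_ : x * n * t ^+ 2 * s ^+ 2 = x * (n * t ^+ 2 * s ^+ 2)); last by ring.
exact: x_mul_neq1.
Qed.

(** Below 2 e - d an improvement always exists. If x is a uniformizer, -b or 1 - b is a norm of odd
    valuation. If the level of x is odd, solving for y ^ 2 in the residue field makes 1 - b y ^ 2,
    or the norm of (1 + y) + y sqrt b, agree with x to higher order. *)
Lemma best_levelE : v (x - 1) = e + e - d.
Proof.
apply/eqP; rewrite eq_le best_level_le leNgt; apply/negP => lt.
have c_ge0 := best_level_ge0.
have [e0|e_neq0] := ltP 0 e; last by int_lia.
have xsub0 : x - 1 != 0 by rewrite subr_eq0.
have [|[vx1 vxE]|[k ck]] := wild_best e0; first by int_lia.
- have [[d0 vb1]|[l dl]|dE] := wild_b e0; last by int_lia.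
    apply: (odd_norm_improve (n := - b) (k := 0)) => //; first by rewrite oppr_eq0.
    by rewrite place_valN.
  apply: (odd_norm_improve (n := 1 - b) (k := l)) => //; first by rewrite -opprB oppr_eq0.
  by rewrite -opprB place_valN.
- have vxE : v x = 0 by apply: positive_level => //; int_lia.
  have ltx : v x < v (x - 1) + 1 by rewrite vxE; int_lia.
  have [[d0 vb1]|[l dl]|dE] := wild_b e0; last by int_lia.
    have [||y [y0 vy hy]] := @sqrt_residue _ v two_neq0 finres e0 (- (x - 1) / b) k.
    + by rewrite mulf_neq0 ?invr_eq0 ?oppr_eq0.
    + by rewrite place_valMz ?oppr_eq0 // place_valN // ck vb1; int_lia.
    have N' : N (1 - b * y ^+ 2) by exists 1, y; rewrite expr1n.
    have hxn : val_ge v (v (x - 1) + 1) (x - (1 - b * y ^+ 2)).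
      have -> : x - (1 - b * y ^+ 2) = - (b * (- (x - 1) / b - y ^+ 2)) by field.
      by rewrite val_geN ck addrC val_geM // -?vb1 ?val_ge_refl.
    have [n0 vn] := place_val_close x0 ltx hxn.
    by apply: (improve_close n0 N'); rewrite vn // vxE addr0.
  have [||y [y0 vy hy]] := @sqrt_residue _ v two_neq0 finres e0 (- (x - 1) / (b - 1)) (k - l).
  + by rewrite mulf_neq0 ?invr_eq0 ?oppr_eq0.
  + by rewrite place_valMz ?oppr_eq0 // place_valN // ck dl; int_lia.
  have N' := norm_form y.
  have hxn : val_ge v (v (x - 1) + 1) (x - (1 + 2 * y - (b - 1) * y ^+ 2)).
    have -> : x - (1 + 2 * y - (b - 1) * y ^+ 2) =
        - ((b - 1) * (- (x - 1) / (b - 1) - y ^+ 2)) - 2 * y by field.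
    apply: val_geB.
      rewrite val_geN; have -> : v (x - 1) + 1 = d + (k - l + (k - l) + 1) by int_lia.
      by rewrite val_geM // val_ge_refl.
    by rewrite val_geE ?mulf_neq0 // place_valM // vy; int_lia.
  have [n0 vn] := place_val_close x0 ltx hxn.
  by apply: (improve_close n0 N'); rewrite vn // vxE addr0.
Qed.

(* At the critical level, the class of [eps * (b - 1) / 4] is not of the form
   y - y ^ 2 in the residue field. *)
Lemma critical_residue y : 0 < e -> d < e + e -> O y ->
  ~ val_ge v 1 ((x - 1) * (b - 1) / 4 - (y - y ^+ 2)).
Proof.
move=> e0 de Oy h.
have vxE : v x = 0 by apply: positive_level => //; rewrite best_levelE; int_lia.
have ltx : v x < v (x - 1) + 1 by rewrite vxE best_levelE; int_lia.
(* The argument 2 y / (b - 1) gives the linear and quadratic terms the same size: the norm is 1 + 4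
   / (b - 1) (y - y ^ 2). *)
pose n := 1 + 2 * (2 * y / (b - 1)) - (b - 1) * (2 * y / (b - 1)) ^+ 2.
have hxn : val_ge v (v (x - 1) + 1) (x - n).
  have -> : x - n = 4 / (b - 1) * ((x - 1) * (b - 1) / 4 - (y - y ^+ 2)).
    by rewrite /n; field; rewrite four_neq0.
  by rewrite val_geM // best_levelE -val4 -place_valMz // val_ge_refl.
have [n0 vn] := place_val_close x0 ltx hxn.
by apply: (improve_close n0 (norm_form _)); rewrite vn // vxE addr0.
Qed.

End Best.

(** A norm with the right residue exists by [residue_norm_surj], and the quotient by it is close
    enough to 1 to be a norm itself. *)
Lemma tame_unit_norm x : e = 0 -> v b = 0 -> x != 0 -> v x = 0 -> N x.
Proof.
move=> e0 vb0 x0 vx.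
have Ox : O x by rewrite val_geE // vx.
have Ob : O b by rewrite val_geE // vb0.
have b_unit : ~ val_ge v 1 b by rewrite val_geE // vb0.
have [y [z [Oy Oz xyz]]] := residue_norm_surj two_neq0 finres e0 Ox Ob b_unit.
have ltx : v x < 1 by rewrite vx.
have [n0 vn] := place_val_close x0 ltx xyz.
have Nn : N (y ^+ 2 - b * z ^+ 2) by exists y, z.
apply: (is_norm_mulr _ (is_normV Nn)); first by rewrite invr_eq0.
apply: close_to1_is_norm b1 _.
have -> : x / (y ^+ 2 - b * z ^+ 2) - 1 =
    (x - (y ^+ 2 - b * z ^+ 2)) / (y ^+ 2 - b * z ^+ 2) by field.
apply: val_ge_div => //; rewrite vn vx; apply: val_geW xyz; int_lia.
Qed.

(** This is the unramified case: level 1 already makes a unit a norm, and a square brings every unit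
    there. *)
Lemma even_norm_of_level0 x k : 0 < e -> d = e + e -> x != 0 -> v x = k + k -> N x.
Proof.
move=> e0 dE x0 vx; have [t [t0 vt]] := twist_by_sqr x0 vx.
have t20 : t ^+ 2 != 0 by rewrite expf_neq0.
apply: (is_norm_mulr t20 (is_norm_sqr _ _)).
have y0 : x * t ^+ 2 != 0 by rewrite mulf_neq0.
have [->|y1] := eqVneq (x * t ^+ 2) 1.
  by exact: is_norm1.
have c0 : 0 <= v (x * t ^+ 2 - 1) by apply: nonneg_level => //; left.
have [cE|c_neq0] := eqVneq (v (x * t ^+ 2 - 1)) 0.
  have [||s [s0 vs hs]] := @even_level_improve _ 0 e0 y0 vt y1 cE; try int_lia.
  have s20 : s ^+ 2 != 0 by rewrite expf_neq0.
  apply: (is_norm_mulr s20 (is_norm_sqr _ _)); apply: close_to1_is_norm b1 _.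
  by apply: val_geW hs; int_lia.
have c1 : 0 < v (x * t ^+ 2 - 1) by rewrite lt_def c_neq0.
have {}c1 : 1 <= v (x * t ^+ 2 - 1) by int_lia.
by apply: close_to1_is_norm b1 _; rewrite dE subrr add0r val_geE ?subr_eq0.
Qed.

Lemma tame_ramified_norm x x' : e = 0 -> v b = 1 -> x != 0 -> v x = 0 -> x' != 0 -> v x' = 0 ->
  ~ N x -> ~ N x' -> N (x * x').
Proof.
move=> e0 vb1 x0 vx x'0 vx' nNx nNx'.
have sq y z : y != 0 -> v y = 0 -> y - z ^+ 2 = 0 \/ val_ge v 1 (y - z ^+ 2) -> N y.
  move=> y0 vy [/eqP|h]; first by rewrite subr_eq0 => /eqP ->; exact: is_norm_sqr.
  have lty : v y < 1 by rewrite vy.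
  have [z0 vz] := place_val_close y0 lty h.
  apply: (is_norm_mulr _ (is_normV (is_norm_sqr b z))); first by rewrite invr_eq0.
  apply: close_to1_is_norm b1 _.
  have -> : y / z ^+ 2 - 1 = (y - z ^+ 2) / z ^+ 2.
    by field; move: z0; rewrite expf_eq0.
  apply: val_ge_div => //; rewrite vz vy; apply: val_geW h; int_lia.
have u y : y != 0 -> v y = 0 -> O y /\ ~ val_ge v 1 y.
  by move=> y0 vy; rewrite !val_geE // vy.
have [[Ox ux] [Ox' ux']] := (u x x0 vx, u x' x'0 vx').
have [||y Oy h] := square_residues_index2 finres Ox ux Ox' ux'.
- by move=> y Oy h; apply: nNx; apply: (sq x y) => //; right.
- by move=> y Oy h; apply: nNx'; apply: (sq x' y) => //; right.
by apply: (sq _ y); rewrite ?mulf_neq0 ?place_valM ?vx ?vx' //; right.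
Qed.

Lemma norm_index2_normalized a a' : a != 0 -> a' != 0 -> ~ N a -> ~ N a' -> N (a * a').
Proof.
move=> a0 a'0 nNa nNa'.
have [x bx] := exists_best a0 nNa; have [x' bx'] := exists_best a'0 nNa'.
have nNx := best_not_norm nNa bx; have nNx' := best_not_norm nNa' bx'.
have xc := best_levelE nNa bx; have x'c := best_levelE nNa' bx'.
have xc0 := best_level_ge0 nNa bx; have x'c0 := best_level_ge0 nNa' bx'.
suff Nxx' : N (x * x').
  have [_ _ [n [n0 Nn] xE] _] := bx; have [_ _ [n' [n'0 Nn'] x'E] _] := bx'.
  have nn0 : n * n' != 0 by rewrite mulf_neq0.
  by apply: (is_norm_mulr nn0 (is_normM Nn Nn')); rewrite mulrACA -xE -x'E.
have [x0 vx _ _] := bx; have [x'0 vx' _ _] := bx'.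
have xx'0 : x * x' != 0 by rewrite mulf_neq0.
have even_prod : v x = 1 -> v x' = 1 -> v (x * x') = 1 + 1.
  by move=> h h'; rewrite place_valM // h h'.
have [e0|e_neq0] := ltP 0 e; last first.
  have {e_neq0} e0 : e = 0 by int_lia.
  (* For v b = 0 all units are norms, so both representatives have valuation 1 and their product is
     a unit up to a square. *)
  case: vb => vbE.
    have vx1 : v x = 1 by case: vx => // vxE; case: nNx; exact: tame_unit_norm.
    have vx'1 : v x' = 1 by case: vx' => // vxE; case: nNx'; exact: tame_unit_norm.
    have [t [t0 vt]] := twist_by_sqr xx'0 (even_prod vx1 vx'1).
    have t20 : t ^+ 2 != 0 by rewrite expf_neq0.
    apply: (is_norm_mulr t20 (is_norm_sqr _ _)).
    by apply: tame_unit_norm => //; rewrite mulf_neq0.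
  (* For v b = 1 the norm -b has odd valuation and moves each norm class to the units. *)
  have unit_rep y : y != 0 -> v y = 0 \/ v y = 1 ->
      exists n, [/\ n != 0, N n & v (y * n) = 0].
    move=> y0 [vy|vy].
      by exists 1; rewrite oner_neq0 mulr1; split=> //; exact: is_norm1.
    have yb0 : y * - b != 0 by rewrite mulf_neq0 ?oppr_eq0.
    have [|t [t0 vt]] := @twist_by_sqr _ 1 yb0.
      by rewrite place_valM ?oppr_eq0 // place_valN // vy vbE.
    exists (- b * t ^+ 2); rewrite (mulrA y); split=> //.
      by rewrite mulf_neq0 ?oppr_eq0 ?expf_neq0.
    by apply: is_normM => //; exact: is_norm_sqr.
  have [n [n0 Nn vn]] := unit_rep x x0 vx; have [n' [n'0 Nn' vn']] := unit_rep x' x'0 vx'.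
  have nn0 : n * n' != 0 by rewrite mulf_neq0.
  apply: (is_norm_mulr nn0 (is_normM Nn Nn')); rewrite mulrACA.
  apply: tame_ramified_norm; rewrite ?mulf_neq0 //.
    exact: contra_not (is_norm_mulr n0 Nn) nNx.
  exact: contra_not (is_norm_mulr n'0 Nn') nNx'.
(* For d = 2 e both levels are 0, which forces valuation 1; the product then has even valuation. *)
have [dE|d_neq] := eqVneq d (e + e).
  have [|[_ vx1]|[k]] := wild_best nNa bx e0; try int_lia.
  have [|[_ vx'1]|[k]] := wild_best nNa' bx' e0; try int_lia.
  by apply: even_norm_of_level0 (even_prod vx1 vx'1).
have de : d < e + e by rewrite lt_neqAle d_neq d_le.
have one : N 1 by exact: is_norm1.
have xsub0 : x - 1 != 0 by rewrite subr_eq0; apply: contra_notN nNx => /eqP ->.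
have x'sub0 : x' - 1 != 0 by rewrite subr_eq0; apply: contra_notN nNx' => /eqP ->.
(* [K] rescales deviations from 1 at the critical level 2 e - d to integral elements. It turns
   products into sums to first order, since (x - 1) (x' - 1) is of higher order. *)
pose K z := (z - 1) * (b - 1) / 4.
have OK z : z - 1 != 0 -> v (z - 1) = e + e - d -> O (K z).
  move=> z0 vz; have Kz0 : (z - 1) * (b - 1) != 0 by rewrite mulf_neq0.
  rewrite val_geE ?mulf_neq0 ?invr_eq0 // place_valMz // place_valM // vz val4; int_lia.
have [||y Oy h] := artin_schreier_index2 two_neq0 finres e0 (OK x xsub0 xc) (OK x' x'sub0 x'c).
- by move=> y Oy; exact: (critical_residue nNa bx e0 de Oy).
- by move=> y Oy; exact: (critical_residue nNa' bx' e0 de Oy).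
pose n := 1 + 2 * (2 * y / (b - 1)) - (b - 1) * (2 * y / (b - 1)) ^+ 2.
have hn : val_ge v (e + e - d + 1) (x * x' - n).
  have -> : x * x' - n =
      4 / (b - 1) * (K x + K x' - (y - y ^+ 2)) + (x - 1) * (x' - 1).
    by rewrite /n /K; field; rewrite four_neq0.
  apply: val_geD; first by rewrite val_geM // -val4 -place_valMz // val_ge_refl.
  by rewrite val_geE ?mulf_neq0 // place_valM // xc x'c; int_lia.
have vx0 : v x = 0 by apply: positive_level => //; rewrite xc; int_lia.
have vx'0 : v x' = 0 by apply: positive_level => //; rewrite x'c; int_lia.
have vxx' : v (x * x') = 0 by rewrite place_valM // vx0 vx'0.
have lt : v (x * x') < e + e - d + 1 by rewrite vxx'; int_lia.
have [n0 vn] := place_val_close xx'0 lt hn.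
have Nn : N n by exact: norm_form.
apply: (is_norm_mulr _ (is_normV Nn)); first by rewrite invr_eq0.
apply: close_to1_is_norm b1 _.
have -> : x * x' / n - 1 = (x * x' - n) / n by field.
by apply: val_ge_div => //; rewrite vn vxx' addr0.
Qed.

End FixedB.

Theorem local_norm_index2 b a a' : b != 0 -> a != 0 -> a' != 0 ->
  ~ is_norm b a -> ~ is_norm b a' -> is_norm b (a * a').
Proof.
move=> b0 a0 a'0 nNa nNa'.
(* If b were a square, the form would represent everything, against the non-norm a. *)
have nsq t : t != 0 -> b * t ^+ 2 != 1.
  move=> t0; apply: contra_notN nNa => /eqP bt.
  apply/(is_norm_twist _ _ t0); rewrite bt.
  by exists ((a + 1) / 2), ((a - 1) / 2); field.
pose P x := (v x = 0 \/ v x = 1) /\ exists2 t, t != 0 & x = b * t ^+ 2.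
have [|x [vx [t t0 xE]]|x [vx [t t0 xE]] xmax] := @max_level P.
- by have [t [t0 vt]] := exists_half_twist b0; exists (b * t ^+ 2); split=> //; exists t.
- have x1 : x != 1 by rewrite xE nsq.
  have x0 : x != 0 by rewrite xE mulf_neq0 ?expf_neq0.
  have xsub0 : x - 1 != 0 by rewrite subr_eq0.
  split=> //.
    have : O (x - 1).
      apply: val_geB; first by rewrite val_geE //; case: vx => ->.
      by rewrite val_geE ?oner_neq0 // place_val1.
    by rewrite val_geE.
  rewrite leNgt; apply/negP => lt.
  have [|y yE] := hensel (x := x); first by apply: (val_geW _ (val_ge_refl v (x - 1))); int_lia.
  have y0 : y != 0 by apply: contraNneq x0 => y0; rewrite yE y0 expr0n.
  have := nsq (t / y); rewrite mulf_neq0 ?invr_eq0 // => /(_ isT)/eqP; apply.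
  by rewrite exprMn mulrA -xE yE exprVn mulfV // expf_neq0.
- apply/(is_norm_twist _ _ t0); rewrite -xE.
  have x0 : x != 0 by rewrite xE mulf_neq0 ?expf_neq0.
  have x1 : x != 1 by rewrite xE nsq.
  have xsub0 : x - 1 != 0 by rewrite subr_eq0.
  have xnsq s : s != 0 -> x * s ^+ 2 != 1.
    by move=> s0; rewrite xE -mulrA -exprMn nsq // mulf_neq0.
  have x_le : v (x - 1) <= e + e.
    rewrite leNgt; apply/negP => lt.
    have [|y yE] := hensel (x := x); first by apply: (val_geW _ (val_ge_refl v (x - 1))); int_lia.
    have y0 : y != 0 by apply: contraNneq x0 => y0; rewrite yE y0 expr0n.
    have := xnsq y^-1; rewrite invr_eq0 => /(_ y0)/eqP; apply.
    by rewrite yE exprVn mulfV // expf_neq0.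
  apply: norm_index2_normalized => //.
  + move=> s s0 vs; apply: xmax; split=> //; exists (t * s); first by rewrite mulf_neq0.
    by rewrite xE exprMn -mulrA.
  + by rewrite xE => /(is_norm_twist a b t0).1.
  + by rewrite xE => /(is_norm_twist a' b t0).1.
Qed.

End LocalIndex.

(** * Local functionals *)

Lemma int_parity (a b : int) : a *+ 2 = 1 + b *+ 2 -> False.
Proof. by rewrite !mulr2n; lia. Qed.

Lemma int_double_eq0 (a : int) : a *+ 2 = 0 -> 0 <= a.
Proof. by rewrite mulr2n; lia. Qed.

Lemma int_double_lt (a : int) : a < 0 -> 1 + a *+ 2 + 1 <= 0.
Proof. by rewrite mulr2n; lia. Qed.

(** * The valuation of the completion, and Hensel's lemma for squares *)

Section CompletionPlace.
Variables (K : fieldType) (w : finite_place K).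
Implicit Types (x y : K) (s t : cauchy_seq w) (q : completion w) (N : int).

Definition eventual_val (s : nat -> K) N : Prop :=
  exists M, forall n, (M <= n)%N -> s n != 0 /\ w (s n) = N.

Lemma eventual_val_uniq (s : nat -> K) N N' :
  eventual_val s N -> eventual_val s N' -> N = N'.
Proof.
move=> [M h] [M' h']; have [_ <-] := h (maxn M M') (leq_maxl _ _).
by have [_ ->] := h' (maxn M M') (leq_maxr _ _).
Qed.

Lemma eventual_val_exists (s : nat -> K) : is_cauchy w s -> ~ is_null w s ->
  exists N, eventual_val s N.
Proof.
move=> cs ns; have [B [M0 h0]] := not_null_bounded cs ns; have [M1 h1] := cs B.
pose m := maxn M0 M1; exists (w (s m)), m => n mn.
have [sm0 smB] := h0 m (leq_maxl _ _).
by apply: place_val_close sm0 smB _; apply: h1 (leq_maxr _ _) (leq_trans (leq_maxr _ _) mn).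
Qed.

Lemma eventual_val_close (s t : nat -> K) N : eventual_val s N ->
  is_null w (s - t) -> eventual_val t N.
Proof.
move=> [M h] /(_ (N + 1))[M' h']; exists (maxn M M') => n; rewrite geq_max => /andP[n1 n2].
have [s0 <-] := h n n1; apply: place_val_close s0 _ (h' n n2).
by have [_ ->] := h n n1; int_lia.
Qed.

Lemma pi_completion_eq s t :
  \pi_(completion w) s = \pi_(completion w) t <-> is_null w (val s - val t).
Proof.
rewrite -[is_null _ _]/(is_null w (val (s - t))).
split=> [/eqP|h]; last apply/eqP; rewrite -subr_eq0 -rmorphB pi_completion_eq0.
  by move/asboolP.
exact/asboolP.
Qed.

Lemma pi_completion_neq0 s : \pi_(completion w) s != 0 -> exists N, eventual_val (val s) N.
Proof.
move=> s0; apply: eventual_val_exists; first exact/asboolP/(valP s).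
by move=> ns; case/negP: s0; rewrite pi_completion_eq0; exact/asboolP.
Qed.

(** Any representing sequence gives the same eventual valuation. The default 0 is taken only at q =
    0, where no sequence has one. *)
Definition completion_val q : int :=
  xget 0 [set N | exists2 s : cauchy_seq w, q = \pi_(completion w) s & eventual_val (val s) N]%classic.

Lemma completion_valE s N : eventual_val (val s) N -> completion_val (\pi_(completion w) s) = N.
Proof.
move=> sN; rewrite /completion_val; case: xgetP => [M _ [t st tM]|/(_ N)[]]; last by exists s.
by apply: eventual_val_uniq (eventual_val_close tM _) sN; apply/pi_completion_eq.
Qed.

Lemma completion_quotW (P : completion w -> Prop) :
  (forall s, P (\pi_(completion w) s)) -> forall q, P q.
Proof. by move=> h q; rewrite -[q]reprK. Qed.

Lemma completion_valM q r : q != 0 -> r != 0 ->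
  completion_val (q * r) = completion_val q + completion_val r.
Proof.
move: q r; apply: completion_quotW => s; apply: completion_quotW => t.
move=> /pi_completion_neq0[N sN] /pi_completion_neq0[M tM].
rewrite (completion_valE sN) (completion_valE tM) -rmorphM; apply: completion_valE.
move: sN tM => [i hi] [j hj]; exists (maxn i j) => n; rewrite geq_max => /andP[n1 n2].
have [[s0 vs] [t0 vt]] := (hi n n1, hj n n2).
by rewrite /= !fctE mulf_neq0 // place_valM // vs vt.
Qed.

Lemma completion_valD q r : q != 0 -> r != 0 -> q + r != 0 ->
  Num.min (completion_val q) (completion_val r) <= completion_val (q + r).
Proof.
move: q r; apply: completion_quotW => s; apply: completion_quotW => t.
move=> /pi_completion_neq0[N sN] /pi_completion_neq0[M tM]; rewrite -rmorphD.
move=> /pi_completion_neq0[L stL].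
rewrite (completion_valE sN) (completion_valE tM) (completion_valE stL).
move: sN tM stL => [i hi] [j hj] [k hk]; pose n := maxn i (maxn j k).
have [s0 <-] := hi n (leq_maxl _ _).
have [t0 <-] := hj n (leq_trans (leq_maxl _ _) (leq_maxr _ _)).
have [st0 <-] := hk n (leq_trans (leq_maxr _ _) (leq_maxr _ _)).
exact: place_valD.
Qed.

Lemma completion_emb_val x : x != 0 -> completion_val (completion_emb w x) = w x.
Proof. by move=> x0; apply: completion_valE; exists 0%N. Qed.

Lemma completion_val_surj N : exists2 q, q != 0 & completion_val q = N.
Proof.
have [x x0 xN] := place_val_surj w N; exists (completion_emb w x).
  by rewrite fmorph_eq0.
by rewrite completion_emb_val.
Qed.

Definition completion_place : finite_place (completion w) :=
  FinitePlace completion_valM completion_valD completion_val_surj.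

Local Notation v := completion_place.

Lemma val_ge_completion s N : val_ge v N (\pi_(completion w) s) <->
  exists M, forall n, (M <= n)%N -> val_ge w N (val s n).
Proof.
have [s0|sn0] := eqVneq (\pi_(completion w) s) 0.
  rewrite s0 val_ge0; split=> // _.
  by have /eqP := s0; rewrite pi_completion_eq0 => /asboolP.
have [L sL] := pi_completion_neq0 sn0.
rewrite val_geE // -[v _]/(completion_val _) (completion_valE sL); split=> [NL|[M h]].
  by move: sL => [M h]; exists M => n /h[n0 nL]; rewrite val_geE // nL.
move: sL => [M' h']; have [n0 <-] := h' (maxn M M') (leq_maxr _ _).
by have := h (maxn M M') (leq_maxl _ _); rewrite val_geE.
Qed.

Lemma val_ge_emb x N : val_ge v N (completion_emb w x) = val_ge w N x.
Proof.
have [->|x0] := eqVneq x 0; first by rewrite rmorph0 !val_ge0.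
by rewrite !val_geE ?fmorph_eq0 // -[v _]/(completion_val _) completion_emb_val.
Qed.

Lemma completion_dense q N : exists x, val_ge v N (q - completion_emb w x).
Proof.
move: q; apply: completion_quotW => s.
have /asboolP/(_ N)[M h] := valP s; exists (val s M).
rewrite -rmorphB; apply/val_ge_completion; exists M => n Mn.
exact: h.
Qed.

Lemma finite_residue_completion : finite_residue w -> finite_residue v.
Proof.
move=> [s sP]; exists (map (completion_emb w) s) => q Oq.
have [x qx] := completion_dense q 1.
have /sP[y ys xy] : val_ge w 0 x.
  rewrite -val_ge_emb -[completion_emb _ _](subKr q) val_geB //.
  exact: val_geW qx.
exists (completion_emb w y); first exact: map_f.
by apply: val_ge_trans qx _; rewrite -rmorphB val_ge_emb.
Qed.

Hypothesis two_neq0 : 2 != 0 :> K.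
Local Notation e := (w 2).

Let e_ge0 : 0 <= e. Proof. exact: val_two_ge0. Qed.

(** Newton's step r - c, with c = (r ^ 2 - a) / (2 r), leaves the error c ^ 2. It is carried out
    inside K, one precision at a time. *)
Lemma newton_sqrt a (k : nat) : val_ge w (e + e + 1) (a - 1) ->
  exists r, val_ge w (e + 1) (r - 1) /\ val_ge w (e + e + 1 + k%:Z) (r ^+ 2 - a).
Proof.
move=> ha; elim: k => [|k [r [r1 ra]]].
  exists 1; rewrite subrr val_ge0 addr0 expr1n; split=> //.
  by rewrite val_ge_sub.
have [r0 vr] : r != 0 /\ w r = 0.
  have lt1 : w 1 < e + 1 by rewrite place_val1; int_lia.
  rewrite val_ge_sub in r1.
  by have [r0 ->] := place_val_close (oner_neq0 K) lt1 r1; rewrite place_val1.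
have tr0 : 2 * r != 0 by rewrite mulf_neq0.
pose c := (r ^+ 2 - a) / (2 * r).
have hc : val_ge w (e + 1 + k%:Z) c.
  apply: val_ge_div => //; rewrite place_valM // vr addr0.
  by rewrite (_ : e + 1 + k%:Z + e = e + e + 1 + k%:Z) //; ring.
exists (r - c); split.
  have -> : r - c - 1 = r - 1 - c by ring.
  by apply: val_geB => //; apply: val_geW hc; int_lia.
have -> : (r - c) ^+ 2 - a = c ^+ 2.
  by rewrite /c; field; rewrite two_neq0 r0.
apply: val_geW (val_geM hc hc); int_lia.
Qed.

(** Each term of a representing sequence gets its own approximate root. Keeping the roots within
    valuation e + 1 of 1 fixes their sign: a sum of two has valuation exactly e, so their
    differences are controlled by those of their squares. *)
Lemma completion_hensel q : val_ge v (v 2 + v 2 + 1) (q - 1) -> exists r, q = r ^+ 2.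
Proof.
have -> : v 2 = e.
  by rewrite -(rmorph_nat (completion_emb w)) -[v _]/(completion_val _) completion_emb_val.
move: q; apply: completion_quotW => s.
rewrite -(rmorph1 \pi_(completion w)) -rmorphB => /val_ge_completion[M h].
have /choice[r rP] : forall n : nat, exists r, (M <= n)%N -> val_ge w (e + 1) (r - 1) /\
    val_ge w (e + e + 1 + n%:Z) (r ^+ 2 - val s n).
  move=> n; have [Mn|_] := boolP (M <= n)%N; last by exists 0.
  by have [r hr] := newton_sqrt n (h n Mn); exists r.
have cr : is_cauchy w r.
  move=> N; have /asboolP/(_ (N + e))[M' h'] := valP s.
  exists (maxn M (maxn M' (absz N))) => m n; rewrite !geq_max.
  move=> /and3P[m1 m2 m3] /and3P[n1 n2 n3].
  have [rm1 rm2] := rP m m1; have [rn1 rn2] := rP n n1.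
  have [sum0 vsum] : r m + r n != 0 /\ w (r m + r n) = e.
    have -> : r m + r n = 2 + ((r m - 1) + (r n - 1)) by ring.
    by apply: place_val_addl => //; exact: val_geD.
  have -> : r m - r n = (r m ^+ 2 - r n ^+ 2) / (r m + r n) by field.
  apply: val_ge_div => //; rewrite vsum.
  have -> : r m ^+ 2 - r n ^+ 2 =
      r m ^+ 2 - val s m + (val s m - val s n) - (r n ^+ 2 - val s n) by ring.
  apply: val_geB; last by apply: val_geW rn2; lia.
  by apply: val_geD; [apply: val_geW rm2; lia | exact: h'].
have cr' : r \in cauchy_pred w by exact/asboolP.
exists (\pi_(completion w) (exist _ r cr' : cauchy_seq w)).
rewrite -rmorphXn; apply/pi_completion_eq => N.
exists (maxn M (absz N)) => n; rewrite geq_max => /andP[n1 n2].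
have [_ rn2] := rP n n1.
rewrite val_ge_sub /= in rn2 *; apply: val_geW rn2; lia.
Qed.

Lemma completion_two_neq0 : 2 != 0 :> completion w.
Proof. by rewrite -(rmorph_nat (completion_emb w)) fmorph_eq0. Qed.

Hypothesis finres : finite_residue w.

Lemma local_functionalD (b : sqclass (completion w)) (u u' : sqclass K) :
  local_functional b (u + u') = local_functional b u + local_functional b u'.
Proof.
elim/quotW: b => b; elim/quotW: u => x; elim/quotW: u' => y.
have -> : \pi_(sqclass K) x + \pi_(sqclass K) y = \pi_(sqclass K) (nonzeroM x y).
  exact: pi_nonzeroM.
rewrite /local_functional !sqclass_map_pi !hilbert_symbol_pi.
have two := completion_two_neq0.
have P (z : completion w) : is_sqrt_norm z (sval b) <-> is_norm (sval b) z.
  exact: is_sqrt_normP two (valP b).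
have emb0 (z : nonzero K) : completion_emb w (sval z) != 0.
  by rewrite fmorph_eq0 (valP z).
have h b0 a0 a'0 := local_norm_index2 two (finite_residue_completion finres)
  completion_hensel (b := sval b) (a := completion_emb w (sval x))
  (a' := completion_emb w (sval y)) b0 a0 a'0.
rewrite /= rmorphM /=.
move: (h (valP b) (emb0 x) (emb0 y)) => {}h.
case: (asboolP (is_sqrt_norm (_ * _) _)) => [/P Nxy|/P Nxy];
case: (asboolP (is_sqrt_norm (completion_emb w (sval x)) _)) => [/P Nx|/P Nx];
case: (asboolP (is_sqrt_norm (completion_emb w (sval y)) _)) => [/P Ny|/P Ny];
rewrite ?eqxx /=; try by apply: val_inj.
- by case: Ny; apply: (is_norm_mulr (emb0 x) Nx); rewrite mulrC.
- by case: Nx; exact: (is_norm_mulr (emb0 y) Ny).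
- by case: Nxy; exact: is_normM.
- by case: Nxy; exact: h.
Qed.

End CompletionPlace.

(** * Units whose residue is not a square *)

Section NonsquareResidue.

(** The valuation of b z ^ 2 is odd; if z were not integral, this term would dominate u and force x
    ^ 2 to have odd valuation. *)
Lemma unit_norm_residue (F : fieldType) (v : finite_place F) (b u x z : F) :
  b != 0 -> v b = 1 -> u != 0 -> v u = 0 -> u = x ^+ 2 - b * z ^+ 2 ->
  val_ge v 0 x /\ val_ge v 1 (u - x ^+ 2).
Proof.
move=> b0 vb u0 vu uE.
have z_ge : val_ge v 0 z.
  have [->|z0] := eqVneq z 0; first exact: val_ge0.
  rewrite val_geE // leNgt; apply/negP => vz.
  have z20 : z ^+ 2 != 0 by rewrite expf_neq0.
  have bz0 : b * z ^+ 2 != 0 by rewrite mulf_neq0.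
  have vbz : v (b * z ^+ 2) = 1 + v z *+ 2 by rewrite place_valM // place_valX // vb.
  have x2E : x ^+ 2 = b * z ^+ 2 + u by rewrite uE; ring.
  have hu : val_ge v (v (b * z ^+ 2) + 1) u.
    by rewrite val_geE // vu vbz; exact: int_double_lt.
  have [x20 vx2] := place_val_addl bz0 hu; rewrite -x2E in x20 vx2.
  have x0 : x != 0 by move: x20; rewrite expf_eq0.
  by move: vx2; rewrite vbz place_valX //; exact: int_parity.
have h : val_ge v 1 (u - x ^+ 2).
  rewrite uE addrAC subrr add0r val_geN -[1]addr0 val_geM //.
    by rewrite -vb val_ge_refl.
  by rewrite expr2 -[0]addr0 val_geM.
have lt : v u < 1 by rewrite vu.
have [x20] := place_val_close u0 lt h; rewrite vu.
have x0 : x != 0 by move: x20; rewrite expf_eq0.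
by rewrite place_valX // => v2; split=> //; rewrite val_geE //; exact: int_double_eq0.
Qed.

Variables (K : fieldType) (w : finite_place K) (varpi : K).
Hypotheses (two_neq0 : 2 != 0 :> K) (varpi0 : varpi != 0) (w_varpi : w varpi = 1).

Local Notation v := (completion_place w).
Local Notation emb := (completion_emb w).

Let v_emb x : x != 0 -> v (emb x) = w x.
Proof. exact: completion_emb_val. Qed.

(** By density, the root of u in the residue field of the completion is represented by an element of
    K. *)
Lemma nonsquare_residue_not_norm u : u != 0 -> w u = 0 ->
  (forall x, ~ val_ge w 1 (u - x ^+ 2)) -> ~ is_norm (emb varpi) (emb u).
Proof.
move=> u0 wu nsq [x [z uE]].
have embu0 : emb u != 0 by rewrite fmorph_eq0.
have embp0 : emb varpi != 0 by rewrite fmorph_eq0.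
have vp : v (emb varpi) = 1 by rewrite v_emb.
have vu : v (emb u) = 0 by rewrite v_emb.
have [x_ge h] := unit_norm_residue embp0 vp embu0 vu uE.
have [x0 hx0] := completion_dense x 1.
apply: (nsq x0); rewrite -val_ge_emb rmorphB rmorphXn.
have -> : emb u - emb x0 ^+ 2 = (emb u - x ^+ 2) + (x + emb x0) * (x - emb x0) by ring.
apply: val_geD => //; apply: val_ge1M => //; apply: val_geD => //.
by rewrite -[emb x0](subKr x) val_geB // val_ge01.
Qed.

Lemma nonsquare_residue_functional (y : nonzero K) : w (val y) = 0 ->
  (forall x, ~ val_ge w 1 (val y - x ^+ 2)) ->
  exists b : sqclass (completion w), local_functional b (\pi_(sqclass K) y) = 1.
Proof.
move=> wy nsq; have embp0 : emb varpi != 0 by rewrite fmorph_eq0.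
exists (\pi_(sqclass (completion w)) (Nonzero embp0)).
rewrite /local_functional sqclass_map_pi hilbert_symbol_pi /=.
case: asboolP => // /(is_sqrt_normP _ (completion_two_neq0 w two_neq0) embp0) N.
by case: (nonsquare_residue_not_norm (valP y) wy nsq).
Qed.

End NonsquareResidue.

Lemma coprime_bezout_nat (m n : nat) : (0 < m)%N -> coprime m n ->
  exists a b : nat, (a * m = b * n + 1)%N.
Proof. by move=> m0 /(coprimeP _ m0)[[a b] /= ab]; exists a, b; lia. Qed.

(** * Finiteness of the residue fields of a number field *)

Section NumberFieldPlace.
Variables (K : fieldExtType rat) (w : finite_place K).
Implicit Types (x y : K) (s : seq K).

Local Notation O := (val_ge w 0).

Lemma ratA_natr n : (n%:R)%:A = n%:R :> K.
Proof. by rewrite -[_%:A]/(in_alg K _) rmorph_nat. Qed.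

Lemma number_field_natr_eq0 n : (n%:R == 0 :> K) = (n == 0%N).
Proof. by rewrite -ratA_natr -[_%:A]/(in_alg K _) fmorph_eq0 pnatr_eq0. Qed.

Lemma rational_dependence s : (\dim {:K} < size s)%N ->
  exists c : nat -> rat, \sum_(i < size s) (c i)%:A * s`_i = 0 /\
    exists2 i, (i < size s)%N & c i != 0.
Proof.
move=> ds; have nf : ~~ free (in_tuple s).
  apply: contraTN ds; rewrite /free => /eqP <-; rewrite -leqNgt.
  by apply: dimvS; exact: subvf.
have /existsNP[k /not_implyP[ks /existsNP[i ki]]] :
    ~ forall k, \sum_(i < size s) k i *: s`_i = 0 -> (forall i, k i = 0).
  by move=> h; case/negP: nf; apply/freeP.
exists (fun j => odflt 0 (omap k (insub j))); split.
  by rewrite -[RHS]ks; apply: eq_bigr => j _; rewrite valK /= mulr_algl.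
by exists i => //; rewrite valK /=; exact/eqP.
Qed.

(** Otherwise the valuation would be trivial on the rationals, and the powers of an element of
    valuation 1 would be linearly independent: the terms of a relation have distinct valuations. *)
Lemma exists_residue_char : exists2 p, prime p & val_ge w 1 p%:R.
Proof.
apply: contrapT => np.
have w_nat n : n != 0%N -> w n%:R = 0.
  elim/ltn_ind: n => n IH n0.
  have nK : n%:R != 0 :> K by rewrite number_field_natr_eq0.
  have [n1|n_gt1] := leqP n 1; first by rewrite (_ : n = 1)%N ?place_val1 //; lia.
  have pr := pdiv_prime n_gt1; set p := pdiv n in pr.
  have pK : p%:R != 0 :> K by rewrite number_field_natr_eq0 -lt0n prime_gt0.
  have wp : w p%:R = 0.
    have := val_ge_natr w p; rewrite val_geE // => p0; apply/eqP; rewrite eq_le p0 andbT.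
    rewrite leNgt; apply/negP => lt; apply: np; exists p => //.
    by rewrite val_geE // -gtz0_ge1.
  have nE := divnK (pdiv_dvd n); rewrite -/p in nE.
  have q0 : (n %/ p)%N != 0%N by apply: contraNneq n0 => q0; rewrite -nE q0.
  have qK : (n %/ p)%N%:R != 0 :> K by rewrite number_field_natr_eq0.
  rewrite -nE natrM place_valM // wp addr0 IH // ltn_Pdiv ?prime_gt1 //; lia.
have w_rat (c : rat) : c != 0 -> w c%:A = 0.
  move=> c0; rewrite -[_%:A]/(in_alg K c) -[c]divq_num_den rmorphM fmorphV !rmorph_int.
  have w_int z : z != 0 -> w z%:~R = 0.
    case: z => n n0; first by rewrite -[_%:~R]/(n%:R) w_nat.
    by rewrite NegzE rmorphN place_valN /= -[_%:~R]/(n.+1%:R) ?w_nat // number_field_natr_eq0.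
  have intK (z : int) : z != 0 -> z%:~R != 0 :> K.
    by move=> z0; rewrite -(rmorph_int (in_alg K)) fmorph_eq0 intr_eq0.
  by rewrite place_valMz ?intK ?numq_eq0 // !w_int ?numq_eq0 ?subrr.
have [x x0 wx] := place_val_surj w 1.
pose s := mkseq (fun i => x ^+ i) (\dim {:K}).+1.
have [c [cs [i0 i0s ci0]]] := @rational_dependence s ltac:(by rewrite size_mkseq).
(* The term of least index has strictly smallest valuation. *)
have exc : exists i, (i < size s)%N && (c i != 0) by exists i0; rewrite i0s.
case: (ex_minnP exc) => i /andP[si ci] imin.
have sE j : (j < size s)%N -> s`_j = x ^+ j.
  by rewrite size_mkseq => js; rewrite nth_mkseq.
have ciA : (c i)%:A != 0 :> K by rewrite scaler_eq0 oner_eq0 orbF.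
have term0 : (c i)%:A * s`_i != 0 by rewrite sE // mulf_neq0 ?expf_neq0.
pose S := \sum_(j < size s | j != Ordinal si) (c j)%:A * s`_j.
have sumE : (c i)%:A * s`_i + S = 0 by rewrite -[RHS]cs [RHS](bigD1 (Ordinal si)).
suff hS : val_ge w (w ((c i)%:A * s`_i) + 1) S.
  by have [] := place_val_addl term0 hS; rewrite sumE eqxx.
rewrite /S; elim/big_ind: _ => [|y z|j ji]; first exact: val_ge0.
  exact: val_geD.
have [cj|cj] := eqVneq (c j) 0; first by rewrite cj scale0r mul0r val_ge0.
have ij : (i < j)%N.
  rewrite ltn_neqAle imin ?ltn_ord ?cj // andbT.
  by apply: contraNneq ji => ij; apply/eqP/val_inj.
have cjA : (c j)%:A != 0 :> K by rewrite scaler_eq0 oner_eq0 orbF.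
rewrite !sE // val_geE ?mulf_neq0 ?expf_neq0 // !place_valM ?expf_neq0 //.
by rewrite !w_rat // !place_valX // wx !add0r -mulrSr ler_nat.
Qed.

Section ResidueChar.
Variable p : nat.
Hypotheses (pr : prime p) (p1 : val_ge w 1 p%:R).

Let val_ge1_dvd n : (p %| n)%N -> val_ge w 1 n%:R.
Proof. by move=> /dvdnP[m ->]; rewrite natrM val_ge1M ?val_ge_natr. Qed.

Lemma natr_residue n : val_ge w 1 n%:R -> (p %| n)%N.
Proof.
move=> n1; apply: contraT => pn; have : coprime p n by rewrite prime_coprime.
have n0 : (0 < n)%N by case: n pn {n1} => //; rewrite dvdn0.
rewrite coprime_sym => /(coprime_bezout_nat n0)[u [v uvE]].
have : val_ge w 1 ((u * n)%:R - (v * p)%:R).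
  by rewrite !natrM val_geB ?val_ge1M ?val_ge_natr.
by rewrite uvE natrD addrAC subrr add0r val_geE ?oner_neq0 // place_val1.
Qed.

Lemma rational_residue (c : rat) : O c%:A -> exists a : nat, val_ge w 1 (c%:A - a%:R).
Proof.
move=> Oc; have intA (z : int) : (z%:~R)%:A = z%:~R :> K.
  by rewrite -[_%:A]/(in_alg K _) rmorph_int.
set m := numq c; set n := absz (denq c).
have n0 : (n != 0)%N by rewrite absz_eq0 denq_neq0.
have nK : n%:R != 0 :> K by rewrite number_field_natr_eq0.
have cE : c%:A * n%:R = m%:~R :> K.
  have nE : n%:R = (denq c)%:~R :> rat by rewrite pmulrn gez0_abs ?denq_ge0.
  by rewrite -ratA_natr -intA nE /m numqE -!(in_algE K) rmorphM.
have nu : ~ val_ge w 1 n%:R.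
  move=> n1; have pn := natr_residue n1.
  have : val_ge w 1 (m%:~R : K) by rewrite -cE val_ge1M.
  have -> : val_ge w 1 (m%:~R : K) = val_ge w 1 (absz m)%:R.
    case: (intP m) => [|k|k] //.
    by rewrite mulrNz val_geN abszN.
  move=> /natr_residue pm; have := coprime_num_den c; rewrite -/m -/n.
  rewrite /coprime => /eqP g1; have := prime_gt1 pr.
  by have := dvdn_gcd p `|m|%N n; rewrite pm pn g1 dvdn1 => /eqP ->.
have cop : coprime n p.
  rewrite coprime_sym prime_coprime //; apply/negP => pn; apply: nu; exact: val_ge1_dvd.
have [u [v uv]] : exists u v : nat, (u * n)%N = (v * p + 1)%N.
  have n_gt0 : (0 < n)%N by rewrite lt0n.
  exact: coprime_bezout_nat.
pose k : nat := absz (m %% p)%Z.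
have mk : val_ge w 1 ((m%:~R : K) - k%:R).
  have p0 : (p%:Z != 0) by rewrite -lt0n prime_gt0.
  rewrite /k -[_%:R]/(_%:Z%:~R) gez0_abs ?modz_ge0 // -rmorphB /=.
  rewrite {1}(divz_eq m p) addrK rmorphM /= val_ge1M //.
  have [[i ->]|[i ->]] : (exists i : nat, (m %/ p)%Z = i) \/ exists i : nat, (m %/ p)%Z = - i%:Z.
    by case: (intP (m %/ p)%Z) => [|j|j]; [left; exists 0%N|left; exists j.+1|right; exists j.+1].
    exact: val_ge_natr.
  by rewrite rmorphN val_geN; exact: val_ge_natr.
exists (u * k)%N.
have Ou : O (u%:R : K) by exact: val_ge_natr.
have -> : (c%:A : K) - (u * k)%:R = u%:R * ((m%:~R : K) - k%:R) - (c%:A : K) * (v * p)%:R :> K.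
  have h : c%:A * (u%:R * n%:R) = c%:A * (v%:R * p%:R + 1) :> K.
    by rewrite -!natrM natr1 uv addn1.
  rewrite -cE; move: (c%:A : K) h => C h.
  have -> : u%:R * (C * n%:R - k%:R) = C * (u%:R * n%:R) - u%:R * k%:R by ring.
  by rewrite h; ring.
by apply: val_geB; apply: val_ge1M => //; apply: val_ge1_dvd; exact: dvdn_mull.
Qed.

(** Linear independence over F_p of the residue classes, with natural numbers as coefficients. *)
Definition residually_free s := {in s, forall x, O x} /\
  forall a : nat -> nat, val_ge w 1 (\sum_(i < size s) (a i)%:R * s`_i) ->
    forall i, (i < size s)%N -> (p %| a i)%N.

(** Dividing a rational relation by its coefficient of least valuation makes all coefficients
    integral and one of them 1; it then reduces to a nontrivial relation over F_p. *)
Lemma residually_free_size s : residually_free s -> (size s <= \dim {:K})%N.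
Proof.
move=> [Os fs]; rewrite leqNgt; apply/negP => /rational_dependence[c [cs [i0 i0s ci0]]].
pose v i := w (c i)%:A.
have cA i : c i != 0 -> (c i)%:A != 0 :> K by move=> ci; rewrite scaler_eq0 oner_eq0 orbF.
have [k [ks ck kmin]] : exists k, [/\ (k < size s)%N, c k != 0 &
    forall i, (i < size s)%N -> c i != 0 -> v k <= v i].
  pose i1 := Ordinal i0s.
  case: (@Order.TotalTheory.arg_minP _ _ _ i1 (fun i : 'I_(size s) => c i != 0) (fun i => v i) ci0) => i ci imin.
  by exists i; split=> // j js cj; exact: (imin (Ordinal js)).
have Or i : (i < size s)%N -> O (c i / c k)%:A.
  move=> si; have [->|ci] := eqVneq (c i) 0; first by rewrite mul0r scale0r val_ge0.
  rewrite -[_%:A]/(in_alg K _) rmorphM fmorphV /= val_ge_div ?cA //.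
  by rewrite add0r val_geE ?cA //; exact: kmin.
have /choice[a aP] : forall i, exists a : nat, (i < size s)%N -> val_ge w 1 ((c i / c k)%:A - a%:R).
  move=> i; have [si|_] := boolP (i < size s)%N; last by exists 0%N.
  by have [a ha] := rational_residue (Or i si); exists a.
have rs : \sum_(i < size s) (c i / c k)%:A * s`_i = 0.
  have := congr1 (fun z => ((c k)^-1)%:A * z) cs; rewrite mulr0 mulr_sumr => e; apply: etrans e.
  apply: eq_bigr => i _; rewrite [RHS]mulrA; congr (_ * _).
  by rewrite -!(in_algE K) rmorphM [RHS]mulrC.
have h : val_ge w 1 (\sum_(i < size s) (a i)%:R * s`_i).
  have -> : \sum_(i < size s) (a i)%:R * s`_i =
      - \sum_(i < size s) ((c i / c k)%:A - (a i)%:R) * s`_i.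
    under [in RHS]eq_bigr do rewrite mulrBl.
    by rewrite sumrB rs sub0r opprK.
  rewrite val_geN; elim/big_ind: _ => [|y z|i _]; [exact: val_ge0|exact: val_geD|].
  by rewrite mulrC val_ge1M ?aP // Os // mem_nth.
have pk := fs a h k ks; have := aP k ks; rewrite divff // scale1r.
move=> h1; have : val_ge w 1 (1 - (a k)%:R + (a k)%:R) by rewrite val_geD ?val_ge1_dvd.
by rewrite subrK val_geE ?oner_neq0 // place_val1.
Qed.

(** A residually free family of maximal length spans the residue field, so its combinations with
    coefficients below p form a complete set of representatives. *)
Lemma number_field_finite_residue_char : finite_residue w.
Proof.
pose Q n := `[< exists2 s, residually_free s & size s = n >].
have exQ : exists n, Q n by exists 0%N; apply/asboolP; exists [::] => //; split.
have ubQ n : Q n -> (n <= \dim {:K})%N.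
  by move=> /asboolP[s /residually_free_size + <-].
case: (ex_maxnP exQ ubQ) => n /asboolP[s [Os fs] sn] nmax.
pose F (a : {ffun 'I_(size s) -> 'I_p}) : K := \sum_i (a i : nat)%:R * s`_i.
exists [seq F a | a : {ffun 'I_(size s) -> 'I_p}] => x Ox.
have nfree : ~ residually_free (x :: s).
  move=> fxs; have := nmax n.+1; rewrite ltnn => h; suff /h : Q n.+1 by [].
  by apply/asboolP; exists (x :: s) => //=; rewrite sn.
have [a [ha a_nd]] : exists a : nat -> nat,
    val_ge w 1 ((a 0)%:R * x + \sum_(i < size s) (a i.+1)%:R * s`_i) /\
    exists2 i, (i < (size s).+1)%N & ~~ (p %| a i)%N.
  apply: contrapT => nex; apply: nfree; split.
    by move=> y; rewrite inE => /orP[/eqP ->|/Os].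
  move=> a /=; rewrite big_ord_recl /= => ha i si; apply: contraT => pa.
  by case: nex; exists a; split=> //; exists i.
have pa0 : ~~ (p %| a 0)%N.
  apply/negP => pa0; have h : val_ge w 1 (\sum_(i < size s) (a i.+1)%:R * s`_i).
    rewrite -[X in val_ge _ _ X](addKr ((a 0)%:R * x)) val_geD // val_geN mulrC.
    by rewrite val_ge1M ?val_ge1_dvd.
  case: a_nd => -[|i] si; first by rewrite pa0.
  by rewrite (fs (fun i => a i.+1) h).
have [b bE] : exists b, (b * a 0 = 1 %[mod p])%N.
  have cop : coprime (a 0) p by rewrite coprime_sym prime_coprime.
  have a0 : (0 < a 0)%N by case: (a 0) pa0 => //; rewrite dvdn0.
  by have [u [v uv]] := coprime_bezout_nat a0 cop; exists u; rewrite uv modnMDl.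
have p0 := prime_gt0 pr.
have modp m : val_ge w 1 (m%:R - (m %% p)%:R).
  rewrite {1}(divn_eq m p) natrD addrK; apply: val_ge1_dvd; exact: dvdn_mull.
(* The relation solved for x: modulo p, [b] is the inverse of [a 0] and [p.-1] is -1. *)
pose r : {ffun 'I_(size s) -> 'I_p} :=
  [ffun i : 'I_(size s) => Ordinal (ltn_pmod (p.-1 * b * a i.+1) p0)].
exists (F r); first by apply/mapP; exists r; rewrite ?mem_enum.
have -> : x - F r = b%:R * ((a 0)%:R * x + \sum_(i < size s) (a i.+1)%:R * s`_i)
   - ((b * a 0)%:R - 1) * x
   - \sum_(i < size s) ((p * b * a i.+1)%:R - ((p.-1 * b * a i.+1)%:R - (r i : nat)%:R)) * s`_i.
  have -> : \sum_(i < size s) ((p * b * a i.+1)%:R - ((p.-1 * b * a i.+1)%:R - (r i : nat)%:R)) * s`_i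
     = b%:R * (\sum_(i < size s) (a i.+1)%:R * s`_i) + F r.
    rewrite /F mulr_sumr -big_split; apply: eq_bigr => i _ /=.
    by rewrite -{1}(prednK p0) -addn1 !natrM natrD; ring.
  by rewrite natrM; ring.
apply: val_geB; first apply: val_geB.
- by rewrite val_ge1M ?val_ge_natr.
- rewrite mulrC val_ge1M //.
  have -> : (b * a 0)%:R - 1 = ((b * a 0)%:R - (b * a 0 %% p)%:R) - (1%:R - (1 %% p)%:R) :> K.
    by rewrite bE; ring.
  by rewrite val_geB.
- elim/big_ind: _ => [|y z|i _]; [exact: val_ge0|exact: val_geD|].
  rewrite mulrC val_ge1M //; first by rewrite Os // mem_nth.
  apply: val_geB; first by apply: val_ge1_dvd; rewrite -mulnA dvdn_mulr.
  by rewrite ffunE.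
Qed.

End ResidueChar.

Lemma number_field_finite_residue : finite_residue w.
Proof.
have [p pr p1] := exists_residue_char; exact: number_field_finite_residue_char pr p1.
Qed.

End NumberFieldPlace.

(** * Ideals of a quadratic order *)

Section Divisibility.
Variables (K : fieldType) (R : subringClosed K).
Implicit Types (a b c m : K).

(** As b / 0 = 0 lies in R, zero divides everything here; nonzero divisors are therefore required
    explicitly. *)
Definition divides a b : bool := b / a \in R.

Lemma divides_refl a : a != 0 -> divides a a.
Proof. by move=> a0; rewrite /divides divff // rpred1. Qed.

Lemma dividesD a b c : divides a b -> divides a c -> divides a (b + c).
Proof. by rewrite /divides mulrDl; exact: rpredD. Qed.

Lemma dividesN a b : divides a (- b) = divides a b.
Proof. by rewrite /divides mulNr rpredN. Qed.

Lemma dividesB a b c : divides a b -> divides a c -> divides a (b - c).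
Proof. by move=> ab ac; rewrite dividesD ?dividesN. Qed.

Lemma divides_mulr a b c : c \in R -> divides a b -> divides a (b * c).
Proof. by move=> cR ab; rewrite /divides mulrAC rpredM. Qed.

Lemma divides_mull a b c : c \in R -> divides a b -> divides a (c * b).
Proof. by rewrite mulrC; exact: divides_mulr. Qed.

Lemma divides_trans b a c : b != 0 -> divides a b -> divides b c -> divides a c.
Proof.
rewrite /divides => b0 ab bc.
have -> : c / a = (c / b) * (b / a) by rewrite mulrA mulfVK.
exact: rpredM.
Qed.

Lemma divides_mulR a b : a != 0 -> b \in R -> divides a (a * b).
Proof. by move=> a0 bR; rewrite /divides mulrC mulKf. Qed.

End Divisibility.

(* [Lambda a b] is the ideal (a, sqrt u - s) (b, sqrt u + s) of R[sqrt u], an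
   element x + y sqrt u being the pair (x, y); s is a square root of u modulo m. *)
Section Lattice.
Variables (K : fieldType) (R : subringClosed K) (u s h k m : K).
Hypotheses (uR : u \in R) (sR : s \in R) (hR : h \in R) (kR : k \in R).
Hypotheses (mR : m \in R) (m0 : m != 0).
Hypothesis half_mod : divides R m (2 * h - 1).
Hypothesis inv_mod : divides R m (s * k - 1).
Hypothesis sqrt_mod : divides R m (s ^+ 2 - u).

Definition Lambda (a b : K) (z : K * K) : Prop :=
  [/\ z.1 \in R, z.2 \in R, divides R a (z.1 - s * z.2) & divides R b (z.1 + s * z.2)].

Definition pairM (z e : K * K) : K * K := (z.1 * e.1 + u * z.2 * e.2, z.2 * e.1 + z.1 * e.2).

Definition modulus (a b : K) : Prop :=
  [/\ a \in R, b \in R, a != 0, b != 0 & divides R (a * b) m].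

Section Pair.
Variables a b : K.
Hypothesis ab_mod : modulus a b.

Let aR : a \in R. Proof. by case: ab_mod. Qed.
Let bR : b \in R. Proof. by case: ab_mod. Qed.
Let a0 : a != 0. Proof. by case: ab_mod. Qed.
Let b0 : b != 0. Proof. by case: ab_mod. Qed.
Let ab0 : a * b != 0. Proof. by rewrite mulf_neq0. Qed.
Let abm : divides R (a * b) m. Proof. by case: ab_mod. Qed.

Lemma modulus_dvdl : divides R a m.
Proof. by apply: divides_trans ab0 _ abm; exact: divides_mulR. Qed.

Lemma modulus_dvdr : divides R b m.
Proof. by apply: divides_trans ab0 _ abm; rewrite mulrC; exact: divides_mulR. Qed.

Let dvd_sqrt c y : divides R c m -> y \in R -> divides R c ((s ^+ 2 - u) * y).
Proof. by move=> cm yR; apply: divides_mulr => //; exact: divides_trans m0 cm sqrt_mod. Qed.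

Lemma LambdaD z z' : Lambda a b z -> Lambda a b z' -> Lambda a b (z + z').
Proof.
move: z z' => [x y] [x' y'] [/= xR yR xya xyb] [/= x'R y'R xya' xyb'].
split=> /=; rewrite ?rpredD //.
  have -> : x + x' - s * (y + y') = x - s * y + (x' - s * y') by ring.
  exact: dividesD.
have -> : x + x' + s * (y + y') = x + s * y + (x' + s * y') by ring.
exact: dividesD.
Qed.

Lemma LambdaM z e : Lambda a b z -> e.1 \in R -> e.2 \in R -> Lambda a b (pairM z e).
Proof.
move: z e => [x y] [p q] [/= xR yR xya xyb] pR qR.
split=> /=; rewrite ?(rpredD, rpredM) //.
  have -> : x * p + u * y * q - s * (y * p + x * q) =
      (x - s * y) * (p - s * q) - (s ^+ 2 - u) * (y * q) by ring.
  apply: dividesB; first by apply: divides_mulr; rewrite ?(rpredB, rpredM).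
  by apply: dvd_sqrt; rewrite ?rpredM // modulus_dvdl.
have -> : x * p + u * y * q + s * (y * p + x * q) =
    (x + s * y) * (p + s * q) - (s ^+ 2 - u) * (y * q) by ring.
apply: dividesB; first by apply: divides_mulr; rewrite ?(rpredD, rpredM).
by apply: dvd_sqrt; rewrite ?rpredM // modulus_dvdr.
Qed.

Lemma Lambda_opp z : Lambda a b z -> Lambda a b (- z).
Proof.
move: z => [x y] [/= xR yR xya xyb]; split=> /=; rewrite ?rpredN //.
  by rewrite mulrN -opprD dividesN.
by rewrite mulrN -opprD dividesN.
Qed.

Let cancel_two c : c \in R -> divides R (a * b) (2 * c) -> divides R (a * b) c.
Proof.
move=> cR h2; rewrite (_ : c = (2 * c) * h - (2 * h - 1) * c); last by ring.
apply: dividesB; first exact: divides_mulr.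
by apply: divides_mulr => //; exact: divides_trans m0 abm half_mod.
Qed.

Let cancel_sqrt c : c \in R -> divides R (a * b) (s * c) -> divides R (a * b) c.
Proof.
move=> cR h2; rewrite (_ : c = (s * c) * k - (s * k - 1) * c); last by ring.
apply: dividesB; first exact: divides_mulr.
by apply: divides_mulr => //; exact: divides_trans m0 abm inv_mod.
Qed.

(** These are the coordinates of z times the conjugate of z', which lies in the ideal generated by a
    b. The congruences give this up to factors 2 and s, both invertible modulo m. *)
Lemma Lambda_det z z' : Lambda a b z -> Lambda a b z' ->
  divides R (a * b) (z.1 * z'.1 - u * z.2 * z'.2) /\
  divides R (a * b) (z'.1 * z.2 - z.1 * z'.2).
Proof.
move: z z' => [x y] [x' y'] [/= xR yR xya xyb] [/= x'R y'R xya' xyb'].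
have prod p q : divides R a p -> divides R b q -> divides R (a * b) (p * q).
  by move=> ap bq; rewrite /divides invfM mulrACA rpredM.
split.
  have -> : x * x' - u * y * y' = x * x' - s ^+ 2 * y * y' + (s ^+ 2 - u) * (y * y') by ring.
  apply: dividesD; last by apply: dvd_sqrt; rewrite ?rpredM.
  apply: cancel_two; first by rewrite !(rpredB, rpredM, rpredX).
  have -> : 2 * (x * x' - s ^+ 2 * y * y') =
     (x - s * y) * (x' + s * y') + (x' - s * y') * (x + s * y) by ring.
  by apply: dividesD; exact: prod.
apply: cancel_two; first by rewrite !(rpredB, rpredM).
apply: cancel_sqrt; first by rewrite rpredM ?rpred_nat // !(rpredB, rpredM).
have -> : s * (2 * (x' * y - x * y')) =
   (x' - s * y') * (x + s * y) - (x - s * y) * (x' + s * y') by ring.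
by apply: dividesB; exact: prod.
Qed.

(** Here a b j is the relative norm of z' and a b q is z times its conjugate. So z' and j determine
    the ideal once it is known which q modulo j occur. *)
Lemma Lambda_reconstruct z z' : Lambda a b z -> Lambda a b z' ->
  z'.1 ^+ 2 - u * z'.2 ^+ 2 != 0 ->
  let j := (z'.1 ^+ 2 - u * z'.2 ^+ 2) / (a * b) in
  exists q : K * K, [/\ q.1 \in R, q.2 \in R &
    z = pairM z' (q.1 / j, q.2 / j)].
Proof.
move=> Lz Lz' n0 j; have [d1 d2] := Lambda_det Lz Lz'.
exists ((z.1 * z'.1 - u * z.2 * z'.2) / (a * b), (z'.1 * z.2 - z.1 * z'.2) / (a * b)).
split=> //; rewrite /j /pairM; case: z z' {Lz Lz' d1 d2 j} n0 => [x y] [x' y'] /= n0.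
by congr (_, _); field; rewrite n0 a0 b0.
Qed.

End Pair.

(** Modulo m, h (1 - k sqrt u) is idempotent: the map x - s y sends it to 1 and x + s y sends it to
    0. Its multiple by a thus lies in the first ideal, and membership in the second gives a' | a.
    The conjugate idempotent handles b. *)
Lemma Lambda_sub_divides a b a' b' : modulus a b -> modulus a' b' ->
  (forall z, Lambda a b z -> Lambda a' b' z) -> divides R a' a /\ divides R b' b.
Proof.
move=> ab ab' sub; have [aR bR a0 b0 _] := ab.
have [a'R b'R a'0 b'0 _] := ab'.
have am := modulus_dvdl ab; have bm := modulus_dvdr ab.
have a'm := modulus_dvdl ab'; have b'm := modulus_dvdr ab'.
have plus c x : c \in R -> divides R c m -> x \in R ->
    divides R c (h * x * (1 + s * k) - x) /\ divides R c (h * x * (1 - s * k)).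
  move=> cR cm xR.
  have -> : h * x * (1 + s * k) - x = (2 * h - 1) * x + (s * k - 1) * (h * x) by ring.
  have -> : h * x * (1 - s * k) = - ((s * k - 1) * (h * x)) by ring.
  have d1 : divides R c ((2 * h - 1) * x).
    by apply: divides_mulr => //; exact: divides_trans m0 cm half_mod.
  have d2 : divides R c ((s * k - 1) * (h * x)).
    by apply: divides_mulr; [exact: rpredM | exact: divides_trans m0 cm inv_mod].
  by rewrite dividesN dividesD.
split.
  have [|_ _ /= d _] := sub (h * a, - (h * k * a)).
    have [_ e2] := plus b a bR bm aR; split=> /=; rewrite ?rpredN ?rpredM //.
      have -> : h * a - s * - (h * k * a) = a * (h * (1 + s * k)) by ring.
      by apply: divides_mulR => //; rewrite !(rpredM, rpredD, rpred1).
    by have -> : h * a + s * - (h * k * a) = h * a * (1 - s * k) by ring.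
  have [e1 _] := plus a' a a'R a'm aR.
  rewrite (_ : a = h * a - s * - (h * k * a) - (h * a * (1 + s * k) - a)); last by ring.
  exact: dividesB.
have [|_ _ /= _ d] := sub (h * b, h * k * b).
  have [_ e2] := plus a b aR am bR; split=> /=; rewrite ?rpredM //.
    by have -> : h * b - s * (h * k * b) = h * b * (1 - s * k) by ring.
  have -> : h * b + s * (h * k * b) = b * (h * (1 + s * k)) by ring.
  by apply: divides_mulR => //; rewrite !(rpredM, rpredD, rpred1).
have [e1 _] := plus b' b b'R b'm bR.
rewrite (_ : b = h * b + s * (h * k * b) - (h * b * (1 + s * k) - b)); last by ring.
exact: dividesB.
Qed.

End Lattice.

Lemma shell_spacing_nat (c n T : nat) : (0 < c)%N -> (0 < n * T)%N ->
  (n * (2 * (c * T)) * (2 * c) < n * (4 * c * c + 4 * c) * T)%N.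
Proof.
move=> c0 nT; have -> : (n * (4 * c * c + 4 * c) * T =
  n * (2 * (c * T)) * (2 * c) + 4 * (c * (n * T)))%N by nia.
by rewrite -addn1 leq_add2l muln_gt0 /= muln_gt0 c0.
Qed.

Lemma scale_ratio_nat (c y : nat) : (0 < y)%N -> (2 * c * y * (2 * c) < (2 * c + 1) ^ 2 * y)%N.
Proof.
move=> y0; have -> : ((2 * c + 1) ^ 2 * y = 2 * c * y * (2 * c) + (4 * c * y + y))%N.
  by rewrite expnS expn1; nia.
lia.
Qed.

Lemma shell_width_nat (c n T : nat) : (0 < n * T)%N ->
  (2 * (c + n * (c * T)) <= n * (4 * c * c + 4 * c) * T)%N.
Proof.
move=> nT; have -> : (n * (4 * c * c + 4 * c) * T =
  2 * (n * T * c) + 2 * (n * T * c) + 4 * (c * c * (n * T)))%N by nia.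
have : (c * 1 <= c * (n * T))%N by rewrite leq_mul2l nT orbT.
have -> : (2 * (c + n * (c * T)) = 2 * c + 2 * (n * T * c))%N by nia.
lia.
Qed.

(** * Counting ideals, with an abstract norm on an order of rank d *)

Section Counting.
Variables (K : fieldType) (R : subringClosed K) (d : nat) (nrm : K -> rat) (c : nat).
Variable box : ('I_d -> nat) -> K.
Hypothesis nrmD : forall x y, nrm (x + y) <= nrm x + nrm y.
Hypothesis nrmM : forall x y, nrm (x * y) <= nrm x * nrm y.
Hypothesis nrmN : forall x, nrm (- x) = nrm x.
Hypothesis nrm_ge0 : forall x, 0 <= nrm x.
Hypothesis nrm_natl : forall n x, nrm (n%:R * x) = n%:R * nrm x.
Hypothesis nrm_ge1 : forall x, x \in R -> x != 0 -> 1 <= nrm x.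
Hypothesis c_gt0 : (0 < c)%N.
Hypothesis nrm1_le : nrm 1 <= c%:R.
Hypothesis round : forall x, exists2 r, r \in R & nrm (x - r) <= c%:R.
Hypothesis boxR : forall a, box a \in R.
Hypothesis box_nrm : forall a N, (forall k, (a k <= N)%N) -> nrm (box a) <= c%:R * N%:R.
Hypothesis box_inj : forall a b, box a = box b -> forall k, a k = b k.
Hypothesis enc : forall N : nat, exists e : K -> {ffun 'I_d -> 'I_(c * N.+1)},
  forall x y, x \in R -> y \in R -> nrm x <= N%:R -> nrm y <= N%:R -> e x = e y -> x = y.
Hypothesis d_gt0 : (0 < d)%N.

Let nrm0 : nrm 0 = 0.
Proof. by have := nrm_natl 0 0; rewrite !mul0r. Qed.

Let natK_neq0 n : (0 < n)%N -> n%:R != 0 :> K.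
Proof.
move=> n0; apply/eqP => nK; have := nrm_natl n 1; rewrite nK mul0r nrm0 => /esym/eqP.
rewrite mulf_eq0 pnatr_eq0 -leqn0 leqNgt n0 /= => /eqP n1.
by have := nrm_ge1 (rpred1 R) (oner_neq0 K); rewrite n1 ler10.
Qed.

Let small_eq0 x : x \in R -> nrm x < 1 -> x = 0.
Proof. by move=> xR x1; apply: contraTeq x1 => x0; rewrite -leNgt nrm_ge1. Qed.

Let nrm_sub x y : nrm (x - y) <= nrm x + nrm y.
Proof. by rewrite -(nrmN y) nrmD. Qed.

Variables (u D2 U : K) (D0 nu : nat).
Hypotheses (uR : u \in R) (D2R : D2 \in R) (UR : U \in R).
Hypotheses (D0_gt0 : (0 < D0)%N) (D0_two : D0%:R = 2 * D2) (D0_u : D0%:R = u * U).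
Hypothesis nu_ge : nrm u <= nu%:R.
Hypothesis u_nsq : forall y, y ^+ 2 != u.
Hypothesis all_sqrt : forall M, M \in R -> M != 0 -> divides R D0%:R (M - 1) ->
  exists2 s, s \in R & divides R M (s ^+ 2 - u).

(** Q keeps the deviation of a shell element from [Y i] below half of [Y i], and keeps quotients
    within one shell at distance less than 1 from 1. As t exceeds (2 c) ^ 2, quotients from a lower
    to a higher shell have norm below 1; t is a square so that t ^ J has the integral root tau ^
    J. *)
Let Q := (4 * c * c + 4 * c)%N.
Let tau := (2 * c + 1)%N.
Let t := (tau ^ 2)%N.
Let Y i := (D0 * Q * t ^ i)%N.

(* Elements of a shell around Y i, all congruent to 1 modulo D0: two of them that
   generate the same ideal are equal. *)
Definition shell (i : nat) (a : 'I_d -> nat) : K :=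
  1 + D0%:R * ((Q * t ^ i)%:R + box a).

Let t_gt0 : (0 < t)%N. Proof. by rewrite expn_gt0 /tau addn1. Qed.
Let Q_gt0 : (0 < Q)%N. Proof. by rewrite /Q; lia. Qed.
Let Y_gt0 i : (0 < Y i)%N.
Proof. by rewrite !muln_gt0 D0_gt0 Q_gt0 expn_gt0 t_gt0. Qed.
Let Yr_gt0 i : 0 < (Y i)%:R :> rat. Proof. by rewrite ltr0n. Qed.
Let c_ge1 : 1 <= c%:R :> rat. Proof. by rewrite ler1n. Qed.

Lemma shellR i a : shell i a \in R.
Proof. by rewrite rpredD ?rpred1 // rpredM ?rpredD ?rpred_nat. Qed.

Lemma shell_mod i a : divides R D0%:R (shell i a - 1).
Proof.
rewrite /shell addrAC subrr add0r; apply: divides_mulR; first exact: natK_neq0.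
by rewrite rpredD ?rpred_nat.
Qed.

Section ShellBounds.
Variables (i : nat) (a : 'I_d -> nat).
Hypothesis a_le : forall k, (a k <= t ^ i)%N.
Let xi := 1 + D0%:R * box a.

Let xi_small : 2 * nrm xi <= (Y i)%:R.
Proof.
have h1 : nrm xi <= c%:R + D0%:R * (c%:R * (t ^ i)%:R).
  apply: le_trans (nrmD _ _) _; rewrite lerD // nrm_natl ler_wpM2l ?ler0n //.
  exact: box_nrm.
have h2 : (2 * (c + D0 * (c * t ^ i)) <= Y i)%N.
  by apply: shell_width_nat; rewrite muln_gt0 D0_gt0 expn_gt0 t_gt0.
apply: le_trans (_ : (2 * (c + D0 * (c * t ^ i)))%:R <= _); last by rewrite ler_nat.
by rewrite natrM natrD !natrM ler_wpM2l.
Qed.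

Let shellE : shell i a = (Y i)%:R * 1 + xi.
Proof. by rewrite /shell /xi /Y !natrM; ring. Qed.

Lemma shell_neq0 : shell i a != 0.
Proof.
apply/eqP => s0; have xiE : xi = - ((Y i)%:R * 1) by apply/eqP; rewrite -addr_eq0 addrC -shellE s0.
have := xi_small; rewrite xiE nrmN nrm_natl => h.
have := nrm_ge1 (rpred1 R) (oner_neq0 K) => h1.
have h2 : (Y i)%:R * 1 <= (Y i)%:R * nrm 1 by rewrite ler_wpM2l.
have := Yr_gt0 i; lra.
Qed.

Lemma shell_nrm : nrm (shell i a) <= 2 * c%:R * (Y i)%:R.
Proof.
rewrite shellE; apply: le_trans (nrmD _ _) _; rewrite nrm_natl.
have h : (Y i)%:R * nrm 1 <= (Y i)%:R * c%:R by rewrite ler_wpM2l.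
have h2 : (Y i)%:R * 1 <= (Y i)%:R * c%:R :> rat by rewrite ler_wpM2l.
have := xi_small; have := Yr_gt0 i; lra.
Qed.

(** With g the inverse, Y g = 1 - xi g; as xi has norm at most Y / 2, the last term is absorbed on
    the left. *)
Lemma shell_nrmV : nrm (shell i a)^-1 * (Y i)%:R <= 2 * c%:R.
Proof.
set g := (shell i a)^-1.
have e : (Y i)%:R * g = 1 - xi * g.
  have -> : (Y i)%:R * g = shell i a * g - xi * g by rewrite shellE; ring.
  by rewrite mulfV ?shell_neq0.
have h : (Y i)%:R * nrm g <= c%:R + nrm xi * nrm g.
  rewrite -nrm_natl e; apply: le_trans (nrm_sub _ _) _; exact: lerD.
have h2 : 2 * nrm xi * nrm g <= (Y i)%:R * nrm g by rewrite ler_wpM2r ?xi_small.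
have h3 : (2 * nrm xi) * nrm g = 2 * (nrm xi * nrm g) by rewrite mulrA.
rewrite [nrm g * _]mulrC; lra.
Qed.

Lemma shell_nrm_code : nrm (shell i a) * c%:R <= (2 * c * c * Y i)%:R.
Proof.
have -> : (2 * c * c * Y i)%:R = 2 * c%:R * (Y i)%:R * c%:R :> rat by rewrite !natrM; ring.
by rewrite ler_wpM2r ?shell_nrm // ler0n.
Qed.

End ShellBounds.

(** A nonzero element of R has norm at least 1. Within one shell the quotient minus 1 is smaller, so
    it vanishes; from a lower to a higher shell the quotient itself is smaller, which is
    impossible. *)
Lemma shell_inj i i' a a' : (forall k, (a k <= t ^ i)%N) -> (forall k, (a' k <= t ^ i')%N) ->
  divides R (shell i a) (shell i' a') -> divides R (shell i' a') (shell i a) ->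
  i = i' /\ forall k, a k = a' k.
Proof.
wlog le_ii : i i' a a' / (i <= i')%N.
  move=> wl ha ha' d1 d2; have [l|/ltnW l] := leqP i i'; first exact: wl.
  by have [-> h] := wl _ _ _ _ l ha' ha d2 d1; split=> // k; rewrite h.
move=> ha ha' d1 d2; have s0 := shell_neq0 ha; have s0' := shell_neq0 ha'.
have gY := shell_nrmV ha'; set g := nrm (shell i' a')^-1 in gY.
have g0 : 0 <= g by exact: nrm_ge0.
have [eii|ne] := eqVneq i i'.
  subst i'; split=> //; apply: box_inj; apply/eqP; rewrite -subr_eq0.
  have : (shell i a - shell i a') / shell i a' = 0.
    apply: small_eq0.
      by rewrite mulrBl divff // rpredB ?rpred1.
    apply: le_lt_trans (nrmM _ _) _; rewrite -/g.
    have h : nrm (shell i a - shell i a') <= D0%:R * (2 * (c%:R * (t ^ i)%:R)).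
      have -> : shell i a - shell i a' = D0%:R * (box a - box a') by rewrite /shell; ring.
      rewrite nrm_natl ler_wpM2l ?ler0n // mulr_natl mulr2n.
      by apply: le_trans (nrm_sub _ _) _; rewrite lerD ?box_nrm.
    have h1 : nrm (shell i a - shell i a') * g * (Y i)%:R <=
        D0%:R * (2 * (c%:R * (t ^ i)%:R)) * (2 * c%:R).
      by rewrite -mulrA ler_pM // mulr_ge0.
    rewrite -(ltr_pM2r (Yr_gt0 i)) mul1r; apply: le_lt_trans h1 _.
    rewrite -!natrM ltr_nat /Y /Q.
    by apply: shell_spacing_nat => //; rewrite muln_gt0 D0_gt0 expn_gt0 t_gt0.
  move/eqP; rewrite mulf_eq0 invr_eq0 (negPf s0') orbF /shell.
  have -> : 1 + D0%:R * ((Q * t ^ i)%:R + box a) - (1 + D0%:R * ((Q * t ^ i)%:R + box a')) =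
     D0%:R * (box a - box a') by ring.
  by rewrite mulf_eq0 (negPf (natK_neq0 D0_gt0)).
have lt_ii : (i < i')%N by rewrite ltn_neqAle ne.
suff : shell i a / shell i' a' = 0.
  by move/eqP; rewrite mulf_eq0 invr_eq0 (negPf s0) (negPf s0').
apply: small_eq0 => //; apply: le_lt_trans (nrmM _ _) _; rewrite -/g.
have h1 : nrm (shell i a) * g * (Y i')%:R <= 2 * c%:R * (Y i)%:R * (2 * c%:R).
  by rewrite -mulrA ler_pM ?shell_nrm // mulr_ge0.
rewrite -(ltr_pM2r (Yr_gt0 i')) mul1r; apply: le_lt_trans h1 _.
rewrite -!natrM ltr_nat.
have tY : (t * Y i <= Y i')%N.
  rewrite /Y mulnCA leq_mul2l -expnS leq_pexp2l ?orbT //.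
apply: leq_trans tY; exact: scale_ratio_nat.
Qed.

(** Rounding [x / al] gives a representative of the class of x of norm at most B, which is then
    encoded. *)
Lemma residue_code al (B : nat) : al \in R -> al != 0 -> nrm al * c%:R <= B%:R ->
  exists f : K -> {ffun 'I_d -> 'I_(c * B.+1)},
    forall x y, x \in R -> y \in R -> f x = f y -> divides R al (x - y).
Proof.
move=> aR a0 aB; have [e eP] := enc B; have /choice[r rP] : forall x, exists r, r \in R /\ nrm (x - r) <= c%:R.
  by move=> x; have [r rR rx] := round x; exists r.
pose f x := x - al * r (x / al).
have fR x : x \in R -> f x \in R.
  by move=> xR; rewrite rpredB // rpredM //; have [] := rP (x / al).
have fB x : nrm (f x) <= B%:R.
  have -> : f x = al * (x / al - r (x / al)) by rewrite /f mulrBr mulrCA divff // mulr1.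
  apply: le_trans (nrmM _ _) _; apply: le_trans aB; rewrite ler_wpM2l //.
  by have [] := rP (x / al).
exists (fun x => e (f x)) => x y xR yR /(eP _ _ (fR x xR) (fR y yR) (fB x) (fB y)) fxy.
have -> : x - y = al * (r (x / al) - r (y / al)).
  have : f x - f y = 0 by rewrite fxy subrr.
  rewrite /f => h; apply/eqP; rewrite -subr_eq0 -h; apply/eqP; ring.
apply: divides_mulR => //; rewrite rpredB //.
  by have [] := rP (x / al).
by have [] := rP (y / al).
Qed.

(** Pigeonhole: there are more pairs of box points than pairs of residue classes modulo [al] and
    [be], so two pairs differ by an element of the ideal. *)
Lemma exists_short_vector al be s (B B' Z : nat) :
  al \in R -> al != 0 -> nrm al * c%:R <= B%:R ->
  be \in R -> be != 0 -> nrm be * c%:R <= B'%:R -> s \in R ->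
  ((c * B.+1) ^ d * (c * B'.+1) ^ d < Z ^ d * Z ^ d)%N ->
  exists z : K * K, [/\ Lambda R s al be z, z != 0, nrm z.1 <= (2 * c * Z)%:R &
    nrm z.2 <= (2 * c * Z)%:R].
Proof.
move=> aR a0 aB bR b0 bB sR lt.
have [f fP] := residue_code aR a0 aB; have [g gP] := residue_code bR b0 bB.
pose T := ({ffun 'I_d -> 'I_Z} * {ffun 'I_d -> 'I_Z})%type.
pose bx (p : {ffun 'I_d -> 'I_Z}) := box (fun k => p k : nat).
pose F (p : T) := (f (bx p.1 - s * bx p.2), g (bx p.1 + s * bx p.2)).
have [p [p' [Fp pp']]] : exists p p' : T, F p = F p' /\ p <> p'.
  apply: contrapT => np; have Finj : injective F.
    by move=> p p' e; apply: contrapT => ne; apply: np; exists p, p'.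
  have := leq_card F Finj; rewrite !card_prod !card_ffun !card_ord leqNgt.
  by rewrite lt.
have bxR q : bx q \in R by exact: boxR.
have bx_le q q' : nrm (bx q - bx q') <= (2 * c * Z)%:R.
  apply: le_trans (nrm_sub _ _) _; rewrite -mulnA natrM mulr_natl mulr2n natrM.
  by rewrite lerD // box_nrm // => k; exact: ltnW.
exists (bx p.1 - bx p'.1, bx p.2 - bx p'.2); split=> //=.
  case: Fp => [/fP h1 /gP h2]; split=> /=; rewrite ?rpredB //.
    rewrite (_ : _ - _ = bx p.1 - s * bx p.2 - (bx p'.1 - s * bx p'.2)); last by ring.
    by apply: h1; rewrite rpredB ?rpredM.
  rewrite (_ : _ + _ = bx p.1 + s * bx p.2 - (bx p'.1 + s * bx p'.2)); last by ring.
  by apply: h2; rewrite rpredD ?rpredM.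
apply/eqP => -[/eqP e1 /eqP e2]; apply: pp'; rewrite !subr_eq0 in e1 e2.
case: p p' e1 e2 {Fp} => [p1 p2] [p1' p2'] /= /eqP e1 /eqP e2.
congr (_, _); apply/ffunP => k; apply: val_inj => /=.
  exact: (box_inj e1 k).
exact: (box_inj e2 k).
Qed.

Section FixedScales.
Variable J : nat.

Local Notation index := ('I_J.+1 * {ffun 'I_d -> 'I_(t ^ J)})%type.
Implicit Type p : index.

(** Writing each coordinate below t ^ J as hi t ^ i + lo identifies the pairs of boxes at scale i
    with one box of (t ^ J) ^ d points, the same for every i. *)
Let lo p (k : 'I_d) : nat := (p.2 k %% t ^ p.1)%N.
Let hi p (k : 'I_d) : nat := (p.2 k %/ t ^ p.1)%N.
Let al p := shell p.1 (lo p).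
Let be p := shell (J - p.1) (hi p).

Let lo_le p k : (lo p k <= t ^ p.1)%N.
Proof. by rewrite ltnW // ltn_mod expn_gt0 t_gt0. Qed.

Let tJ p : (t ^ J = t ^ (J - p.1) * t ^ p.1)%N.
Proof. by rewrite -expnD subnK // -ltnS. Qed.

Let hi_le p k : (hi p k <= t ^ (J - p.1))%N.
Proof.
have lt := ltn_ord (p.2 k); rewrite [X in (_ < X)%N](tJ p) in lt.
by rewrite ltnW // ltn_divLR // expn_gt0 t_gt0.
Qed.

Let alR p : al p \in R. Proof. exact: shellR. Qed.
Let beR p : be p \in R. Proof. exact: shellR. Qed.
Let al0 p : al p != 0. Proof. exact: shell_neq0. Qed.
Let be0 p : be p != 0. Proof. exact: shell_neq0. Qed.

(** One common modulus, so that a single square root s serves all the ideals. *)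
Let m := \prod_(p : index) (al p * be p).

Let mR : m \in R.
Proof. by apply: rpred_prod => p _; rewrite rpredM. Qed.

Let m0 : m != 0.
Proof. by apply/prodf_neq0 => p _; rewrite mulf_neq0. Qed.

Let m_mod : divides R D0%:R (m - 1).
Proof.
have mulP x y : y \in R -> divides R D0%:R (x - 1) -> divides R D0%:R (y - 1) ->
    divides R D0%:R (x * y - 1).
  move=> yR hx hy; have -> : x * y - 1 = (x - 1) * y + (y - 1) by ring.
  by rewrite dividesD // divides_mulr.
suff [] : m \in R /\ divides R D0%:R (m - 1) by [].
rewrite /m; elim/big_ind: _ => [|x y [xR hx] [yR hy]|p _].
- by rewrite rpred1 subrr /divides mul0r rpred0.
- by rewrite rpredM //; split=> //; exact: mulP.
- by rewrite rpredM //; split=> //; apply: mulP; rewrite ?shell_mod.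
Qed.

Let al_be_modulus p : modulus R m (al p) (be p).
Proof.
split; rewrite ?alR ?beR ?al0 ?be0 // /m (bigD1 p) //=.
apply: divides_mulR; first by rewrite mulf_neq0.
by apply: rpred_prod => q _; rewrite rpredM.
Qed.

(** L t ^ i bounds the number of residue codes per coordinate at scale i, so a box of side Z > L tau
    ^ J is large enough. N1 bounds the short vector, N2 the quotient j of its relative norm, and N3
    residues modulo j. Only Z and N1 grow with J. *)
Let L := (4 * c * c * c * D0 * Q)%N.
Let Z := ((L + 1) * tau ^ J)%N.
Let N1 := (2 * c * Z)%N.
Let N2 := (16 * c * c * c * c * (L + 1) * (L + 1) * (1 + nu))%N.
Let N3 := (N2 * c)%N.

Let tauJ : (tau ^ J * tau ^ J = t ^ J)%N.
Proof. by rewrite -expnD addnn -mul2n expnM. Qed.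

Let short_vector_room p :
  ((c * (2 * c * c * Y p.1).+1) ^ d * (c * (2 * c * c * Y (J - p.1)).+1) ^ d < Z ^ d * Z ^ d)%N.
Proof.
have le i : (c * (2 * c * c * Y i).+1 <= L * t ^ i)%N.
  have : (0 < 2 * c * c * Y i)%N by rewrite !muln_gt0 c_gt0 D0_gt0 Q_gt0 expn_gt0 t_gt0.
  have -> : (L * t ^ i = c * (2 * (2 * c * c * Y i)))%N by rewrite /L /Y; ring.
  by rewrite leq_mul2l; lia.
rewrite -!expnMn; apply: leq_ltn_trans (_ : (L * t ^ p.1 * (L * t ^ (J - p.1))) ^ d < _)%N.
  by rewrite leq_exp2r // leq_mul.
rewrite ltn_exp2r // /Z mulnACA [(_ * t ^ (J - _))%N]mulnC -tJ.
rewrite [X in (_ < X)%N]mulnACA tauJ ltn_pmul2r; last by rewrite expn_gt0 t_gt0.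
by rewrite ltn_mul // addn1.
Qed.

Let modular_data : exists s h k,
  [/\ s \in R, h \in R, k \in R, divides R m (2 * h - 1) &
      divides R m (s * k - 1) /\ divides R m (s ^+ 2 - u)].
Proof.
have [s sR su] := all_sqrt mR m0 m_mod; set g := (m - 1) / D0%:R.
have gR : g \in R by exact: m_mod.
have mE : m = 1 + D0%:R * g by rewrite /g mulrCA divff ?natK_neq0 // mulr1 addrC subrK.
have dm : divides R m (- m) by rewrite dividesN divides_refl.
have gD : - (g * D2) \in R by rewrite rpredN rpredM.
have gU : - (g * U) \in R by rewrite rpredN rpredM.
(* Since m = 1 + D0 g, with D0 = 2 D2 = u U, the inverses of 2 and u modulo m are - g D2 and - g U;
   the inverse of s is s / u. *)
exists s, (- (g * D2)), (s * - (g * U)); split=> //; first exact: rpredM.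
  have -> : 2 * - (g * D2) - 1 = - m by rewrite mE D0_two; ring.
  exact: dm.
split=> //; have -> : s * (s * - (g * U)) - 1 = (s ^+ 2 - u) * - (g * U) - m.
  by rewrite mE D0_u; ring.
by apply: dividesD => //; exact: divides_mulr.
Qed.

(** The index is determined by the short vector, j and a subset of a set of residues. The two
    factors from the short vector grow like (t ^ J) ^ d together; the others do not depend on J. *)
Lemma counting_bound : (J.+1 * (t ^ J) ^ d <=
  (c * N1.+1) ^ d * (c * N1.+1) ^ d * (c * N2.+1) ^ d *
  2 ^ ((c * N3.+1) ^ d * (c * N3.+1) ^ d))%N.
Proof.
have [s [h [k [sR hR kR half_mod [inv_mod sqrt_mod]]]]] := modular_data.
have /choice[z zP] : forall p, exists z : K * K, [/\ Lambda R s (al p) (be p) z, z != 0,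
    nrm z.1 <= N1%:R & nrm z.2 <= N1%:R].
  move=> p; apply: exists_short_vector (short_vector_room p) => //.
    exact: shell_nrm_code.
  exact: shell_nrm_code.
have n0 p : (z p).1 ^+ 2 - u * (z p).2 ^+ 2 != 0.
  have [_ zp0 _ _] := zP p; case: (z p) zp0 => [x y] /= xy0.
  have [y0|y0] := eqVneq y 0.
    rewrite y0 expr0n mulr0 subr0 expf_eq0 /=; apply: contraNneq xy0 => ->.
    by rewrite y0.
  rewrite subr_eq0; apply: contraNneq (u_nsq (x / y)) => e.
  by rewrite exprMn exprVn e mulfK // expf_neq0.
pose j p := ((z p).1 ^+ 2 - u * (z p).2 ^+ 2) / (al p * be p).
have j0 p : j p != 0 by rewrite mulf_neq0 ?invr_eq0 ?mulf_neq0.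
have jR p : j p \in R.
  have [Lz _ _ _] := zP p.
  have [] := Lambda_det sR hR kR m0 half_mod inv_mod sqrt_mod (al_be_modulus p) Lz Lz.
  by rewrite -expr2 -mulrA -expr2.
have jN p : nrm (j p) <= N2%:R.
  have [_ _ nx ny] := zP p.
  have num : nrm ((z p).1 ^+ 2 - u * (z p).2 ^+ 2) <= (1 + nu%:R) * (N1%:R * N1%:R).
    apply: le_trans (nrm_sub _ _) _; rewrite mulrDl mul1r lerD //.
      by apply: le_trans (nrmM _ _) _; rewrite ler_pM.
    apply: le_trans (nrmM _ _) _; rewrite ler_pM //.
    by apply: le_trans (nrmM _ _) _; rewrite ler_pM.
  have den : nrm (al p)^-1 * (Y p.1)%:R * (nrm (be p)^-1 * (Y (J - p.1))%:R) <=
      2 * c%:R * (2 * c%:R).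
    by rewrite ler_pM ?mulr_ge0 ?ler0n // shell_nrmV.
  have jle : nrm (j p) <= (1 + nu%:R) * (N1%:R * N1%:R) * (nrm (al p)^-1 * nrm (be p)^-1).
    rewrite /j invfM; apply: le_trans (nrmM _ _) _; rewrite ler_pM //.
  have YY : (t ^ J <= Y p.1 * Y (J - p.1))%N.
    rewrite /Y mulnACA [(t ^ p.1 * _)%N]mulnC -tJ leq_pmull // !muln_gt0.
    by rewrite D0_gt0 Q_gt0.
  have tJ0 : 0 < (t ^ J)%:R :> rat by rewrite ltr0n expn_gt0 t_gt0.
  rewrite -(ler_pM2r tJ0).
  apply: le_trans (_ : nrm (j p) * (Y p.1 * Y (J - p.1))%:R <= _).
    by rewrite ler_wpM2l // ler_nat.
  have YY0 : 0 <= (Y p.1 * Y (J - p.1))%:R :> rat by rewrite ler0n.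
  apply: le_trans (ler_wpM2r YY0 jle) _.
  have -> : (1 + nu%:R) * (N1%:R * N1%:R) * (nrm (al p)^-1 * nrm (be p)^-1) *
       (Y p.1 * Y (J - p.1))%:R = (1 + nu%:R) * (N1%:R * N1%:R) *
      (nrm (al p)^-1 * (Y p.1)%:R * (nrm (be p)^-1 * (Y (J - p.1))%:R)) :> rat.
    by rewrite natrM; ring.
  have -> : N2%:R * (t ^ J)%:R = (1 + nu%:R) * (N1%:R * N1%:R) * (2 * c%:R * (2 * c%:R)) :> rat.
    by rewrite -tauJ /N2 /N1 /Z !natrM !natrD; ring.
  by rewrite ler_wpM2l // !mulr_ge0 ?ler0n // addr_ge0 ?ler0n.
have [e1 e1P] := enc N1; have [e2 e2P] := enc N2; have [e3 e3P] := enc N3.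
pose E := ({ffun 'I_d -> 'I_(c * N3.+1)} * {ffun 'I_d -> 'I_(c * N3.+1)})%type.
pose small (r : K * K) := [/\ r.1 \in R, r.2 \in R, nrm r.1 <= N3%:R & nrm r.2 <= N3%:R].
(* The residues r modulo j for which z r / j lies in the ideal; with z and j they determine it. *)
pose T p : {set E} := [set q : E | `[< exists r : K * K, [/\ small r, q = (e3 r.1, e3 r.2) &
  Lambda R s (al p) (be p) (pairM u (z p) (r.1 / j p, r.2 / j p))] >]]%SET.
pose code p := (e1 (z p).1, e1 (z p).2, e2 (j p), T p).
have sub p p' : z p = z p' -> j p = j p' -> T p = T p' ->
    forall x, Lambda R s (al p) (be p) x -> Lambda R s (al p') (be p') x.
  move=> ez ej eT x Lx; have [Lz _ _ _] := zP p; have [Lz' _ _ _] := zP p'.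
  have [q [q1R q2R xE]] := Lambda_reconstruct sR hR kR m0 half_mod inv_mod sqrt_mod
    (al_be_modulus p) Lx Lz (n0 p).
  rewrite -/(j p) in xE.
  have [y1 y1R hy1] := round (q.1 / j p); have [y2 y2R hy2] := round (q.2 / j p).
  (* Reducing q modulo j changes x by a multiple of z, which stays in the ideal, and leaves a
     remainder small enough to be encoded. *)
  pose r := (q.1 - j p * y1, q.2 - j p * y2).
  have small_diff v y : nrm (v / j p - y) <= c%:R -> nrm (v - j p * y) <= N3%:R.
    move=> h'; have -> : v - j p * y = j p * (v / j p - y) by field.
    by apply: le_trans (nrmM _ _) _; rewrite natrM ler_pM.
  have smallr : small r.
    rewrite /small /r /=; split.
    - by rewrite rpredB // rpredM.
    - by rewrite rpredB // rpredM.
    - exact: (small_diff _ _ hy1).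
    - exact: (small_diff _ _ hy2).
  have xE' : x = pairM u (z p) (y1, y2) + pairM u (z p) (r.1 / j p, r.2 / j p).
    by rewrite {1}xE /pairM /=; congr (_, _) => /=; field.
  have Lr : Lambda R s (al p) (be p) (pairM u (z p) (r.1 / j p, r.2 / j p)).
    have -> : pairM u (z p) (r.1 / j p, r.2 / j p) = x + - pairM u (z p) (y1, y2).
      by rewrite xE' addrAC subrr add0r.
    apply: LambdaD => //; apply: Lambda_opp.
    by apply: (LambdaM uR sR m0 sqrt_mod (al_be_modulus p)).
  have : (e3 r.1, e3 r.2) \in T p by rewrite inE; apply/asboolP; exists r.
  rewrite eT inE => /asboolP[r' [[r1R r2R n1 n2] [f1 f2] Lr']].
  have [s1R s2R s1 s2] := smallr.
  have g1 := e3P _ _ s1R r1R s1 n1 f1; have g2 := e3P _ _ s2R r2R s2 n2 f2.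
  rewrite xE' ez ej g1 g2; apply: LambdaD => //.
  by apply: (LambdaM uR sR m0 sqrt_mod (al_be_modulus p')) => //; rewrite -ez.
have code_inj : injective code.
  move=> p p' [E1 E2 E3 E4].
  have [Lz _ nz1 nz2] := zP p; have [Lz' _ nz1' nz2'] := zP p'.
  have [z1R z2R _ _] := Lz; have [z1R' z2R' _ _] := Lz'.
  have ez : z p = z p'.
    have f1 := e1P _ _ z1R z1R' nz1 nz1' E1; have f2 := e1P _ _ z2R z2R' nz2 nz2' E2.
    by move: f1 f2; case: (z p) (z p') => [x y] [x' y'] /= -> ->.
  have ej : j p = j p' := e2P _ _ (jR p) (jR p') (jN p) (jN p') E3.
  have [d1 d2] := Lambda_sub_divides sR hR kR m0 half_mod inv_mod
    (al_be_modulus p) (al_be_modulus p') (sub _ _ ez ej E4).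
  have [d1' d2'] := Lambda_sub_divides sR hR kR m0 half_mod inv_mod
    (al_be_modulus p') (al_be_modulus p) (sub _ _ (esym ez) (esym ej) (esym E4)).
  have [ei elo] := shell_inj (@lo_le p) (@lo_le p') d1' d1.
  have [_ ehi] := shell_inj (@hi_le p) (@hi_le p') d2' d2.
  rewrite [p]surjective_pairing [p']surjective_pairing; congr (_, _).
    exact: val_inj.
  apply/ffunP => k'; apply: val_inj => /=.
  rewrite (divn_eq (p.2 k') (t ^ p.1)) (divn_eq (p'.2 k') (t ^ p'.1)).
  by rewrite -/(lo p k') -/(lo p' k') -/(hi p k') -/(hi p' k') elo ehi ei.
have cE : #|{: {set E}}| = (2 ^ #|{: E}|)%N by rewrite -cardsT -powersetT card_powerset cardsT.
have := leq_card code code_inj.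
by rewrite !card_prod cE card_prod !card_ffun !card_ord.
Qed.

End FixedScales.

Theorem counting_contradiction : False.
Proof.
pose L := (4 * c * c * c * D0 * Q)%N.
pose N2 := (16 * c * c * c * c * (L + 1) * (L + 1) * (1 + nu))%N.
pose C2 := ((c * N2.+1) ^ d * 2 ^ ((c * (N2 * c).+1) ^ d * (c * (N2 * c).+1) ^ d))%N.
(* J is the constant in the O(P^d) bound itself, so J + 1 scales already exceed it. *)
pose J := ((3 * c * c * (L + 1)) ^ d * (3 * c * c * (L + 1)) ^ d * C2)%N.
have := counting_bound J; rewrite -/L -/N2 -mulnA -/C2; apply/negP; rewrite -ltnNge.
set Z := ((L + 1) * tau ^ J)%N.
have Z_gt0 : (0 < Z)%N by rewrite muln_gt0 addn1 expn_gt0 /tau addn1.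
have le : (c * (2 * c * Z).+1 <= 3 * c * c * Z)%N.
  have -> : (3 * c * c * Z = c * (3 * c * Z))%N by ring.
  rewrite leq_mul2l; apply/orP; right.
  have : (0 < c * Z)%N by rewrite muln_gt0 c_gt0.
  have -> : (3 * c * Z = 2 * c * Z + c * Z)%N by ring.
  lia.
apply: (@leq_ltn_trans ((3 * c * c * Z) ^ d * (3 * c * c * Z) ^ d * C2)%N).
  by rewrite leq_mul2r leq_mul ?orbT // leq_exp2r.
have -> : ((3 * c * c * Z) ^ d * (3 * c * c * Z) ^ d * C2 = J * (t ^ J) ^ d)%N.
  have -> : (3 * c * c * Z = 3 * c * c * (L + 1) * tau ^ J)%N by rewrite /Z; ring.
  have tauJ : (tau ^ J * tau ^ J = t ^ J)%N by rewrite -expnD addnn -mul2n expnM.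
  by rewrite expnMn mulnACA -[((tau ^ J) ^ d * _)%N]expnMn tauJ mulnAC.
by rewrite ltn_mul2r ltnSn expn_gt0 expn_gt0 t_gt0.
Qed.

End Counting.

(** * Orders in number fields *)

Section Evaluation.
Variables (K : fieldExtType rat) (theta : K).
Implicit Types (F G : {poly int}) (q : {poly rat}).

Definition evQ q : K := (map_poly (in_alg K) q).[theta].
Definition evZ F : K := evQ (map_poly intr F).

Lemma evQD q q' : evQ (q + q') = evQ q + evQ q'.
Proof. by rewrite /evQ rmorphD hornerD. Qed.

Lemma evQN q : evQ (- q) = - evQ q.
Proof. by rewrite /evQ rmorphN hornerN. Qed.

Lemma evQM q q' : evQ (q * q') = evQ q * evQ q'.
Proof. by rewrite /evQ rmorphM hornerM. Qed.

Lemma evQC a : evQ a%:P = a%:A.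
Proof. by rewrite /evQ map_polyC hornerC. Qed.

Lemma evQX : evQ 'X = theta.
Proof. by rewrite /evQ map_polyX hornerX. Qed.

Lemma evZD F G : evZ (F + G) = evZ F + evZ G.
Proof. by rewrite /evZ rmorphD evQD. Qed.

Lemma evZN F : evZ (- F) = - evZ F.
Proof. by rewrite /evZ rmorphN evQN. Qed.

Lemma evZB F G : evZ (F - G) = evZ F - evZ G.
Proof. by rewrite evZD evZN. Qed.

Lemma evZM F G : evZ (F * G) = evZ F * evZ G.
Proof. by rewrite /evZ rmorphM evQM. Qed.

Lemma evZC n : evZ n%:P = n%:~R.
Proof. by rewrite /evZ map_polyC evQC -(in_algE K) rmorph_int. Qed.

Lemma evZ1 : evZ 1 = 1.
Proof. by rewrite -[1 in LHS]/(1%:P) evZC. Qed.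

Lemma evZX : evZ 'X = theta.
Proof. by rewrite /evZ map_polyX evQX. Qed.

Lemma evZ_nat n : evZ n%:R = n%:R.
Proof. by elim: n => [|n IH]; [rewrite (evZC 0)|rewrite -!natr1 evZD IH evZ1]. Qed.

Definition int_order : {pred K} := fun x => `[< exists F, x = evZ F >].

Lemma evZ_order F : evZ F \in int_order.
Proof. by apply/asboolP; exists F. Qed.

Lemma order_subring : subring_closed int_order.
Proof.
split=> [|x y /asboolP[F ->] /asboolP[G ->]|x y /asboolP[F ->] /asboolP[G ->]].
- by rewrite -evZ1 evZ_order.
- by rewrite -evZB evZ_order.
- by rewrite -evZM evZ_order.
Qed.

HB.instance Definition _ := GRing.isSubringClosed.Build K int_order order_subring.

End Evaluation.

Lemma integral_generator (K : fieldExtType rat) : exists (theta : K) (f : {poly int}),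
  [/\ f \is monic, size f = (\dim {:K}).+1, evZ theta f = 0 & <<1; theta>>%VS = {:K}%VS].
Proof.
have sepK : separable 1 {:K}.
  by apply/separableP => x _; apply: pcharf0_separable => p; rewrite (pchar_lalg K) pchar_num.
have gen := eq_adjoin_separable_generator sepK (sub1v _).
set t := separable_generator 1 {:K} in gen.
have deg : adjoin_degree 1 t = \dim {:K} by rewrite adjoin_degreeE -gen dimv1 divn1.
have [q qE] := polyOver1P (minPolyOver 1 t).
have [g [a a0 gE]] := rat_poly_scale q.
have szq : size q = (\dim {:K}).+1.
  by rewrite -deg -(size_minPoly 1 t) qE size_map_poly.
have gE' : map_poly intr g = a%:~R *: q by rewrite gE scalerA mulfV ?intr_eq0 // scale1r.
have qt : evQ t q = 0 by rewrite /evQ -qE minPolyxx.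
have gt : evZ t g = 0 by rewrite /evZ gE' /evQ linearZ /= hornerZ -/(evQ t q) qt mulr0.
have szg : size g = (\dim {:K}).+1.
  have <- : size (map_poly (intr : int -> rat) g) = size g.
    by apply: size_map_inj_poly => //; exact: intr_inj.
  by rewrite gE' size_scale ?intr_eq0.
have lead_g : g`_(\dim {:K}) = a.
  apply: (@intr_inj rat); rewrite -coef_map /= gE' coefZ.
  have mq : q \is monic by have := monic_minPoly 1 t; rewrite qE map_monic.
  by have := monicP mq; rewrite /lead_coef szq /= => ->; rewrite mulr1.
pose d := (\dim {:K}).-1.
have dE : \dim {:K} = d.+1 by rewrite prednK // adim_gt0.
(* K has degree d + 1 in this proof. Multiplying g (t) = 0 by a ^ d gives a monic equation with
   integer coefficients for a t. *)
pose h : {poly int} := \poly_(i < d.+1) (g`_i * a ^+ (d - i)).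
exists (a%:~R * t), ('X^(d.+1) + h).
have szh : (size h < size ('X^(d.+1) : {poly int}))%N by rewrite size_polyXn ltnS size_poly.
have aK : a%:~R != 0 :> K by rewrite -(rmorph_int (in_alg K)) fmorph_eq0 intr_eq0.
split.
- by rewrite monicE lead_coefDl // lead_coefXn.
- by rewrite size_polyDl // size_polyXn dE.
- have evh (x : K) (F : {poly int}) n : (size F <= n)%N -> evZ x F = \sum_(i < n) (F`_i)%:~R * x ^+ i.
    move=> Fn; rewrite /evZ /evQ (@horner_coef_wide _ n); last first.
      by rewrite size_map_poly size_map_inj_poly //; exact: intr_inj.
    by apply: eq_bigr => i _; rewrite !coef_map /= -(in_algE K) rmorph_int.
  rewrite evZD (evh _ h d.+1) ?size_poly // (evh _ 'X^(d.+1) d.+2) ?size_polyXn //.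
  rewrite big_ord_recr big1 /= ?add0r => [|i _]; last first.
    by rewrite coefXn (ltn_eqF (ltn_ord i)) mul0r.
  rewrite coefXn eqxx mul1r.
  have := gt; rewrite (evh _ g d.+2) ?szg ?dE // big_ord_recr /= -dE lead_g dE => gt'.
  have gt2 := congr1 (fun z => a%:~R ^+ d * z) gt'; rewrite mulr0 in gt2; apply: etrans gt2.
  rewrite mulrDr addrC mulr_sumr; congr (_ + _).
    apply: eq_bigr => i _; rewrite coef_poly ltn_ord.
    have id : (i <= d)%N by rewrite -ltnS.
    have -> : a%:~R ^+ d = a%:~R ^+ (d - i) * a%:~R ^+ i :> K by rewrite -exprD subnK.
    have -> : (g`_i * a ^+ (d - i))%:~R = a%:~R ^+ (d - i) * (g`_i)%:~R :> K.
      by rewrite mulrC intrM -(rmorphXn (intmul (1 : K))).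
    by rewrite exprMn mulrACA.
  by rewrite exprMn exprSr mulrA mulrAC.
- apply/eqP; rewrite eqEsubv subvf /= gen; apply/FadjoinP; split; first exact: sub1v.
  suff : a%:~R^-1 * (a%:~R * t) \in <<1; a%:~R * t>>%VS by rewrite mulKf.
  rewrite -{1}(rmorph_int (in_alg K)) -fmorphV /= mulr_algl memvZ //.
  exact: memv_adjoin.
Qed.

Section Order.
Variables (K : fieldExtType rat) (theta : K) (f : {poly int}).
Local Notation d := (\dim {:K}).
Hypotheses (f_monic : f \is monic) (f_size : size f = d.+1).
Hypotheses (f_root : evZ theta f = 0) (gen : <<1; theta>>%VS = {:K}%VS).

Let degE : adjoin_degree 1 theta = d.
Proof. by rewrite adjoin_degreeE gen dimv1 divn1. Qed.

Lemma evQ_eq0 (q : {poly rat}) : (size q <= d)%N -> evQ theta q = 0 -> q = 0.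
Proof.
move=> qd q0; apply: (map_poly_inj (in_alg K)); rewrite rmorph0.
apply/eqP; apply: contraTT qd => q'0; rewrite -ltnNge -degE -(size_minPoly 1 theta).
rewrite -[size q](size_map_poly (in_alg K)); apply: dvdp_leq => //.
by apply: minPoly_dvdp; [exact: alg_polyOver | apply/rootP].
Qed.

Lemma evQ_surj x : exists2 q : {poly rat}, (size q <= d)%N & x = evQ theta q.
Proof.
have [q qE] := polyOver1P (Fadjoin_polyOver 1 theta x); exists q.
  by rewrite -degE -(size_map_poly (in_alg K)) -qE size_Fadjoin_poly.
by rewrite /evQ -qE Fadjoin_poly_eq // gen memvf.
Qed.

Lemma evZ_reduce (F : {poly int}) : exists2 G : {poly int}, (size G <= d)%N & evZ theta F = evZ theta G.
Proof.
exists (Pdiv.Ring.rmodp F f).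
  by rewrite -ltnS -f_size Pdiv.Ring.ltn_rmodpN0 // monic_neq0.
rewrite {1}(Pdiv.RingMonic.rdivp_eq f_monic F).
by rewrite evZD evZM f_root mulr0 add0r.
Qed.

Lemma order_scale x : exists2 n : nat, (0 < n)%N & n%:R * x \in int_order theta.
Proof.
have [q _ ->] := evQ_surj x; have [g [a a0 qE]] := rat_poly_scale q.
have nE (b : int) : exists e : int, (absz b)%:R = b%:~R * e%:~R :> rat.
  case: b => n; first by exists 1; rewrite mulr1.
  by exists (-1); rewrite NegzE !rmorphN mulrN mulr1 opprK.
exists (absz a); first by rewrite absz_gt0.
have [e eE] := nE a.
suff -> : (absz a)%:R * evQ theta q = evZ theta (e%:P * g) by exact: evZ_order.
rewrite -ratA_natr -(evQC theta) -evQM /evZ rmorphM /= map_polyC /=; congr (evQ _ _).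
rewrite qE eE mul_polyC scalerA mulrAC mulfV ?intr_eq0 // mul1r mul_polyC; congr (_ *: _).
Qed.

End Order.

Lemma absz_shift_lt (z : int) (N c : nat) : - N%:Z <= z -> z <= N%:Z -> (1 < c)%N ->
  0 <= z + N%:Z /\ (absz (z + N%:Z)%R < c * N.+1)%N.
Proof.
move=> h1 h2 c1; have h3 : (2 * N.+1 <= c * N.+1)%N by rewrite leq_mul2r c1 orbT.
by split; lia.
Qed.

Section OrderNorm.
Variables (K : fieldExtType rat) (theta : K) (f : {poly int}).
Local Notation d := (\dim {:K}).
Hypotheses (f_monic : f \is monic) (f_size : size f = d.+1).
Hypotheses (f_root : evZ theta f = 0) (gen : <<1; theta>>%VS = {:K}%VS).
Implicit Types (x y : K).

Definition coordp x : {poly rat} := s2val (cid2 (evQ_surj gen x)).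

Let coordp_size x : (size (coordp x) <= d)%N.
Proof. exact: (s2valP (cid2 (evQ_surj gen x))). Qed.

Let coordpK x : evQ theta (coordp x) = x.
Proof. exact: esym (s2valP' (cid2 (evQ_surj gen x))). Qed.

Let evQK (q : {poly rat}) : (size q <= d)%N -> coordp (evQ theta q) = q.
Proof.
move=> qd; apply/eqP; rewrite -subr_eq0; apply/eqP; apply: (evQ_eq0 gen).
  by apply: leq_trans (size_polyD _ _) _; rewrite geq_max coordp_size size_polyN.
by rewrite evQD evQN coordpK subrr.
Qed.

Let coordpD x y : coordp (x + y) = coordp x + coordp y.
Proof.
rewrite -{1}[x]coordpK -{1}[y]coordpK -evQD evQK //.
by apply: leq_trans (size_polyD _ _) _; rewrite geq_max !coordp_size.
Qed.

Let coordpZ (a : rat) x : coordp (a%:A * x) = a *: coordp x.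
Proof.
rewrite -{1}[x]coordpK -(evQC theta) -evQM mul_polyC evQK //.
by apply: leq_trans (size_scale_leq _ _) _; exact: coordp_size.
Qed.

Let coordp_order x : x \in int_order theta -> exists2 g : {poly int}, (size g <= d)%N &
  coordp x = map_poly intr g.
Proof.
move=> /asboolP[g ->]; have [h hd ->] := evZ_reduce f_monic f_size f_root g.
exists h => //; rewrite /evZ evQK //.
by rewrite size_map_inj_poly //; exact: intr_inj.
Qed.

Definition coord_norm x : rat := \sum_(i < d) `|(coordp x)`_i|.

Let coord_norm_ge0 x : 0 <= coord_norm x.
Proof. by apply: sumr_ge0. Qed.

Let coord_normD x y : coord_norm (x + y) <= coord_norm x + coord_norm y.
Proof.
rewrite /coord_norm -big_split; apply: ler_sum => i _ /=.
by rewrite coordpD coefD; exact: ler_normD.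
Qed.

Let coord_normZ (a : rat) x : coord_norm (a%:A * x) = `|a| * coord_norm x.
Proof.
rewrite /coord_norm mulr_sumr; apply: eq_bigr => i _.
by rewrite coordpZ coefZ normrM.
Qed.

Let coord_norm0 : coord_norm 0 = 0.
Proof. by have := coord_normZ 0 0; rewrite scale0r mul0r normr0 mul0r. Qed.

Let coord_norm_sum (n : nat) (F : 'I_n -> K) :
  coord_norm (\sum_i F i) <= \sum_i coord_norm (F i).
Proof.
elim/big_ind2: _ => [|x a y b xa yb|//]; first by rewrite coord_norm0.
by apply: le_trans (coord_normD _ _) _; exact: lerD.
Qed.

Let expand x : x = \sum_(i < d) ((coordp x)`_i)%:A * theta ^+ i.
Proof.
rewrite -{1}[x]coordpK /evQ (@horner_coef_wide _ d).
  by apply: eq_bigr => i _; rewrite coef_map.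
by rewrite size_map_poly.
Qed.

Let S : rat := \sum_(i < d) \sum_(j < d) coord_norm (theta ^+ i * theta ^+ j).

(** C bounds the structure constants of the basis of powers of theta, which makes C times
    [coord_norm] submultiplicative; the successor ensures C >= 1. *)
Let C := (Num.bound S).+1.

Let S_ge i j : coord_norm (theta ^+ (i : 'I_d) * theta ^+ (j : 'I_d)) <= C%:R.
Proof.
have h : coord_norm (theta ^+ i * theta ^+ j) <= S.
  rewrite /S (bigD1 i) //= (bigD1 j) //= -addrA lerDl.
  by rewrite addr_ge0 // sumr_ge0 // => k _; rewrite sumr_ge0.
apply: le_trans h _; have S0 : 0 <= S by apply: sumr_ge0 => k _; apply: sumr_ge0.
by apply: le_trans (ltW (archi_boundP S0)) _; rewrite ler_nat.
Qed.

Let coord_normM x y : coord_norm (x * y) <= C%:R * (coord_norm x * coord_norm y).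
Proof.
rewrite [X in coord_norm (X * _)]expand [X in coord_norm (_ * X)]expand mulr_suml.
apply: le_trans (coord_norm_sum _) _; rewrite [X in X * coord_norm y]/coord_norm mulr_suml mulr_sumr.
apply: ler_sum => i _; rewrite mulr_sumr; apply: le_trans (coord_norm_sum _) _.
rewrite /coord_norm !mulr_sumr; apply: ler_sum => j _; rewrite -/(coord_norm _).
rewrite mulrACA -!(in_algE K) -rmorphM /= coord_normZ normrM mulrC.
by rewrite ler_wpM2r // mulr_ge0.
Qed.

Let one_poly_size : (size (1%:P : {poly rat}) <= d)%N.
Proof. by rewrite size_polyC oner_eq0 adim_gt0. Qed.

Lemma order_counting (u D2 U : K) (D0 : nat) :
  u \in int_order theta -> D2 \in int_order theta -> U \in int_order theta ->
  (0 < D0)%N -> D0%:R = 2 * D2 -> D0%:R = u * U -> (forall y, y ^+ 2 != u) ->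
  (forall M, M \in int_order theta -> M != 0 -> divides (int_order theta) D0%:R (M - 1) ->
    exists2 s, s \in int_order theta & divides (int_order theta) M (s ^+ 2 - u)) ->
  False.
Proof.
have d_gt0 : (0 < d)%N by exact: adim_gt0.
(* C d dominates the norm of 1, the rounding error and the size of box points; adding 2 gives c > 1,
   so the 2 N + 1 integers between -N and N fit into c (N + 1) codes. *)
pose c := (C * d + 2)%N.
pose nrm x := C%:R * coord_norm x.
pose box (a : 'I_d -> nat) : K := \sum_(i < d) ((a i)%:R)%:A * theta ^+ i.
have CC : 1 <= C%:R :> rat by rewrite ler1n.
have C0 : 0 <= C%:R :> rat by rewrite ler0n.
have Cd_c : (C * d)%:R <= c%:R :> rat by rewrite ler_nat leq_addr.
have box_coord a : coordp (box a) = \poly_(i < d) (oapp (fun k => (a k)%:R) 0 (insub i)).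
  rewrite -[RHS]evQK ?size_poly //; congr coordp.
  rewrite /evQ (@horner_coef_wide _ d) ?size_map_poly ?size_poly //.
  by apply: eq_bigr => i _; rewrite coef_map coef_poly ltn_ord valK.
have box_coef a (k : 'I_d) : (coordp (box a))`_k = (a k)%:R.
  by rewrite box_coord coef_poly ltn_ord valK.
have nat_bound x N : (forall i : 'I_d, `|(coordp x)`_i| <= N%:R) -> nrm x <= (C * d)%:R * N%:R.
  move=> h; rewrite /nrm natrM -mulrA ler_wpM2l // /coord_norm.
  apply: le_trans (ler_sum _ (fun i _ => h i)) _.
  by rewrite big_const_ord iter_addr addr0 -[_ *+ d]mulr_natl.
have c_gt0 : (0 < c)%N by rewrite /c addn2.
move=> uR D2R UR D0_gt0 D0_2 D0_u u_nsq all_sqrt.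
have nrmu0 : 0 <= nrm u by rewrite mulr_ge0.
apply: (@counting_contradiction K (int_order theta) d nrm c box _ _ _ _ _ _ _ _ _ _ _ _ _ _
  u D2 U D0 (Num.bound (nrm u)) _ _ _ _ _ _ _ u_nsq all_sqrt) => //; last exact: ltW (archi_boundP nrmu0).
- by move=> x y; rewrite /nrm -mulrDr ler_wpM2l.
- move=> x y; rewrite /nrm; apply: le_trans (ler_wpM2l C0 (coord_normM x y)) _.
  by rewrite mulrACA -mulrA.
- move=> x; rewrite /nrm -mulN1r (_ : -1 = (-1)%:A) ?coord_normZ ?normrN1 ?mul1r //.
  by rewrite scaleN1r.
- by move=> x; rewrite mulr_ge0.
- move=> n x; rewrite /nrm -ratA_natr coord_normZ mulrCA normr_nat; ring.
- move=> x xR x0; have [g gd gE] := coordp_order xR.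
  have [i gi] : exists i : 'I_d, g`_i != 0.
    apply: contrapT => ng; move/eqP: x0; apply.
    rewrite -[x]coordpK gE (_ : g = 0) ?rmorph0 //.
      by rewrite /evQ rmorph0 horner0.
    apply/polyP => i; rewrite coef0; have [id|id] := ltnP i d.
      by apply/eqP; apply: contrapT => /negP gi; apply: ng; exists (Ordinal id).
    by rewrite nth_default // (leq_trans gd).
  rewrite /nrm -[1]mulr1 ler_pM // /coord_norm (bigD1 i) //=.
  rewrite -[1]addr0 lerD ?sumr_ge0 // gE coef_map /= -intr_norm ler1z.
  by rewrite -gtz0_ge1 normr_gt0.
- rewrite /nrm; apply: le_trans Cd_c; rewrite natrM ler_wpM2l //.
  rewrite /coord_norm.
  have -> : coordp 1 = 1%:P by rewrite -[RHS]evQK // evQC scale1r.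
  rewrite (eq_bigr (fun i : 'I_d => (i == Ordinal d_gt0)%:R)).
    rewrite (bigD1 (Ordinal d_gt0)) //= ?eqxx big1 ?addr0 => [|i /negPf -> //].
    by rewrite ?lexx ?ler1n.
  by move=> i _; rewrite coefC -val_eqE /=; case: (_ == _); rewrite ?normr1 ?normr0.
- move=> x; pose g : {poly int} := \poly_(i < d) Num.floor (coordp x)`_i.
  have gZ : coordp (evZ theta g) = map_poly intr g.
    by rewrite /evZ evQK // size_map_inj_poly ?size_poly //; exact: intr_inj.
  exists (evZ theta g); first exact: evZ_order.
  apply: le_trans Cd_c; rewrite -[(C * d)%:R]mulr1; apply: (nat_bound _ 1%N) => i.
  have -> : x - evZ theta g = x + (-1)%:A * evZ theta g by rewrite scaleN1r mulN1r.
  rewrite coordpD coordpZ gZ coefD coefZ coef_map coef_poly ltn_ord /= mulN1r.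
  have := floor_itv (coordp x)`_i; rewrite intrD => /andP[h1 h2].
  rewrite ger0_norm ?subr_ge0 //; lra.
- move=> a; rewrite rpred_sum // => i _; rewrite ratA_natr rpredM ?rpred_nat // rpredX //.
  by have := evZ_order theta 'X; rewrite evZX.
- move=> a N aN; apply: le_trans (_ : (C * d)%:R * N%:R <= _); last by rewrite ler_wpM2r.
  by apply: nat_bound => i; rewrite box_coef normr_nat ler_nat.
- move=> a b ab k; apply/eqP; rewrite -(eqr_nat rat) -!box_coef ab //.
- move=> N; have pos : (0 < c * N.+1)%N by rewrite muln_gt0 c_gt0.
  exists (fun x => [ffun k : 'I_d => insubd (Ordinal pos) (absz (numq (coordp x)`_k + N%:Z))]).
  move=> x y xR yR xN yN /ffunP exy.
  have [g gd gE] := coordp_order xR; have [h hd hE] := coordp_order yR.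
  have bd z (p : {poly int}) (k : 'I_d) : coordp z = map_poly intr p -> nrm z <= N%:R ->
      - N%:Z <= p`_k <= N%:Z.
    move=> zE zN; rewrite -ler_norml -(ler_int rat) intr_norm; apply: le_trans zN.
    have -> : (p`_k)%:~R = (coordp z)`_k by rewrite zE coef_map.
    apply: le_trans (_ : coord_norm z <= _); last by rewrite /nrm ler_peMl.
    by rewrite /coord_norm (bigD1 k) //= lerDl sumr_ge0.
  have code z (p : {poly int}) (k : 'I_d) : coordp z = map_poly intr p -> nrm z <= N%:R ->
      (val (insubd (Ordinal pos) (absz (numq (coordp z)`_k + N%:Z))))%:Z = p`_k + N%:Z.
    move=> zE zN; have /andP[h1 h2] := bd z p k zE zN.
    have -> : numq (coordp z)`_k = p`_k by rewrite zE coef_map /= numq_int.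
    have c1 : (1 < c)%N by rewrite /c addn2.
    have [z0 lt] := absz_shift_lt h1 h2 c1.
    by rewrite val_insubd lt gez0_abs.
  suff gh : g = h by rewrite -[x]coordpK -[y]coordpK gE hE gh.
  apply/polyP => i; have [id|id] := ltnP i d; last by rewrite !nth_default ?(leq_trans _ id).
  have := exy (Ordinal id); rewrite !ffunE => /(congr1 val)/(congr1 Posz).
  by rewrite (code x g) // (code y h) // => /addIr.
Qed.

End OrderNorm.

(** * Primes of an order *)

Section ModP.
Variable p : nat.
Hypothesis pr : prime p.

Local Notation bar := (map_poly (intr : int -> 'F_p)).

Lemma Fp_intr_eq0 (z : int) : (z%:~R == 0 :> 'F_p) = (p %| absz z)%N.
Proof.
rewrite (dvdn_pcharf (pchar_Fp pr)); case: z => n //.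
by rewrite NegzE rmorphN oppr_eq0.
Qed.

Lemma bar_lift (h : {poly 'F_p}) : exists H : {poly int}, bar H = h.
Proof.
exists (map_poly (fun x : 'F_p => (nat_of_ord x)%:Z) h).
apply/polyP => i; rewrite coef_map coef_map_id0 //=.
by rewrite -[RHS]natr_Zp.
Qed.

Lemma bar_eq0 (F : {poly int}) : bar F = 0 -> exists G : {poly int}, F = p%:R *: G.
Proof.
move=> F0; have dv i : (p %| absz (F`_i)%R)%N.
  by rewrite -Fp_intr_eq0 -coef_map F0 coef0.
exists (map_poly (fun z : int => (z %/ p)%Z) F); apply/polyP => i.
rewrite coefZ coef_map_id0 ?div0z // natz [RHS]mulrC divzK //.
exact: dv.
Qed.

Lemma irreducible_coprimep (g a : {poly 'F_p}) : irreducible_poly g -> ~~ (g %| a) -> coprimep g a.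
Proof.
move=> [g1 girr] ga; apply: contraT => /girr h.
have /eqp_dvdl e := h (dvdp_gcdl g a).
by case/negP: ga; rewrite -e dvdp_gcdr.
Qed.

End ModP.

(** * The place of an unramified prime, generated by p and a lift of g *)

Section PrimePlace.
Variables (K : fieldExtType rat) (theta : K) (f : {poly int}).
Local Notation d := (\dim {:K}).
Hypotheses (f_monic : f \is monic) (f_size : size f = d.+1).
Hypotheses (f_root : evZ theta f = 0) (gen : <<1; theta>>%VS = {:K}%VS).
Variable p : nat.
Hypothesis pr : prime p.
Local Notation bar := (map_poly (intr : int -> 'F_p)).
Variable g : {poly 'F_p}.
Hypotheses (g_irr : irreducible_poly g) (g_dvd : g %| bar f) (f_sep : separable_poly (bar f)).
Implicit Types (x y : K) (F G : {poly int}).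

Local Notation ev := (evZ theta).

Lemma evZ_eq0_dvd F : ev F = 0 -> bar f %| bar F.
Proof.
rewrite {1 2}(Pdiv.RingMonic.rdivp_eq f_monic F) evZD evZM f_root mulr0 add0r => r0.
have sz : (size (Pdiv.Ring.rmodp F f) <= d)%N.
  by rewrite -ltnS -f_size Pdiv.Ring.ltn_rmodpN0 // monic_neq0.
have -> : Pdiv.Ring.rmodp F f = 0.
  apply: (@map_inj_poly _ _ (intr : int -> rat)) => //; first exact: intr_inj.
  rewrite rmorph0; apply: (evQ_eq0 gen) => //.
  by rewrite size_map_inj_poly //; exact: intr_inj.
by rewrite addr0 rmorphM dvdp_mulIr.
Qed.

(** Two integer polynomials with the same value at theta differ by a multiple of f, so membership in
    the prime depends on the value only. *)
Lemma evZ_eq_dvd F G : ev F = ev G -> (g %| bar F) = (g %| bar G).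
Proof.
move=> FG; have : g %| bar (F - G).
  by apply: dvdp_trans g_dvd _; apply: evZ_eq0_dvd; rewrite evZB FG subrr.
by rewrite rmorphB /= => h; rewrite -[bar F](subrK (bar G)) dvdp_addr.
Qed.

(** The part of Z[theta] outside the prime ideal generated by p and a lift of g. *)
Definition away x : Prop := exists2 F, x = ev F & ~~ (g %| bar F).

Lemma awayM x y : away x -> away y -> away (x * y).
Proof.
move=> [F -> nF] [G -> nG]; exists (F * G); first by rewrite evZM.
by rewrite rmorphM Gauss_dvdpr ?irreducible_coprimep.
Qed.

Lemma away_nat n : ~~ (p %| n)%N -> away n%:R.
Proof.
move=> pn; exists n%:R; first by rewrite evZ_nat.
rewrite rmorph_nat -(rmorph_nat polyC); apply/negP => /dvdp_leq.
rewrite polyC_eq0 -(dvdn_pcharf (pchar_Fp pr)) => /(_ pn).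
by rewrite leqNgt (leq_ltn_trans (size_polyC_leq1 _)) //; case: g_irr.
Qed.

Lemma away1 : away 1.
Proof. by apply: (away_nat (n := 1)); rewrite dvdn1 neq_ltn prime_gt1 ?orbT. Qed.

Lemma awayX x n : away x -> away (x ^+ n).
Proof. by move=> ax; elim: n => [|n IH]; [exact: away1|rewrite exprS; exact: awayM]. Qed.

Lemma away_neq0 x : away x -> x != 0.
Proof.
move=> [F -> nF]; apply: contraNneq nF => F0.
by rewrite (@evZ_eq_dvd F 0) ?rmorph0 ?dvdp0 // F0; exact: esym (evZ_nat theta 0).
Qed.

Lemma away_order x : away x -> x \in int_order theta.
Proof. by move=> [F -> _]; exact: evZ_order. Qed.

Lemma not_away_p y : y \in int_order theta -> ~ away (p%:R * y).
Proof.
move=> /asboolP[F ->] [G e nG]; case/negP: nG.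
rewrite -(@evZ_eq_dvd (p%:R * F) G) ?evZM ?evZ_nat // rmorphM rmorph_nat.
by rewrite -(rmorph_nat polyC) (pcharf0 (pchar_Fp pr)) rmorph0 mul0r dvdp0.
Qed.

(** Separability makes the cofactor h of g in f modulo p prime to g. For t lifting h, multiplication
    by t carries the prime ideal into p Z[theta]: p is a uniformizer there. *)
Lemma local_parameter : exists2 t, away t & forall F, g %| bar F ->
  exists G, t * ev F = p%:R * ev G.
Proof.
have [h hE] := dvdpP _ _ g_dvd.
have gh : coprimep h g by move: f_sep; rewrite hE separable_mul => /and3P[].
have [T TE] := bar_lift h; exists (ev T).
  exists T => //; rewrite TE; apply/negP => gdh; have [g1 _] := g_irr.
  have := coprimepP h g gh g gdh (dvdpp g); rewrite -size_poly_eq1 => /eqP g1'.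
  by rewrite g1' in g1.
move=> F /dvdpP[q qE]; have [Q QE] := bar_lift q.
have /bar_eq0[//|G GE] : bar (T * F - f * Q) = 0.
  by rewrite rmorphB !rmorphM /= TE qE QE hE; ring.
exists G; rewrite -evZM -(evZ_nat theta p) -evZM.
have -> : T * F = f * Q + p%:R * G.
  by rewrite -[T * F](subrKC (f * Q)) GE scaler_nat mulr_natl.
by rewrite evZD evZM f_root mul0r add0r.
Qed.

Lemma int_order_multiple x : x != 0 -> exists2 y, y \in int_order theta &
  exists2 n : nat, (0 < n)%N & x * y = n%:R.
Proof.
move=> x0; have [n n0 h] := order_scale gen x^-1; exists (n%:R * x^-1) => //.
by exists n => //; rewrite mulrCA mulfV // mulr1.
Qed.

Let pK0 : p%:R != 0 :> K.
Proof. by rewrite number_field_natr_eq0 -lt0n prime_gt0. Qed.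

Definition has_val x (n : int) : Prop := exists a b, [/\ away a, away b & x = p%:R ^ n * (a / b)].

(** Factors of p are extracted one at a time, at the cost of factors t. This stops: x has a multiple
    m in the positive integers, and extracting more factors than p has in m would put an element
    outside the prime into it. *)
Lemma has_val_order x : x \in int_order theta -> x != 0 -> exists n : nat, has_val x n.
Proof.
move=> xR x0; have [t at_ tP] := local_parameter; have t0 := away_neq0 at_.
apply: contrapT => nex.
have all n : exists2 G, True & t ^+ n * x = p%:R ^+ n * ev G.
  elim: n => [|n [G _ GE]].
    by have /asboolP[F ->] := xR; exists F => //; rewrite !expr0 !mul1r.
  have [gG|nG] := boolP (g %| bar G).
    have [H HE] := tP G gG; exists H => //.
    by rewrite exprS -mulrA GE mulrCA HE exprSr mulrA.
  case: nex; exists n, (ev G), (t ^+ n); split; first by exists G.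
    exact: awayX.
  by rewrite -exprnP mulrA -GE mulrAC mulfV ?mul1r // expf_neq0.
have [y yR [m m0 xy]] := int_order_multiple x0.
have [m' pm' mE] := pfactor_coprime pr m0; move: (logn p m) mE => k mE.
have [G _ GE] := all k.+1.
have : away (t ^+ k.+1 * m'%:R).
  apply: awayM; first exact: awayX.
  by apply: away_nat; rewrite -prime_coprime.
suff -> : t ^+ k.+1 * m'%:R = p%:R * (ev G * y).
  by apply: not_away_p; rewrite rpredM // evZ_order.
apply: (mulfI (expf_neq0 k pK0)).
have -> : p%:R ^+ k * (t ^+ k.+1 * m'%:R) = t ^+ k.+1 * (x * y).
  by rewrite xy mE natrM natrX; ring.
by rewrite mulrA GE (exprS p%:R); ring.
Qed.

Lemma has_valM x y n k : has_val x n -> has_val y k -> has_val (x * y) (n + k).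
Proof.
move=> [a [b [aa ab ->]]] [a' [b' [aa' ab' ->]]]; exists (a * a'), (b * b').
split; rewrite ?awayM //; try exact: awayM.
by rewrite expfzDr // invfM; ring.
Qed.

Lemma has_valV x n : has_val x n -> has_val x^-1 (- n).
Proof.
move=> [a [b [aa ab ->]]]; exists b, a; split=> //.
by rewrite !invfM invrK invr_expz [a^-1 * b]mulrC.
Qed.

Lemma has_val_exists x : x != 0 -> exists n, has_val x n.
Proof.
move=> x0; have [n n0 h] := order_scale gen x.
have nK : n%:R != 0 :> K by rewrite number_field_natr_eq0 -lt0n.
have [k hk] := has_val_order h (mulf_neq0 nK x0).
have nR : n%:R \in int_order theta by rewrite rpred_nat.
have [l hl] := has_val_order nR nK.
exists (k%:Z - l%:Z); rewrite (_ : x = (n%:R * x) * n%:R^-1).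
  by apply: has_valM => //; exact: has_valV.
by rewrite mulrC mulKf.
Qed.

(** A larger exponent k would make a product of elements outside the prime divisible by p. *)
Lemma has_val_le x n k : has_val x n -> has_val x k -> k <= n.
Proof.
move=> [a [b [aa ab ->]]] [a' [b' [aa' ab' e]]]; rewrite leNgt; apply/negP => nk.
have b0 := away_neq0 ab; have b'0 := away_neq0 ab'.
have [j jE] : exists j : nat, k = n + j.+1%:Z by exists (absz (k - n)).-1; lia.
have : away (a * b') by exact: awayM.
have -> : a * b' = p%:R * (p%:R ^+ j * (a' * b)).
  have h : a / b = p%:R ^+ j.+1 * (a' / b').
    apply: (mulfI (expfz_neq0 n pK0)); rewrite e jE expfzDr // -exprnP; ring.
  have -> : a * b' = a / b * (b * b') by field.
  by rewrite h exprS; field.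
by apply: not_away_p; rewrite !rpredM ?rpredX ?rpred_nat ?away_order.
Qed.

Lemma has_val_uniq x n k : has_val x n -> has_val x k -> n = k.
Proof.
move=> hn hk; apply/eqP; rewrite eq_le.
by rewrite (has_val_le hn hk) (has_val_le hk hn).
Qed.

Lemma has_valD x y n k j : has_val x n -> has_val y k -> n <= k -> x + y != 0 ->
  has_val (x + y) j -> n <= j.
Proof.
move=> [a [b [aa ab ->]]] [a' [b' [aa' ab' ->]]] nk xy0.
have b0 := away_neq0 ab; have b'0 := away_neq0 ab'.
have [i iE] : exists i : nat, k = n + i%:Z by exists (absz (k - n)); lia.
pose c := a * b' + p%:R ^+ i * (a' * b).
have E : p%:R ^ n * (a / b) + p%:R ^ k * (a' / b') = p%:R ^ n * (c * (b * b')^-1).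
  by rewrite iE expfzDr // -exprnP /c; field; rewrite b0 b'0.
rewrite E in xy0 *.
have c0 : c != 0 by apply: contraNneq xy0 => ->; rewrite mul0r mulr0.
have cR : c \in int_order theta.
  by rewrite rpredD ?rpredM ?rpredX ?rpred_nat ?away_order.
have [l hl] := has_val_order cR c0.
have hb : has_val (b * b')^-1 0.
  exists 1, (b * b'); split; [exact: away1|exact: awayM|by rewrite expr0z !mul1r].
have hp : has_val (p%:R ^ n) n.
  by exists 1, 1; split; [exact: away1|exact: away1|rewrite divr1 mulr1].
move=> hj; have := has_val_uniq hj (has_valM hp (has_valM hl hb)); lia.
Qed.

Definition prime_val x : int := xget 0 [set n | has_val x n]%classic.

Lemma prime_valP x : x != 0 -> has_val x (prime_val x).
Proof.
move=> /has_val_exists[n hn]; rewrite /prime_val; case: xgetP => [k _ //|/(_ n)].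
by [].
Qed.

Lemma prime_valE x n : x != 0 -> has_val x n -> prime_val x = n.
Proof. by move=> x0; apply: has_val_uniq; exact: prime_valP. Qed.

Lemma prime_valM x y : x != 0 -> y != 0 -> prime_val (x * y) = prime_val x + prime_val y.
Proof.
by move=> x0 y0; apply: prime_valE; rewrite ?mulf_neq0 //; apply: has_valM; exact: prime_valP.
Qed.

Lemma prime_valD x y : x != 0 -> y != 0 -> x + y != 0 ->
  Num.min (prime_val x) (prime_val y) <= prime_val (x + y).
Proof.
move=> x0 y0 xy0; have hx := prime_valP x0; have hy := prime_valP y0.
have hxy := prime_valP xy0; rewrite ge_min.
have [le|/ltW le] := leP (prime_val x) (prime_val y).
  by rewrite (has_valD hx hy le xy0 hxy).
by rewrite addrC in xy0 hxy *; rewrite (has_valD hy hx le xy0 hxy) orbT.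
Qed.

Lemma prime_val_surj n : exists2 x : K, x != 0 & prime_val x = n.
Proof.
have p0 := expfz_neq0 n pK0; exists (p%:R ^ n) => //; apply: prime_valE => //.
by exists 1, 1; split; [exact: away1|exact: away1|rewrite divr1 mulr1].
Qed.

Definition prime_place : finite_place K := FinitePlace prime_valM prime_valD prime_val_surj.

Lemma prime_place_away x : away x -> prime_place x = 0.
Proof.
move=> ax; apply: prime_valE; first exact: away_neq0.
by exists x, 1; split; [|exact: away1|rewrite expr0z divr1 mul1r].
Qed.

Lemma prime_place_p : prime_place p%:R = 1.
Proof.
apply: prime_valE => //; exists 1, 1; split; [exact: away1|exact: away1|].
by rewrite expr1z divr1 mulr1.
Qed.

Lemma prime_place_dvd F : val_ge prime_place 1 (ev F) -> g %| bar F.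
Proof.
move=> h; apply: contraT => nF; have aF : away (ev F) by exists F.
by move: h; rewrite val_geE ?away_neq0 // prime_place_away.
Qed.

Section NonSquare.
Variable Fu : {poly int}.
Hypothesis Fu_nsq : forall s, ~~ (g %| s ^+ 2 - bar Fu).

Let u := ev Fu.

Let u_away : away u.
Proof.
exists Fu => //; have := Fu_nsq 0; rewrite expr0n sub0r.
by rewrite dvdpNr.
Qed.

Let u0 : u != 0. Proof. exact: away_neq0. Qed.

(** Such an x would be a unit a / b with a and b outside the prime; as b is invertible modulo g, a /
    b reduces to a square root of [Fu] modulo g. *)
Lemma residue_nonsquare x : ~ val_ge prime_place 1 (u - x ^+ 2).
Proof.
move=> h; have wu := prime_place_away u_away.
have [x0|x0] := eqVneq x 0.
  by move: h; rewrite x0 expr0n subr0 val_geE // wu.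
have lt : prime_place u < 1 by rewrite wu.
have [_] := place_val_close u0 lt h; rewrite place_valX // wu => wx.
have {wx} wx : prime_val x = 0.
  by move/eqP: wx; rewrite mulrn_eq0 => /eqP.
have [a [b [aa ab xE]]] := prime_valP x0; rewrite wx expr0z mul1r in xE.
have [A AE nA] := aa; have [B BE nB] := ab.
have b0 := away_neq0 ab.
have : val_ge prime_place 1 (ev (B ^+ 2 * Fu - A ^+ 2)).
  rewrite evZB !expr2 !evZM -AE -BE -/u.
  have -> : b * b * u - a * a = b ^+ 2 * (u - x ^+ 2) by rewrite xE; field.
  rewrite -[1]add0r val_geM // val_geE ?expf_neq0 // place_valX //.
  by rewrite prime_place_away // mul0rn.
move/prime_place_dvd; rewrite rmorphB rmorphM !rmorphXn /= => gd.
have cop : coprimep g (bar B) by exact: irreducible_coprimep.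
have [[c e] /= ce] := Bezout_eq1_coprimepP _ _ cop.
have := Fu_nsq (e * bar A); apply/negP; rewrite negbK.
have -> : (e * bar A) ^+ 2 - bar Fu =
    - (e ^+ 2 * (bar B ^+ 2 * bar Fu - bar A ^+ 2)) + ((e * bar B) ^+ 2 - 1) * bar Fu.
  by ring.
have -> : (e * bar B) ^+ 2 - 1 = g * (c * (c * g - 2)).
  have -> : e * bar B = 1 - c * g by rewrite -ce; ring.
  by ring.
apply: dvdp_add; first by rewrite dvdpNr dvdp_mull.
by rewrite -mulrA dvdp_mulIl.
Qed.

Lemma prime_place_nonnorm (y : nonzero K) : val y = u ->
  exists (w : finite_place K) (b : sqclass (completion w)),
    local_functional b (\pi_(sqclass K) y) = 1.
Proof.
move=> yu; have two0 : 2 != 0 :> K by rewrite (number_field_natr_eq0 K 2).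
exists prime_place; apply: (nonsquare_residue_functional two0 pK0 prime_place_p).
  by rewrite yu prime_place_away.
by rewrite yu; exact: residue_nonsquare.
Qed.

End NonSquare.

End PrimePlace.

(** * Square roots modulo separable polynomials *)

Section PolySqrt.
Variable F : fieldType.
Implicit Types (p q g h : {poly F}).

Lemma exists_irreducible_factor h : (1 < size h)%N -> exists2 g, irreducible_poly g & g %| h.
Proof.
move=> h1; pose Q n := `[< exists2 g, g %| h & (1 < size g)%N /\ size g = n >].
have exQ : exists n, Q n by exists (size h); apply/asboolP; exists h; rewrite ?dvdpp.
case: (ex_minnP exQ) => n /asboolP[g gh [g1 gn]] nmin; exists g => //.
split=> // q q1 qg; have g0 : g != 0 by rewrite -size_poly_gt0 (ltn_trans _ g1).
have q0 : q != 0 by apply: contraNneq g0 => q0; move: qg; rewrite q0 dvd0p.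
rewrite -dvdp_size_eqp // eqn_leq dvdp_leq //= gn; apply: nmin; apply/asboolP.
exists q; first exact: dvdp_trans qg gh.
by split=> //; rewrite ltn_neqAle eq_sym q1 size_poly_gt0.
Qed.

(** Chinese remainders: separability makes each irreducible factor prime to its cofactor, and a
    Bezout relation glues the roots. *)
Lemma sqrt_mod_separable q h : separable_poly h ->
  (forall g, irreducible_poly g -> g %| h -> exists s, g %| s ^+ 2 - q) ->
  exists s, h %| s ^+ 2 - q.
Proof.
have [n] := ubnP (size h); elim: n h => // n IH h hn sep loc.
have hnz : h != 0 by exact: separable_poly_neq0.
have [h1|h1] := leqP (size h) 1.
  have hu : h %= 1 by rewrite -size_poly_eq1 eqn_leq h1 size_poly_gt0.
  by exists 0; rewrite (eqp_dvdl _ hu) dvd1p.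
have [g g_irr gh] := exists_irreducible_factor h1.
have [sg sgP] := loc g g_irr gh.
have [h' hE] := dvdpP _ _ gh.
have := sep; rewrite hE separable_mul => /and3P[sep' _ cop].
have g1 : (1 < size g)%N by case: g_irr.
have [h'0 g0] : h' != 0 /\ g != 0 by apply/andP; rewrite -negb_or -mulf_eq0 -hE.
have h'n : (size h' < n)%N.
  rewrite -ltnS; apply: leq_trans hn; rewrite hE size_mul // -(prednK (ltnW g1)) addnS /=.
  by rewrite ltnS -[X in (X < _)%N]addn0 ltn_add2l -ltnS prednK // ltnW.
have loc' k : irreducible_poly k -> k %| h' -> exists s, k %| s ^+ 2 - q.
  by move=> k_irr kh'; apply: loc => //; rewrite hE dvdp_mulr.
have [s sP] := IH h' h'n sep' loc'.
have [[a b] /= ab] := Bezout_eq1_coprimepP _ _ cop.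
exists (s * (b * g) + sg * (a * h')); rewrite Gauss_dvdp //; apply/andP; split.
  have -> : (s * (b * g) + sg * (a * h')) ^+ 2 - q =
      s ^+ 2 - q + h' * (a * (sg - s) * (s + (s * (b * g) + sg * (a * h')))).
    have -> : b * g = 1 - a * h' by rewrite -ab; ring.
    ring.
  by apply: dvdp_add => //; exact: dvdp_mulIl.
have -> : (s * (b * g) + sg * (a * h')) ^+ 2 - q =
    sg ^+ 2 - q + g * (b * (s - sg) * (sg + (s * (b * g) + sg * (a * h')))).
  have -> : a * h' = 1 - b * g by rewrite -ab; ring.
  ring.
by apply: dvdp_add => //; exact: dvdp_mulIl.
Qed.

End PolySqrt.

(** * From square roots modulo primes to square roots modulo elements of the order *)

Section SquaresModulo.
Variables (K : fieldExtType rat) (theta : K) (f : {poly int}).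
Local Notation d := (\dim {:K}).
Hypotheses (f_monic : f \is monic) (f_size : size f = d.+1).
Hypotheses (f_root : evZ theta f = 0) (gen : <<1; theta>>%VS = {:K}%VS).
Local Notation R := (int_order theta).
Local Notation ev := (evZ theta).

(** Clearing denominators in a Bezout relation between f and its derivative gives an integer whose
    prime divisors are the only ones to avoid. *)
Lemma separable_mod : exists2 D1 : nat, (0 < D1)%N & forall p, prime p -> ~~ (p %| D1)%N ->
  separable_poly (map_poly (intr : int -> 'F_p) f).
Proof.
pose fQ := map_poly (intr : int -> rat) f.
have fQ_size : size fQ = d.+1 by rewrite size_map_inj_poly //; exact: intr_inj.
have sep : separable_poly fQ.
  rewrite -(separable_map (in_alg K)) -(@eqp_separable _ (minPoly 1 theta)).
    by apply: pcharf0_separable => p; rewrite (pchar_lalg K) pchar_num.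
  have dv : minPoly 1 theta %| map_poly (in_alg K) fQ.
    by apply: minPoly_dvdp; [exact: alg_polyOver | apply/rootP].
  by rewrite -dvdp_size_eqp // size_minPoly size_map_poly fQ_size adjoin_degreeE gen dimv1 divn1.
have cop : coprimep fQ fQ^`() by move: sep; rewrite unlock.
have [[A B] /= AB] := Bezout_eq1_coprimepP _ _ cop.
have [A' [a a0 AE]] := rat_poly_scale A; have [B' [b b0 BE]] := rat_poly_scale B.
have ABZ : b *: A' * f + a *: B' * f^`() = (a * b)%:P.
  apply: (@map_inj_poly _ _ (intr : int -> rat)) => //; first exact: intr_inj.
  have A'E : map_poly intr A' = a%:~R *: A by rewrite AE scalerA mulfV ?intr_eq0 // scale1r.
  have B'E : map_poly intr B' = b%:~R *: B by rewrite BE scalerA mulfV ?intr_eq0 // scale1r.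
  rewrite rmorphD !rmorphM /= !map_polyZ /= -deriv_map -/fQ A'E B'E !scalerA -!scalerAl.
  by rewrite [b%:~R * _]mulrC -scalerDr AB !map_polyC /= -polyCM alg_polyC.
exists (absz (a * b)); first by rewrite absz_gt0 mulf_neq0.
move=> p pr pD; have ABp := congr1 (map_poly (intr : int -> 'F_p)) ABZ.
rewrite rmorphD /= map_polyC /= [X in X + _]rmorphM [X in _ + X]rmorphM /= -deriv_map in ABp.
have ab0 : (a * b)%:~R != 0 :> 'F_p by rewrite Fp_intr_eq0.
rewrite unlock; apply/Bezout_coprimepP.
exists (map_poly intr (b *: A'), map_poly intr (a *: B')).
by rewrite /= ABp; apply/eqpP; exists (1, (a * b)%:~R) => /=; rewrite ?oner_neq0 ?ab0 // scale1r alg_polyC.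
Qed.

Variables (u D2 U : K) (Fu : {poly int}) (D0 : nat).
Hypotheses (uE : u = ev Fu) (D2R : D2 \in R) (UR : U \in R).
Hypotheses (D0_gt0 : (0 < D0)%N) (D0_two : D0%:R = 2 * D2) (D0_u : D0%:R = u * U).
Hypothesis sqrt_mod_prime : forall p, prime p -> ~~ (p %| D0)%N ->
  exists s : {poly 'F_p}, map_poly intr f %| s ^+ 2 - map_poly intr Fu.

Let natK0 n : (0 < n)%N -> n%:R != 0 :> K.
Proof. by rewrite number_field_natr_eq0 -lt0n. Qed.

Let uR : u \in R. Proof. by rewrite uE evZ_order. Qed.

Lemma order_sqrt_mod_prime p : prime p -> ~~ (p %| D0)%N ->
  exists2 s, s \in R & divides R p%:R (s ^+ 2 - u).
Proof.
move=> pr pD; have [s /dvdpP[q qE]] := sqrt_mod_prime pr pD.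
have [S SE] := bar_lift s; have [Q QE] := bar_lift q.
exists (ev S); first exact: evZ_order.
have /bar_eq0[//|G GE] : map_poly (intr : int -> 'F_p) (S ^+ 2 - Fu - Q * f) = 0.
  by rewrite !rmorphB rmorphXn rmorphM /= SE QE qE subrr.
have -> : ev S ^+ 2 - u = p%:R * ev G.
  rewrite uE expr2 -evZM -evZB -(evZ_nat theta p) -evZM.
  have -> : S * S - Fu = p%:R * G + Q * f.
    by rewrite -[LHS](subrK (Q * f)) -expr2 GE scaler_nat mulr_natl.
  by rewrite evZD [ev (Q * f)]evZM f_root mulr0 addr0.
by apply: divides_mulR; rewrite ?evZ_order ?natK0 ?prime_gt0.
Qed.

Lemma order_sqrt_mod_nat m : (0 < m)%N -> coprime m D0 ->
  exists2 s, s \in R & divides R m%:R (s ^+ 2 - u).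
Proof.
elim/ltn_ind: m => m IH m0 cop.
have [m1|m1] := leqP m 1.
  by exists 0; rewrite ?rpred0 // (_ : m = 1%N) ?/divides ?divr1 ?rpredB ?rpredX ?rpred0 //; lia.
have pr := pdiv_prime m1; set p := pdiv m in pr.
have [n mE] : exists n, m = (n * p)%N by apply/dvdnP; exact: pdiv_dvd.
have p1 := prime_gt1 pr; have p0 := prime_gt0 pr.
have n0 : (0 < n)%N by move: m0; rewrite mE muln_gt0 => /andP[].
have [copn copp] : coprime n D0 /\ coprime p D0.
  by apply/andP; move: cop; rewrite mE coprimeMl.
have nm : (n < m)%N by rewrite mE -[X in (X < _)%N]muln1 ltn_pmul2l.
have [s sR sn] := IH n nm n0 copn.
have nK := natK0 n0; have pK := natK0 p0.
have [pn|pn] := boolP (p %| n)%N.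
  have sp : divides R p%:R (s ^+ 2 - u).
    apply: divides_trans nK _ sn; have [k ->] := dvdnP pn.
    by rewrite natrM mulrC divides_mulR ?rpred_nat.
  have [q [j qj]] : exists q j : nat, (q * D0 = j * p + 1)%N.
    by apply: coprime_bezout_nat; rewrite // coprime_sym.
  set c := (s ^+ 2 - u) / n%:R in sn.
  have cR : c \in R by exact: sn.
  have sE : s ^+ 2 - u = n%:R * c by rewrite /c mulrCA mulfV // mulr1.
  (* Newton's step from n to n p: as s ^ 2 = u modulo p, 2 s k is (q D0) ^ 2 = 1 there. The
     quadratic error is also divisible by n p because p divides n. *)
  pose k := s * U * D2 * q%:R ^+ 2.
  have kR : k \in R by rewrite /k !rpredM ?rpredX ?rpred_nat.
  exists (s - n%:R * (c * k)); first by rewrite rpredB // rpredM ?rpred_nat // rpredM.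
  have inv : divides R p%:R (2 * s * k - 1).
    have -> : 2 * s * k - 1 = (s ^+ 2 - u) * (U * (2 * D2) * q%:R ^+ 2) +
        ((q * D0)%:R ^+ 2 - 1).
      have D0sq : D0%:R ^+ 2 = u * U * (2 * D2) by rewrite -D0_u -D0_two expr2.
      by rewrite natrM exprMn D0sq /k; ring.
    apply: dividesD.
      by apply: divides_mulr => //; rewrite -D0_two; do !apply: rpredM; rewrite ?rpredX ?rpred_nat.
    have -> : (q * D0)%:R ^+ 2 - 1 = p%:R * (j%:R * ((j * p)%:R + 2)) :> K.
      by rewrite qj natrD natrM; ring.
    by apply: divides_mulR => //; apply: rpredM; rewrite ?rpred_nat //; apply: rpredD; rewrite rpred_nat.
  have [l pl] := dvdnP pn.
  have -> : (s - n%:R * (c * k)) ^+ 2 - u = n%:R * (- c * (2 * s * k - 1) + n%:R * (c * k) ^+ 2).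
    have -> : (s - n%:R * (c * k)) ^+ 2 - u =
       (s ^+ 2 - u) - 2 * s * (n%:R * (c * k)) + n%:R ^+ 2 * (c * k) ^+ 2 by ring.
    by rewrite sE; ring.
  set X := - c * (2 * s * k - 1) + n%:R * (c * k) ^+ 2.
  have pX : divides R p%:R X.
    apply: dividesD; first by rewrite divides_mull ?rpredN.
    rewrite pl natrM -mulrA mulrCA divides_mulR //.
    by rewrite rpredM ?rpred_nat // rpredX // rpredM.
  have -> : divides R m%:R (n%:R * X) = divides R p%:R X; last exact: pX.
  by rewrite /divides (_ : n%:R * X / m%:R = X / p%:R) // mE natrM; field; rewrite nK pK.
have pD : ~~ (p %| D0)%N by rewrite -prime_coprime.
have [t tR tp] := order_sqrt_mod_prime pr pD.
have [a [b ab]] : exists a b : nat, (a * p = b * n + 1)%N.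
  by apply: coprime_bezout_nat; rewrite // prime_coprime.
pose b' : K := - b%:R.
have one : a%:R * p%:R + b' * n%:R = 1.
  by rewrite /b' mulNr -!natrM ab natrD addrAC subrr add0r.
have apE : a%:R * p%:R = 1 - b' * n%:R by apply/eqP; rewrite eq_sym subr_eq one.
have bnE : b' * n%:R = 1 - a%:R * p%:R by apply/eqP; rewrite eq_sym subr_eq addrC one.
have b'R : b' \in R by rewrite rpredN rpred_nat.
(* Chinese remainders: x is s modulo n and t modulo p. *)
pose x := s * (a%:R * p%:R) + t * (b' * n%:R).
have xR : x \in R by rewrite /x rpredD // !rpredM ?rpred_nat.
exists x => //.
have xn : divides R n%:R (x ^+ 2 - u).
  have -> : x ^+ 2 - u = (s ^+ 2 - u) + n%:R * (b' * (t - s) * (x + s)).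
    have -> : x = s + n%:R * (b' * (t - s)).
      by rewrite /x apE; ring.
    ring.
  apply: dividesD => //; apply: divides_mulR => //.
  by apply: rpredM; [apply: rpredM => //; exact: rpredB | exact: rpredD].
have xp : divides R p%:R (x ^+ 2 - u).
  have -> : x ^+ 2 - u = (t ^+ 2 - u) + p%:R * (a%:R * (s - t) * (x + t)).
    have -> : x = t + p%:R * (a%:R * (s - t)).
      by rewrite /x bnE; ring.
    ring.
  apply: dividesD => //; apply: divides_mulR => //.
  by apply: rpredM; [apply: rpredM; [exact: rpred_nat | exact: rpredB] | exact: rpredD].
rewrite /divides (_ : _ / _ = a%:R * ((x ^+ 2 - u) / n%:R) + b' * ((x ^+ 2 - u) / p%:R)).
  by rewrite rpredD // rpredM ?rpred_nat.
have -> : (x ^+ 2 - u) / m%:R = (a%:R * p%:R + b' * n%:R) * (x ^+ 2 - u) / m%:R.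
  by rewrite one mul1r.
by rewrite mE natrM; field; rewrite nK pK.
Qed.

(** The least positive integer multiple m of M is prime to D0: a common prime factor could be
    cancelled from m, since M is 1 modulo it. A root modulo m is then one modulo M. *)
Lemma order_sqrt_mod M : M \in R -> M != 0 -> divides R D0%:R (M - 1) ->
  exists2 s, s \in R & divides R M (s ^+ 2 - u).
Proof.
move=> MR M0 MD.
pose Q n := (0 < n)%N && (divides R M n%:R).
have exQ : exists n, Q n.
  have [n n0 h] := order_scale gen M^-1; exists n; rewrite /Q n0.
  by rewrite /divides.
case: (ex_minnP exQ) => m /andP[m0 Mm] mmin.
have cop : coprime m D0.
  apply: contraT; rewrite /coprime => g1.
  have g_gt1 : (1 < gcdn m D0)%N by rewrite ltn_neqAle eq_sym g1 gcdn_gt0 m0.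
  have pr := pdiv_prime g_gt1; set q := pdiv _ in pr.
  have qg : (q %| gcdn m D0)%N by exact: pdiv_dvd.
  have [n mE] := dvdnP (dvdn_trans qg (dvdn_gcdl _ _)).
  have [D1 DE] := dvdnP (dvdn_trans qg (dvdn_gcdr _ _)).
  have qK := natK0 (prime_gt0 pr).
  have D0K := natK0 D0_gt0.
  have n0 : (0 < n)%N by move: m0; rewrite mE muln_gt0 => /andP[].
  have : (m <= n)%N; last first.
    by rewrite mE -[X in (_ <= X)%N]muln1 leq_pmul2l // leqNgt prime_gt1.
  apply: mmin; rewrite /Q n0 /divides /=.
  set c := m%:R / M; set e := (M - 1) / D0%:R.
  have cR : c \in R by exact: Mm. 
  have eR : e \in R by exact: MD.
  have -> : n%:R / M = n%:R - D1%:R * e * c.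
    apply: (mulfI qK); rewrite /c /e mE DE !natrM; field.
    rewrite M0 qK /=; move: D0K; rewrite DE natrM mulf_eq0 negb_or => /andP[-> _] //.
  by apply: rpredB; rewrite ?rpred_nat //; apply: rpredM => //; apply: rpredM; rewrite ?rpred_nat.
have [s sR sm] := order_sqrt_mod_nat m0 cop; exists s => //.
exact: divides_trans (natK0 m0) Mm sm.
Qed.

End SquaresModulo.

(** * Independence of local functionals *)

(** If all symbols were trivial, u would be a square modulo each irreducible factor of f modulo p,
    for every p not dividing D0. Gluing and lifting these roots contradicts the counting. *)
Lemma exists_nontrivial_functional (K : fieldExtType rat) (v : sqclass K) : v != 0 ->
  exists (w : finite_place K) (b : sqclass (completion w)), local_functional b v = 1.
Proof.
elim/quotW: v => x x_nsq; apply: contrapT => triv.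
have natK n : (n%:R == 0 :> K) = (n == 0%N) := number_field_natr_eq0 K n.
have [theta [f [f_monic f_size f_root gen]]] := integral_generator K.
have x0 : val x != 0 := valP x.
have [n n0 nx] := order_scale gen (val x).
have nK : n%:R != 0 :> K by rewrite natK -lt0n.
(* One factor n puts x into the order; the second keeps the square class. *)
pose u := n%:R * (n%:R * val x).
have u0 : u != 0 by rewrite !mulf_neq0.
have uR : u \in int_order theta by rewrite rpredM ?rpred_nat.
have xy : \pi_(sqclass K) x = \pi_(sqclass K) (Nonzero u0).
  by apply/eqP/eq_sqclassP; exists n%:R^-1; rewrite /u /= exprVn mulrA -expr2 mulrAC mulfV ?expf_neq0 ?mul1r.
have u_nsq z : z ^+ 2 != u.
  apply: contraNneq x_nsq => zu; rewrite xy -[0]/(\pi_(sqclass K) (Defs.nonzero1 K)).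
  by apply/eqP/eqP/eq_sqclassP; exists z; rewrite /= mul1r zu.
have /asboolP[Fu uE] := uR.
have [D1 D1_gt0 D1_sep] := separable_mod f_size f_root gen.
have [m m0 mR] := order_scale gen u^-1.
(* D1 keeps f separable modulo the primes outside D0; the factors 2 and m, where m / u lies in the
   order, make 2 and u divide D0. *)
pose D0 := (2 * (D1 * m))%N.
have D0_gt0 : (0 < D0)%N by rewrite !muln_gt0 D1_gt0 m0.
pose D2 : K := (D1 * m)%:R; pose U := (2 * D1)%:R * (m%:R * u^-1).
have D2R : D2 \in int_order theta by exact: rpred_nat.
have UR : U \in int_order theta by rewrite rpredM ?rpred_nat.
have D0_two : D0%:R = 2 * D2 by rewrite /D0 natrM.
have D0_u : D0%:R = u * U by rewrite /D0 /U !natrM; field.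
apply: (order_counting f_monic f_size f_root gen uR D2R UR D0_gt0 D0_two D0_u u_nsq).
apply: (order_sqrt_mod f_monic f_size f_root gen uE D2R UR D0_gt0 D0_two D0_u) => p pr pD.
have D1p : ~~ (p %| D1)%N.
  by apply: contra pD => pD1; rewrite /D0 dvdn_mull // dvdn_mulr.
have sep := D1_sep p pr D1p.
apply: sqrt_mod_separable => // g g_irr g_dvd; apply: contrapT => nsq; apply: triv.
rewrite xy; apply: (prime_place_nonnorm f_monic f_size f_root gen pr g_irr g_dvd sep (Fu := Fu)).
  by move=> s; apply/negP => gs; apply: nsq; exists s.
by rewrite -uE.
Qed.

Section Functionals.
Variable K : fieldExtType rat.

Lemma number_field_functionalD (w : finite_place K) (b : sqclass (completion w)) u v :
  local_functional b (u + v) = local_functional b u + local_functional b v.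
Proof.
have two0 : 2 != 0 :> K by rewrite (number_field_natr_eq0 K 2).
exact: local_functionalD two0 (number_field_finite_residue w) b u v.
Qed.

Lemma number_field_functional0 (w : finite_place K) (b : sqclass (completion w)) :
  local_functional b 0 = 0.
Proof. by apply: (addrI (local_functional b 0)); rewrite -number_field_functionalD !addr0. Qed.

Lemma number_field_functionalZ (w : finite_place K) (b : sqclass (completion w)) (a : 'F_2) u :
  local_functional b (a *: u) = a * local_functional b u.
Proof.
have [->|->] : a = 0 \/ a = 1.
- by case: a => [[|[|//]] ha]; [left|right]; apply: val_inj.
- by rewrite scale0r mul0r number_field_functional0.
- by rewrite scale1r mul1r.
Qed.

Lemma number_field_functional_sum (w : finite_place K) (b : sqclass (completion w)) n
    (c : 'I_n -> 'F_2) (e : 'I_n -> sqclass K) :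
  local_functional b (\sum_i c i *: e i) = \sum_i c i * local_functional b (e i).
Proof.
elim/big_ind2: _ => [|x a y b' xa yb|i _]; first exact: number_field_functional0.
  by rewrite number_field_functionalD xa yb.
exact: number_field_functionalZ.
Qed.

Variables (r : nat) (w : 'I_r -> finite_place K) (b : forall i, sqclass (completion (w i))).

Lemma functional_mapD u v : functional_map b (u + v) = functional_map b u + functional_map b v.
Proof. by apply/rowP => i; rewrite !mxE number_field_functionalD. Qed.

Lemma functional_mapZ a u : functional_map b (a *: u) = a *: functional_map b u.
Proof. by apply/rowP => i; rewrite !mxE number_field_functionalZ. Qed.

End Functionals.

(** * Independent functionals from a separating family *)

Section DualBasis.
Variables (F : fieldType) (r : nat) (Phi : Type) (phi : Phi -> 'I_r -> F).
Hypothesis phi_sep : forall c : 'I_r -> F, (exists l, c l != 0) ->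
  exists o, \sum_l c l * phi o l != 0.

(** For j < r some nonzero vector c is annihilated by the first j functionals; one that does not
    vanish on c is independent of them. *)
Lemma exists_independent_family j : (j <= r)%N -> exists o : 'I_j -> Phi,
  forall x : 'I_j -> F, (forall l, \sum_i x i * phi (o i) l = 0) -> forall i, x i = 0.
Proof.
elim: j => [|j IH] jr.
  by exists (fun i : 'I_0 => False_rect Phi (notF (ltn_ord i))) => x _ [].
have [o oP] := IH (ltnW jr).
pose A : 'M[F]_(j, r) := \matrix_(i, l) phi (o i) l.
have [c [c_neq0 cA]] : exists c : 'I_r -> F, (exists l, c l != 0) /\
    forall i, \sum_l c l * phi (o i) l = 0.
  have ker0 : kermx A^T != 0.
    rewrite -mxrank_eq0 mxrank_ker mxrank_tr -lt0n subn_gt0.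
    exact: leq_ltn_trans (rank_leq_row _) jr.
  have /rowV0Pn[v /sub_kermxP vA v0] := ker0; exists (fun l => v ord0 l); split.
    apply/existsP; apply: contraNT v0; rewrite negb_exists => /forallP vl.
    by apply/eqP/rowP => l; rewrite mxE; apply/eqP; rewrite -[_ == _]negbK vl.
  move=> i; have /rowP/(_ i) := vA; rewrite !mxE; apply: etrans.
  by apply: eq_bigr => l _; rewrite !mxE.
have [o0 o0P] := phi_sep c_neq0.
exists (fun i => oapp o o0 (unlift ord0 i)) => x xP.
have x_sum l : x ord0 * phi o0 l + \sum_i x (lift ord0 i) * phi (o i) l = 0.
  have := xP l; rewrite big_ord_recl unlift_none /= => h; rewrite -[RHS]h; congr (_ + _).
  by apply: eq_bigr => i _; rewrite liftK.
have x0 : x ord0 = 0.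
  have : \sum_l c l * (x ord0 * phi o0 l + \sum_i x (lift ord0 i) * phi (o i) l) = 0.
    by rewrite big1 // => l _; rewrite x_sum mulr0.
  under eq_bigr do rewrite mulrDr.
  rewrite big_split /= [X in _ + X](_ : _ = 0) ?addr0.
    under eq_bigr do rewrite mulrCA.
    by rewrite -mulr_sumr => /eqP; rewrite mulf_eq0 (negPf o0P) orbF => /eqP.
  under eq_bigr do rewrite mulr_sumr.
  rewrite exchange_big big1 // => i _.
  under eq_bigr do rewrite mulrCA.
  by rewrite -mulr_sumr cA mulr0.
have xl : forall i, x (lift ord0 i) = 0.
  by apply: oP => l; rewrite -[RHS](x_sum l) x0 mul0r add0r.
by move=> i; case: (unliftP ord0 i) => [k ->|->].
Qed.

End DualBasis.

Lemma exists_functional_iso (K : fieldExtType rat) (r : nat) (W : {pred sqclass K}) :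
  subspace_of_dim W r ->
  exists (w : 'I_r -> finite_place K) (b : forall i, sqclass (completion (w i))),
    linear_iso W predT (functional_map b).
Proof.
move=> [[W0 Wlin] [e [eW efree espan]]].
pose Phi := {w : finite_place K & sqclass (completion w)}.
pose phi (o : Phi) l := local_functional (projT2 o) (e l).
have phi_sep (c : 'I_r -> 'F_2) : (exists l, c l != 0) -> exists o : Phi, \sum_l c l * phi o l != 0.
  move=> [l cl]; have u0 : \sum_l c l *: e l != 0.
    by apply: contraNneq cl => /efree ->.
  have [w [b wb]] := exists_nontrivial_functional u0.
  by exists (existT _ w b); rewrite /phi -number_field_functional_sum wb oner_neq0.
have [o oP] := exists_independent_family phi_sep (leqnn r).
pose b i := projT2 (o i); exists (fun i => projT1 (o i)), b.
pose A : 'M['F_2]_r := \matrix_(i, l) phi (o i) l.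
have A_unit : A \in unitmx.
  rewrite -row_free_unit -kermx_eq0; apply/rowV0P => x /sub_kermxP xA.
  apply/rowP => i; rewrite mxE; apply: oP => l.
  by have /rowP/(_ l) := xA; rewrite !mxE => {2}<-; apply: eq_bigr => k _; rewrite mxE.
have mapE (c : 'I_r -> 'F_2) : functional_map b (\sum_l c l *: e l) = (\row_l c l) *m A^T.
  apply/rowP => i; rewrite !mxE number_field_functional_sum.
  by apply: eq_bigr => l _; rewrite !mxE.
have AT_unit : A^T \in unitmx by rewrite unitmx_tr.
split; last by move=> a u v _ _; rewrite functional_mapD functional_mapZ.
split=> // [u v /espan[c ->] /espan[c' ->]|y _].
  rewrite !mapE => /(can_inj (mulmxK AT_unit)) cc'.
  by apply: eq_bigr => l _; have /rowP/(_ l) := cc'; rewrite !mxE => ->.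
pose c := y *m invmx A^T; exists (\sum_l c ord0 l *: e l).
  elim/big_ind: _ => // [u v uW vW|l _]; first by rewrite -[u]scale1r Wlin.
  by rewrite -[_ *: _]addr0 Wlin.
by rewrite mapE (_ : \row_l c ord0 l = c) ?mulmxKV //; apply/rowP => l; rewrite mxE.
Qed.

Theorem theorem7p2 (K : fieldExtType rat) (r : nat) (W : {pred sqclass K})
    (dimW : subspace_of_dim W r) :
  (exists (w : 'I_r -> finite_place K) (b : forall i, sqclass (completion (w i))),
     linear_iso W predT (functional_map b)) /\
  (forall (u0 : sqclass K) (w : 'I_r -> finite_place K)
      (b : forall i, sqclass (completion (w i))),
     linear_iso W predT (functional_map b) ->
     [/\ affine_iso u0 W (functional_map b u0) predT (functional_map b),
         exists s : seq (sqclass K),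
           [/\ uniq s, size s = (2 ^ r)%N & s =i affine_coset u0 W]
       & {in affine_coset u0 W &, forall u v,
           (forall i, local_functional (b i) u = local_functional (b i) v) ->
           u = v}]).
Proof.
split; first exact: exists_functional_iso.
move=> u0 w b isoW; have [[_ inj surj] lin] := isoW.
have inj_coset : {in affine_coset u0 W &, injective (functional_map b)}.
  move=> x y xW yW fxy; apply: (addIr (- u0)); apply: inj => //.
  by apply: (addIr (functional_map b u0)); rewrite -!functional_mapD !subrK.
split.
- split; last by exists (functional_map b), (functional_map b u0); split=> // x _; exact: functional_mapD.
  split=> // y _; have [x xW fx] := surj (y - functional_map b u0) isT.
  exists (u0 + x); first by rewrite inE addrAC subrr add0r.
  by rewrite functional_mapD fx addrC subrK.
(* The inverse isomorphism, translated by [u0], enumerates the coset by the 2 ^ r row vectors. *)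
- have /choice[h hP] : forall y, exists x, x \in W /\ functional_map b x = y.
    by move=> y; have [x xW fx] := surj y isT; exists x.
  exists [seq u0 + h y | y <- enum {: 'rV['F_2]_r}]; split.
  + rewrite map_inj_uniq ?enum_uniq // => y z /addrI hyz.
    by have [_ <-] := hP y; have [_ <-] := hP z; rewrite hyz.
  + by rewrite size_map -cardT card_mx mul1n card_Fp.
  + move=> x; rewrite inE; apply/mapP/idP => [[y _ ->]|xW].
      by rewrite addrAC subrr add0r; have [] := hP y.
    exists (functional_map b (x - u0)); first by rewrite mem_enum.
    have [hW hE] := hP (functional_map b (x - u0)).
    by rewrite (inj _ _ hW xW hE) addrC subrK.
- move=> u v uW vW uv; apply: inj_coset => //; apply/rowP => i.
  by rewrite !mxE uv.
Qed.
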